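(* Suppose that (Model), (RegVar) and (Hölder), defined in the context, hold. Assume $c\in C^2([0,1])$ and let the kernel $K$ in the definition of $\hat c_n$ be Lipschitz-continuous. (a) If additionally (Mix), (Mom$_L$) and (Inc$_L$) with $L=2$, (SecOrd) and (Band), defined in the context, hold, and if $k$ satisfies $\sqrt k\,A(\tfrac n{2k})\to0$, then $\hat\tau_n=\tau+o_{\Pr}(1)$ as $n\to\infty$. (b) If additionally (Mix), and (Mom$_L$) and (Inc$_L$) for all $L\in\mathbb N$, hold with $k$ replaced by $k'$, if (SecOrd) holds, if $k'$ satisfies $\sqrt{k'}A(\tfrac n{Lk'})\to0$ for all $L\in\mathbb N$, and if (ExtInd), (Block) and (UI) hold, then $\hat T_n=\theta^{-1}\tau+o_{\Pr}(1)$ as $n\to\infty$. In particular, if (Model), (RegVar), (Hölder), (SecOrd), (Band), (ExtInd), (Block) and (UI) hold, if $c\in C^2([0,1])$ and $K$ is Lipschitz-continuous, if (Mix), (Mom$_L$) and (Inc$_L$) with $L=2$ hold for $k$ and $\sqrt k\,A(\tfrac n{2k})\to0$, and if (Mix), and (Mom$_L$) and (Inc$_L$) for all $L\in\mathbb N$, hold with $k$ replaced by $k'$ and $\sqrt{k'}A(\tfrac n{Lk'})\to0$ for all $L\in\mathbb N$, then $\hat\theta_n=\hat T_n^{-1}\hat\tau_n$ converges to $\theta$ in probability as $n\to\infty$.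
   Context: All limits are for $n\to\infty$; $\|\cdot\|_\infty$ is the sup-norm. $k=k_n$ is an increasing integer sequence with $k\to\infty$, $k=o(n)$. $X_{n,1}\le\dots\le X_{n,n}$ are the order statistics of $X_1^{(n)},\dots,X_n^{(n)}$. (Model) For each $n$ we observe real random variables $X_1^{(n)},\dots,X_n^{(n)}$, where $X_i^{(n)}$ has continuous c.d.f. $F_{n,i}$. All $F_{n,i}$ share a common right endpoint $x^*=\sup\{x:F_{n,i}(x)<1\}$. There are a continuous c.d.f. $F$ with the same right endpoint $x^*$, strictly increasing on its support, and a positive function $c$ on $[0,1]$ (the scedasis function), which is a bounded continuous probability density, such that $\lim_{x\uparrow x^*}\frac{1-F_{n,i}(x)}{1-F(x)}=c(i/n)$ for all $n$ and $1\le i\le n$. Put $U_i^{(n)}=F_{n,i}(X_i^{(n)})$; for each $n$, $U_1^{(n)},\dots,U_n^{(n)}$ is an excerpt from a strictly stationary time series $(U_t^{(n)})_{t\in\mathbb Z}$ whose law does not depend on $n$; $(U_t)_{t\in\mathbb Z}$ denotes a generic version (with uniform$(0,1)$ margins). (RegVar) The stationary process $Z_t=1/(1-U_t)$ (standard Pareto margins) is regularly varying (necessarily with index $1$), i.e. its finite-dimensional distributions are multivariate regularly varying. (Hölder) There is $K_c>0$ with $|c(s)-c(s')|\le K_c|s-s'|^{1/2}$ for all $s,s'\in[0,1]$. (Mix) There are integer sequences $1<\ell_n<r=r_n<n$, both tending to infinity, with $\ell_n=o(r)$ and $r=o(\sqrt k\wedge\tfrac nk)$, such that the beta-mixing coefficients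 of $(U_t)_{t\in\mathbb Z}$ satisfy $\beta(n)=o(1)$ and $\tfrac nr\beta(\ell_n)=o(1)$. (Mom$_L$) With $c_\infty(L)=1+L\|c\|_\infty$, there is $\delta>0$ with $\mathrm E\big[\{\sum_{s=1}^r\mathbf 1(U_s>1-\tfrac knc_\infty(L))\}^{2+\delta}\big]=O(r\tfrac kn)$. (Inc$_L$) There is a non-decreasing continuous function $g:[0,c_\infty(L)]\to[0,\infty)$, positive on $(0,c_\infty(L)]$, $g(0)=0$, such that for all sufficiently large $n$, $\mathrm E\big[\{\sum_{s=1}^r\mathbf 1(1-\tfrac knx\ge U_s>1-\tfrac kny)\}^2\big]\le r\tfrac kn\,g(y-x)$ for all $0\le x\le y\le c_\infty(L)$. (SecOrd) There is a positive, eventually decreasing function $A$ with $\lim_{t\to\infty}A(t)=0$ such that, as $x\uparrow x^*$, $\sup_{n\in\mathbb N}\max_{1\le i\le n}\big|\frac{1-F_{n,i}(x)}{1-F(x)}-c(\tfrac in)\big|=O\big(A\big(\tfrac1{1-F(x)}\big)\big)$. (Band) The bandwidth $h=h_n>0$ satisfies $h\to0$, $kh\to\infty$, $k^{1/5}h\to\lambda\ge0$, $r=o(\sqrt{kh})$ and $h\ge k^{-1/3}$. (ExtInd) $(U_t)_{t\in\mathbb Z}$ has an extremal index $\theta\in(0,1]$: for every $\tau'>0$, $\lim_{n\to\infty}\Pr(\max_{1\le i\le n}U_i\le1-\tau'/n)=e^{-\theta\tau'}$. (Block) The block size $q=q_n\in\mathbb N$ satisfies $q\to\infty$, $q=o(\sqrt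 n)$ and $n\beta(q)=o(q)$, where $\beta$ denotes the beta-mixing coefficients of $(U_t)_{t\in\mathbb Z}$. Put $k'=\lfloor n/q\rfloor$, $I_j'=\{(j-1)q+1,\dots,jq\}$ for $j=1,\dots,k'$, and $$Z_{n,j}=q\{1-\max_{i\in I_j'}F(X_i^{(n)})\},\quad\hat Z_{n,j}=q\{1-\max_{i\in I_j'}\hat F_n(X_i^{(n)})\},\quad\hat F_n(x)=\frac1n\sum_{i=1}^n\mathbf 1(X_i^{(n)}\le x).$$ (UI) For some $\delta_1>0$, $\limsup_{n\to\infty}\sup_{\xi\in(0,1)}\mathrm E\big[|Z_{n,1+\lfloor\xi k'\rfloor}|^{2+\delta_1}\big]<\infty$. Scedasis estimator. $K$ is a continuous, symmetric function on $[-1,1]$ with $K(x)=0$ for $|x|>1$ and $\int_{-1}^1K=1$. Set $$\tilde c_n(s)=\frac1{kh}\sum_{i=1}^n\mathbf 1(X_i^{(n)}>X_{n,n-k})\,K_b\Big(\frac{s-i/n}h,s\Big),\qquad s\in[0,1],$$ where, for $p\in[0,1]$, $a_j(p)=\int_{-1}^px^jK(x)\,\mathrm dx$, $b_j(p)=\int_{-p}^1x^jK(x)\,\mathrm dx$, and for $s=ph\le h$: $K_b(x,s)=\frac{a_2(p)-a_1(p)x}{a_0(p)a_2(p)-a_1^2(p)}K(x)$; for $s=1-ph\ge1-h$: $K_b(x,s)=\frac{b_2(p)-b_1(p)x}{b_0(p)b_2(p)-b_1^2(p)}K(x)$; for $s\in(h,1-h)$: $K_b(x,s)=K(x)$, in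 each case for $x\in[-1,1]$ (and $K_b(x,s)=0$ for $|x|>1$). The definition presupposes nonzero denominators. Let $c_{\min}>0$ be such that $c(s)>c_{\min}$ for all $s\in[0,1]$, fix $0<\kappa<c_{\min}$ and set $\hat c_n=\max(\tilde c_n,\kappa)$. Finally, $\tau=\int_0^1c(\xi)^{-1}\,\mathrm d\xi$, $\hat\tau_n=\int_0^1\hat c_n(\xi)^{-1}\,\mathrm d\xi$, $\hat T_n=\frac1{k'}\sum_{j=1}^{k'}\hat Z_{n,j}$, $\hat\theta_n=\hat T_n^{-1}\hat\tau_n$. *)

(* Defs.v *)
From HB Require Import structures.
From mathcomp Require Import all_boot all_order all_algebra.
From mathcomp Require Import all_classical all_reals all_analysis.

Set Implicit Arguments.
Unset Strict Implicit.
Unset Printing Implicit Defensive.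

Import Order.TTheory GRing.Theory Num.Theory.
Import numFieldNormedType.Exports.

Local Open Scope classical_set_scope.
Local Open Scope ring_scope.

Section distribution_functions.
Context {R : realType}.

Definition cdfR d (T : measurableType d) (P : probability T R)
  (X : {RV P >-> R}) (x : R) : R := fine (cdf X x).

Definition right_endpoint (G : R -> R) : \bar R :=
  ereal_sup [set x%:E | x in [set x | G x < 1]].

(* The filter of left neighbourhoods "x increases to xs", for xs finite or
   infinite. *)
Definition left_of (xs : \bar R) : set_system R :=
  filter_from [set y : R | (y%:E < xs)%E]
    (fun y => [set x : R | y < x /\ (x%:E < xs)%E]).

(* The (topological) support of the law with c.d.f. G. *)
Definition cdf_support (G : R -> R) : set R :=
  [set x | forall e : R, 0 < e -> G (x - e) < G (x + e)].

End distribution_functions.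

Section processes.
Context {R : realType}.

Definition path_at d (T : measurableType d) (P : probability T R)
    (U : int -> {RV P >-> R}) m (t : 'I_m -> int) (w : T) : 'rV[R]_m :=
  \row_i U (t i) w.

(* Equality of the finite-dimensional distributions, on all Borel sets of
   R^m. *)
Definition same_law d (T : measurableType d) (P : probability T R)
    d' (T' : measurableType d') (P' : probability T' R)
    (V : int -> {RV P >-> R}) (U : int -> {RV P' >-> R}) : Prop :=
  forall m (t : 'I_m -> int) (B : set 'rV[R]_m), <<s @open 'rV[R]_m >> B ->
    P [set w | B (path_at V t w)] = P' [set w | B (path_at U t w)].

Context d (T : measurableType d) (P : probability T R).
Variable U : int -> {RV P >-> R}.

Definition strictly_stationary : Prop :=
  forall s : int, same_law (fun t => U (t + s)) U.

Definition sigma_process (D : set int) : set (set T) :=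
  <<s \bigcup_(t in D) preimage_set_system [set: T] (U t) measurable >>.

Definition finite_partition (G : set (set T)) m (A : 'I_m -> set T) : Prop :=
  [/\ forall i, G (A i), trivIset [set: 'I_m] A
    & \bigcup_(i in [set: 'I_m]) A i = [set: T]].

(* The convention used is the beta-mixing coefficient between the past up to time 0 and the future from
   time n on, as a supremum over pairs of finite measurable partitions. *)
Definition beta_mixing (n : nat) : R :=
  sup [set b | exists m p (A : 'I_m -> set T) (B : 'I_p -> set T),
    [/\ finite_partition (sigma_process [set t | t <= 0]) A,
        finite_partition (sigma_process [set t | n%:Z <= t]) B
      & b = 2^-1 * \sum_(i < m) \sum_(j < p)
          `| fine (P (A i `&` B j)) - fine (P (A i)) * fine (P (B j)) | ]].

(* Multivariate regular variation of a random vector Z: convergence of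
   P(Z \in x B) / P(|Z| > x) as x -> +oo to mu(B), for a nonzero limit measure
   mu that is finite away from the origin and every Borel set B bounded away
   from the origin whose boundary is a mu-null set. *)
Definition mv_regularly_varying m (Z : T -> 'rV[R]_m.+1) : Prop :=
  exists mu : {measure set (g_sigma_algebraType (@open 'rV[R]_m.+1))
                -> \bar R},
  [/\ mu (~` [set (0 : 'rV[R]_m.+1)]) != 0%E,
      forall e : R, 0 < e -> (mu [set v : 'rV[R]_m.+1 | (e <= `|v|)%R] < +oo)%E
    & forall B : set 'rV[R]_m.+1, <<s @open 'rV[R]_m.+1 >> B ->
        (exists2 e : R, 0 < e & B `<=` [set v | e <= `|v|]) ->
        mu (closure B `\` B°) = 0%E ->
        fine (P [set w | B (x^-1 *: Z w)]) / fine (P [set w | x < `|Z w|])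
          @[x --> +oo] --> fine (mu B)].

Definition pareto_regularly_varying : Prop :=
  forall m (t : 'I_m.+1 -> int),
    mv_regularly_varying (fun w => \row_i (1 - U (t i) w)^-1).

Definition extremal_index (theta : R) : Prop :=
  forall tau' : R, 0 < tau' ->
    fine (P [set w | forall i, (1 <= i <= n)%N ->
                       U i%:Z w <= 1 - tau' / n%:R])
      @[n --> \oo] --> expR (- (theta * tau')).

End processes.

Section regularity.
Context {R : realType}.

Definition sup_norm01 (c : R -> R) : R := sup [set `|c s| | s in `[0, 1]].

Definition hoelder_half (c : R -> R) : Prop :=
  exists2 Kc : R, 0 < Kc &
    forall s s' : R, 0 <= s <= 1 -> 0 <= s' <= 1 ->
      `|c s - c s'| <= Kc * Num.sqrt `|s - s'|.

(* C^2([0, 1]): the first two derivatives on the open interval extend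
   continuously to the closed one. *)
Definition C2_01 (c : R -> R) : Prop :=
  exists c1 c2 : R -> R,
  [/\ {within `[0, 1], continuous c}, {within `[0, 1], continuous c1},
      {within `[0, 1], continuous c2},
      forall s : R, 0 < s < 1 -> is_derive s 1 c (c1 s)
    & forall s : R, 0 < s < 1 -> is_derive s 1 c1 (c2 s)].

End regularity.

Section triangular_array.
Context {R : realType}.
Context {d : nat -> measure_display} {T : forall n, measurableType (d n)}.
Context {P : forall n, probability (T n) R}.

Definition cvg_in_prob (Y : forall n, T n -> R) (a : R) : Prop :=
  forall e : R, 0 < e ->
    P n [set w | e < `|Y n w - a|] @[n --> \oo] --> 0%E.

(* X n i is the observation X_i^(n); only the indices 1 <= i <= n matter. *)
Variable X : forall n, nat -> {RV (P n) >-> R}.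

Record model (F : R -> R) (c : R -> R)
    d0 (T0 : measurableType d0) (P0 : probability T0 R)
    (U : int -> {RV P0 >-> R}) : Prop := Model {
  model_cdf_continuous : forall n i, (1 <= i <= n)%N ->
    continuous (cdfR (X n i));
  model_endpoint : forall n i, (1 <= i <= n)%N ->
    right_endpoint (cdfR (X n i)) = right_endpoint F;
  model_F_continuous : continuous F;
  model_F_increasing : forall x y : R, cdf_support F x -> cdf_support F y ->
    x < y -> F x < F y;
  model_c_positive : forall s : R, 0 <= s <= 1 -> 0 < c s;
  model_c_bounded : [bounded c s | s in `[0, 1]];
  model_c_continuous : {within `[0, 1], continuous c};
  model_c_density : \int[lebesgue_measure]_(s in `[0, 1]) c s = 1;
  model_tail : forall n i, (1 <= i <= n)%N ->
    (1 - cdfR (X n i) x) / (1 - F x) @[x --> left_of (right_endpoint F)]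
      --> c (i%:R / n%:R);
  model_stationary : strictly_stationary U;
  model_excerpt : forall n, (0 < n)%N ->
    exists2 V : int -> {RV (P n) >-> R}, same_law V U &
      forall i, (1 <= i <= n)%N -> forall w,
        V i%:Z w = cdfR (X n i) (X n i w) }.

Record second_order (F c A : R -> R) : Prop := SecondOrder {
  so_positive : forall t : R, 0 < t -> 0 < A t;
  so_decreasing : exists t0 : R, forall s t : R, t0 <= s -> s <= t -> A t <= A s;
  so_limit : A t @[t --> +oo] --> 0;
  so_rate : exists C : R,
    \forall x \near left_of (right_endpoint F),
      forall n i, (1 <= i <= n)%N ->
        `|(1 - cdfR (X n i) x) / (1 - F x) - c (i%:R / n%:R)|
          <= C * A (1 - F x)^-1 }.

(* X_{n,j}, the j-th smallest of X_1^(n), ..., X_n^(n), for 1 <= j <= n. *)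
Definition order_stat n (j : nat) (w : T n) : R :=
  nth 0 (sort <=%R [seq X n i w | i <- index_iota 1 n.+1]) j.-1.

Definition ecdf n (w : T n) (x : R) : R :=
  n%:R^-1 * \sum_(1 <= i < n.+1) (X n i w <= x)%R%:R.

Section blocks.
Variable q : nat -> nat.

Definition nblocks n : nat := (n %/ q n)%N.

(* max of G (X_i) over the j-th block; the default value 0 of the maximum is
   harmless, G being nonnegative below. *)
Definition block_max n (j : nat) (G : R -> R) (w : T n) : R :=
  \big[Num.max/0]_((j - 1) * q n + 1 <= i < (j * q n).+1) G (X n i w).

Definition Zblock (F : R -> R) n (j : nat) (w : T n) : R :=
  (q n)%:R * (1 - block_max j F w).

Definition Zhat n (j : nat) (w : T n) : R :=
  (q n)%:R * (1 - block_max j (ecdf w) w).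

Definition That n (w : T n) : R :=
  (nblocks n)%:R^-1 * \sum_(1 <= j < (nblocks n).+1) Zhat j w.

Definition block_integrability (F : R -> R) : Prop :=
  exists2 delta1 : R, 0 < delta1 &
    (limn_esup (fun n => ereal_sup
      [set 'E_(P n)[fun w =>
             (`|Zblock F (Num.truncn (xi * (nblocks n)%:R)).+1 w|
               `^ (2 + delta1))%R]
       | xi in `]0%R, (1 : R)%R[ ]) < +oo)%E.

End blocks.
End triangular_array.

Section kernels.
Context {R : realType}.
Variable K : R -> R.

Definition ker_a (j : nat) (p : R) : R :=
  \int[lebesgue_measure]_(x in `[-1, p]) (x ^+ j * K x).

Definition ker_b (j : nat) (p : R) : R :=
  \int[lebesgue_measure]_(x in `[- p, 1]) (x ^+ j * K x).

(* Boundary-corrected kernel for the bandwidth h; it vanishes for |x| > 1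
   because K does. The two boundary regions are disjoint as soon as h < 1/2. *)
Definition boundary_kernel (h x s : R) : R :=
  if s <= h then
    let p := s / h in
    (ker_a 2 p - ker_a 1 p * x)
      / (ker_a 0 p * ker_a 2 p - ker_a 1 p ^+ 2) * K x
  else if 1 - h <= s then
    let p := (1 - s) / h in
    (ker_b 2 p - ker_b 1 p * x)
      / (ker_b 0 p * ker_b 2 p - ker_b 1 p ^+ 2) * K x
  else K x.

Record kernel_function : Prop := KernelFunction {
  kernel_continuous : {within `[-1, 1], continuous K};
  kernel_symmetric : forall x, K (- x) = K x;
  kernel_support : forall x : R, 1 < `|x| -> K x = 0;
  kernel_integral : \int[lebesgue_measure]_(x in `[-1, 1]) K x = 1;
  kernel_denominator_a : forall p : R, 0 <= p <= 1 ->
    ker_a 0 p * ker_a 2 p - ker_a 1 p ^+ 2 != 0;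
  kernel_denominator_b : forall p : R, 0 <= p <= 1 ->
    ker_b 0 p * ker_b 2 p - ker_b 1 p ^+ 2 != 0 }.

End kernels.

Section estimators.
Context {R : realType}.
Context {d : nat -> measure_display} {T : forall n, measurableType (d n)}.
Context {P : forall n, probability (T n) R}.
Variable X : forall n, nat -> {RV (P n) >-> R}.
Variables (K : R -> R) (k : nat -> nat) (h : nat -> R) (kappa : R).

Definition ctilde n (w : T n) (s : R) : R :=
  ((k n)%:R * h n)^-1 *
  \sum_(1 <= i < n.+1)
     (order_stat X (n - k n)%N w < X n i w)%R%:R
     * boundary_kernel K (h n) ((s - i%:R / n%:R) / h n) s.

Definition chat n (w : T n) (s : R) : R := Num.max (ctilde w s) kappa.

Definition tauhat n (w : T n) : R :=
  \int[lebesgue_measure]_(xi in `[0, 1]) (chat w xi)^-1.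

Definition thetahat (q : nat -> nat) n (w : T n) : R :=
  (That X q w)^-1 * tauhat w.

End estimators.

Definition tau {R : realType} (c : R -> R) : R :=
  \int[lebesgue_measure]_(xi in `[0, 1]) (c xi)^-1.

Section rate_conditions.
Context {R : realType}.
Context d (T : measurableType d) (P : probability T R).
Variable U : int -> {RV P >-> R}.

(* A sequence increasing with k = o(n) can only be nondecreasing. *)
Definition intermediate_sequence (k : nat -> nat) : Prop :=
  [/\ {homo k : m n / (m <= n)%N}, k n @[n --> \oo] --> \oo
    & (k n)%:R / n%:R @[n --> \oo] --> (0 : R)].

Record mixing_cond (k l r : nat -> nat) : Prop := MixingCond {
  mix_order : \forall n \near \oo, [/\ 1 < l n, l n < r n & r n < n]%N;
  mix_l_infty : l n @[n --> \oo] --> \oo;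
  mix_r_infty : r n @[n --> \oo] --> \oo;
  mix_l_small : (l n)%:R / (r n)%:R @[n --> \oo] --> (0 : R);
  mix_r_small :
    (r n)%:R / Num.min (Num.sqrt (k n)%:R) (n%:R / (k n)%:R)
      @[n --> \oo] --> (0 : R);
  mix_beta : beta_mixing U n @[n --> \oo] --> (0 : R);
  mix_beta_rate :
    n%:R / (r n)%:R * beta_mixing U (l n) @[n --> \oo] --> (0 : R) }.

Definition c_infty (c : R -> R) (L : nat) : R := 1 + L%:R * sup_norm01 c.

Definition moment_cond (c : R -> R) (k r : nat -> nat) (L : nat) : Prop :=
  exists2 delta : R, 0 < delta &
  exists C : R, \forall n \near \oo,
    ('E_P[fun w => ((\sum_(1 <= s < (r n).+1)
             (1 - (k n)%:R / n%:R * c_infty c L < U s%:Z w)%R%:R)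
           `^ (2 + delta))%R]
     <= (C * ((r n)%:R * ((k n)%:R / n%:R)))%:E)%E.

Definition increment_cond (c : R -> R) (k r : nat -> nat) (L : nat) : Prop :=
  exists g : R -> R,
  [/\ forall x y : R, 0 <= x -> x <= y -> y <= c_infty c L -> g x <= g y,
      {within `[0, c_infty c L], continuous g},
      forall x : R, 0 < x <= c_infty c L -> 0 < g x,
      g 0 = 0
    & \forall n \near \oo, forall x y : R, 0 <= x -> x <= y -> y <= c_infty c L ->
        ('E_P[fun w => ((\sum_(1 <= s < (r n).+1)
               (1 - (k n)%:R / n%:R * y < U s%:Z w
                  <= 1 - (k n)%:R / n%:R * x)%R%:R) ^+ 2)%R]
         <= ((r n)%:R * ((k n)%:R / n%:R) * g (y - x))%:E)%E].

(* The condition sqrt(k) A(n / (L k)) -> 0. *)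
Definition bias_cond (A : R -> R) (k : nat -> nat) (L : nat) : Prop :=
  Num.sqrt (k n)%:R * A (n%:R / (L%:R * (k n)%:R)) @[n --> \oo] --> (0 : R).

Record bandwidth (k r : nat -> nat) (h : nat -> R) : Prop := Bandwidth {
  band_positive : forall n, 0 < h n;
  band_zero : h n @[n --> \oo] --> 0;
  band_kh : (k n)%:R * h n @[n --> \oo] --> +oo;
  band_lambda : exists2 lambda : R, 0 <= lambda &
    (k n)%:R `^ 5^-1 * h n @[n --> \oo] --> lambda;
  band_r : (r n)%:R / Num.sqrt ((k n)%:R * h n) @[n --> \oo] --> 0;
  band_lower : \forall n \near \oo, (k n)%:R `^ (- 3^-1) <= h n }.

Record block_size (q : nat -> nat) : Prop := BlockSize {
  block_infty : q n @[n --> \oo] --> \oo;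
  block_small : (q n)%:R / Num.sqrt n%:R @[n --> \oo] --> (0 : R);
  block_mixing :
    n%:R * beta_mixing U (q n) / (q n)%:R @[n --> \oo] --> (0 : R) }.

End rate_conditions.

Arguments cvg_in_prob {R d T} P Y a.
Arguments intermediate_sequence R k : clear implicits.

(* Main.v *)
Require Import Defs.
From HB Require Import structures.
From mathcomp Require Import all_boot all_order all_algebra.
From mathcomp Require Import all_classical all_reals all_analysis.
From mathcomp Require Import ring lra zify.
Import Order.TTheory GRing.Theory Num.Theory.
Import numFieldNormedType.Exports.
Local Open Scope classical_set_scope.
Local Open Scope ring_scope.

(** Call [1 - F x] the level of an observation [x], and [q] times the level of
its maximum the level of a block of length [q]. By tail equivalence the
observation at time [i] has a level below a small [v] with probability about
[c (i / n) v], and the transformation of the observations to uniform margins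
lets the indicators of these events inherit the beta-mixing of the stationary
sequence [U]. All limits come from one law of large numbers, [block_lln], for
sums of small functionals of consecutive blocks of such indicators. Two blocks
of the same parity are separated by a whole block, so that mixing makes the
Laplace transform of the sum over one parity nearly a product; each factor is
nearly the Laplace transform of a constant because the summands are small; and
a variable whose Laplace transform at 1 and 2 is nearly that of a constant is
near this constant.

For the kernel estimator, let [k / n] be the reference level. With high
probability the levels [(1 - ep) k / n] and [(1 + ep) k / n] are exceeded by
fewer, respectively more, than [k] observations ([count_lln]), so they enclose
the random threshold, and only about [2 ep k] observations lie between them.
Integrated over the location, an observation contributes [O(1 / k)] to the
kernel estimator whatever the bandwidth ([kernel_sum_dist]); hence the random
threshold may be replaced by the reference level. At that level the law of
large numbers holds at each location, with bounds that do not depend on the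
location ([kernel_level_lln]), and averaging over the location gives the
convergence of the integral of the inverse ([pattern_error_mean]). Near the end
points of the unit interval the truncation at [kappa] is enough, as the
boundary regions have length [2 h].

For the block maxima, a block is called quiet at [u] when none of its
observations exceeds [u]. The number of observations with a level below
[y / q] is about [n y / q], so that the estimated level of a block is above [y]
essentially when the block is quiet at the level [y / q]
([block_comparison]). The extremal index and tail equivalence give the limit
[exp (- theta c (j / k') y)] for the probability that block [j] is quiet
([quiet_prob_limit]), the law of large numbers applies to the proportion of
quiet blocks ([quiet_lln]), and the integral over [y] of these exponentials is
[1 / (theta c (j / k'))], with average [tau / theta] over the blocks. Large
values of [y] need a separate argument, because the counts are only controlled
at finitely many levels: Markov's inequality bounds the number of observations
below all dyadic levels at once, which shows that the estimated level of a
block whose true level is at least 1 is bounded by a constant times the square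
of the latter ([Zhat_le_square]), and the assumed uniform integrability makes the sum of the
large squares negligible ([large_squares_bound]). *)

Set Implicit Arguments.
Unset Strict Implicit.
Unset Printing Implicit Defensive.

(** * A law of large numbers under weak dependence *)

Section finite_lln.
Context {R : realType}.

Lemma expRN_le_quadratic (x : R) : 0 <= x -> expR (- x) <= 1 - x + x ^+ 2.
Proof.
move=> x0; have h : 0 < 1 + x by lra.
rewrite -(ler_pM2r h); apply: (@le_trans _ _ 1); last first.
  have : 0 <= x ^+ 3 by exact: exprn_ge0.
  nra.
by rewrite -[leRHS](@expRxMexpNx_1 R x) [leRHS]mulrC ler_pM2l ?expR_gt0// expR_ge1Dx.
Qed.

Lemma dist_prod_le (I : Type) (s : seq I) (Q : pred I) (a c : I -> R) :
  (forall i, 0 <= a i <= 1) -> (forall i, 0 <= c i <= 1) ->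
  `|\prod_(i <- s | Q i) a i - \prod_(i <- s | Q i) c i|
    <= \sum_(i <- s | Q i) `|a i - c i|.
Proof.
move=> a01 c01; elim: s => [|i s ih]; first by rewrite !big_nil subrr normr0.
rewrite !big_cons; case: ifP => // _.
set A := \prod_(_ <- _ | _) _ in ih *; set B := \prod_(_ <- _ | _) c _ in ih *.
have A0 : `|A| <= 1.
  rewrite /A; elim: (s) => [|j s' ihs]; first by rewrite big_nil normr1.
  rewrite big_cons; case: ifP => // _; rewrite normrM.
  case/andP: (a01 j) => aj0 aj1; rewrite (ger0_norm aj0).
  by rewrite mulr_ile1.
have -> : a i * A - c i * B = (a i - c i) * A + c i * (A - B) by ring.
apply: (le_trans (ler_normD _ _)); rewrite !normrM; apply: lerD.
  by rewrite ler_piMr.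
case/andP: (c01 i) => ci0 ci1; rewrite (ger0_norm ci0).
by apply: le_trans ih; rewrite ler_piMl.
Qed.

Variable n : nat.
Local Notation pat := {ffun 'I_n -> bool}.

(** Expectations under a law on the finite set of patterns of
indicators: the dependence structure is handled without integration theory. *)
Definition pE (p : pat -> R) (f : pat -> R) : R := \sum_x p x * f x.

Definition depends_on (D : pred 'I_n) (f : pat -> R) : Prop :=
  forall x y : pat, (forall i, D i -> x i = y i) -> f x = f y.

Definition prob_weights (p : pat -> R) : Prop :=
  (forall x, 0 <= p x) /\ \sum_x p x = 1.

(** Bounds for functionals with values in [0, 1] suffice for
Laplace transforms of nonnegative sums. *)
Definition weakly_dependent (p : pat -> R) (l : nat) (b : R) : Prop :=
  forall s (f g : pat -> R),
    (forall x, 0 <= f x <= 1) -> (forall x, 0 <= g x <= 1) ->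
    depends_on [pred i : 'I_n | (i < s)%N] f ->
    depends_on [pred i : 'I_n | (s + l <= i)%N] g ->
    `|pE p (fun x => f x * g x) - pE p f * pE p g| <= b.

Definition in_block (r j : nat) : pred 'I_n :=
  [pred i : 'I_n | (j * r <= i < j.+1 * r)%N].

Section expectation.
Variable p : pat -> R.
Hypothesis p_prob : prob_weights p.

Lemma pE_le f g : (forall x, f x <= g x) -> pE p f <= pE p g.
Proof.
by move=> fg; apply: ler_sum => x _; rewrite ler_wpM2l // (proj1 p_prob).
Qed.

Lemma pED f g : pE p (fun x => f x + g x) = pE p f + pE p g.
Proof. by rewrite /pE -big_split; apply: eq_bigr => x _; rewrite mulrDr. Qed.

Lemma pEZ a f : pE p (fun x => a * f x) = a * pE p f.
Proof.
by rewrite /pE mulr_sumr; apply: eq_bigr => x _; rewrite mulrCA.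
Qed.

Lemma pE_cst a : pE p (fun=> a) = a.
Proof. by rewrite /pE -mulr_suml (proj2 p_prob) mul1r. Qed.

Lemma pE_sum (I : Type) (s : seq I) (Q : pred I) (f : I -> pat -> R) :
  pE p (fun x => \sum_(i <- s | Q i) f i x) = \sum_(i <- s | Q i) pE p (f i).
Proof.
rewrite /pE exchange_big /=; apply: eq_bigr => x _; by rewrite mulr_sumr.
Qed.

Lemma pE_itv f a c : (forall x, a <= f x <= c) -> a <= pE p f <= c.
Proof.
move=> h; apply/andP; split.
  by rewrite -[leLHS]pE_cst; apply: pE_le => x; case/andP: (h x).
by rewrite -[leRHS]pE_cst; apply: pE_le => x; case/andP: (h x).
Qed.

Lemma eq_pE f g : f =1 g -> pE p f = pE p g.
Proof. by move=> fg; apply: eq_bigr => x _; rewrite fg. Qed.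

Lemma pE_markov f (D : pred pat) t : 0 < t -> (forall x, 0 <= f x) ->
  (forall x, D x -> t <= f x) -> pE p (fun x => (D x)%:R) <= pE p f / t.
Proof.
move=> t0 f0 Df; rewrite ler_pdivlMr // mulrC -pEZ; apply: pE_le => x.
by case: (boolP (D x)) => [/Df|_]; rewrite ?mulr1 ?mulr0.
Qed.

Lemma weakly_dependent_ge0 l b : weakly_dependent p l b -> 0 <= b.
Proof.
by move=> /(_ 0%N (fun=> 0) (fun=> 0)) mix;
  apply: le_trans (normr_ge0 _) (mix _ _ _ _) => // x; rewrite lexx ler01.
Qed.

(** One step costs one application of the mixing bound: before block [J] the
product only sees blocks up to [J - 2], which leaves a gap of a whole block. *)
Lemma pE_prod_decoupling r l b (par : pred nat) (xi : nat -> pat -> R) :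
  (l <= r)%N -> weakly_dependent p l b ->
  (forall j, par j -> ~~ par j.+1) ->
  (forall j x, 0 <= xi j x <= 1) -> (forall j, depends_on (in_block r j) (xi j)) ->
  forall J : nat,
  `|pE p (fun x => \prod_(0 <= j < J | par j) xi j x)
    - \prod_(0 <= j < J | par j) pE p (xi j)| <= J%:R * b.
Proof.
move=> lr mix parS xi01 xi_dep.
have b0 := weakly_dependent_ge0 mix.
have E01 j : 0 <= pE p (xi j) <= 1 by apply: pE_itv.
elim=> [|J ih].
  by under eq_pE do rewrite big_geq//; rewrite pE_cst big_geq// subrr normr0 mul0r.
rewrite (eq_pE (g := fun x => (\prod_(0 <= j < J | par j) xi j x)
   * (if par J then xi J x else 1))); last first.
  by move=> x; rewrite big_mkcond big_nat_recr//= -big_mkcond.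
rewrite [X in _ - X]big_mkcond big_nat_recr//= -big_mkcond/=.
case: ifPn => parJ; last first.
  under eq_pE do rewrite mulr1.
  by rewrite mulr1; apply: le_trans ih _; rewrite ler_wpM2r // ler_nat.
set f := fun x => _; set Pi := \prod_(0 <= j < J | par j) _ in ih *.
have fin x : 0 <= \prod_(0 <= j < J | par j) xi j x <= 1.
  apply/andP; split; first by apply: prodr_ge0 => j _; case/andP: (xi01 j x).
  by apply: prodr_ile1 => j _; exact: xi01.
have dep1 : `|pE p f - pE p (fun x => \prod_(0 <= j < J | par j) xi j x)
    * pE p (xi J)| <= b.
  case: J parJ @f @Pi ih fin => [|J] parJ f Pi ih fin.
    rewrite (eq_pE (g := xi 0%N)); last by move=> x; rewrite /f big_geq// mul1r.
    rewrite (eq_pE (f := fun x => \prod_(_ <= j < _ | _) _) (g := fun=> 1)).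
      by rewrite pE_cst mul1r subrr normr0.
    by move=> x; rewrite big_geq.
  apply: (mix (J * r)%N) => //.
  - move=> x y xy; apply: congr_big_nat => // j /andP[parj /andP[_ jJ]].
    apply: xi_dep => i /= /andP[_ ij]; apply: xy => /=.
    apply: leq_trans ij _; rewrite leq_mul2r; apply/orP; right.
    rewrite ltn_neqAle -ltnS jJ andbT.
    by apply: contraTN parJ => /eqP <-; exact: parS.
  - move=> x y xy; apply: xi_dep => i /= /andP[ij _]; apply: xy => /=.
    by apply: leq_trans ij; rewrite mulSn addnC leq_add2r.
have -> : pE p f - Pi * pE p (xi J) =
  (pE p f - pE p (fun x => \prod_(0 <= j < J | par j) xi j x) * pE p (xi J))
  + (pE p (fun x => \prod_(0 <= j < J | par j) xi j x) - Pi) * pE p (xi J).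
  by ring.
apply: (le_trans (ler_normD _ _)); rewrite -natr1 [leRHS]mulrDl mul1r [leRHS]addrC lerD //.
rewrite normrM; case/andP: (E01 J) => e0 e1; rewrite (ger0_norm e0).
by apply: le_trans ih; rewrite ler_piMr.
Qed.

(** A small summand and its mean have nearly the same Laplace transform, both
being [1 - t E f] up to a second order error. *)
Lemma pE_expR_small (f : pat -> R) (e t : R) : 0 <= t ->
  (forall x, 0 <= f x <= e) ->
  `|pE p (fun x => expR (- (t * f x))) - expR (- (t * pE p f))|
    <= t ^+ 2 * e * pE p f.
Proof.
move=> t0 fe; have /andP[m0 me] := pE_itv fe; set m := pE p f in m0 me *.
have lo : 1 - t * m <= pE p (fun x => expR (- (t * f x))).
  rewrite -[1 - _](_ : pE p (fun x => 1 + (- t) * f x) = _); last first.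
    by rewrite pED pE_cst pEZ mulNr.
  by apply: pE_le => x; rewrite mulNr expR_ge1Dx.
have hi : pE p (fun x => expR (- (t * f x))) <= 1 - t * m + t ^+ 2 * e * m.
  rewrite -[1 - _ + _](_ : pE p (fun x => 1 + (- t) * f x + (t ^+ 2 * e) * f x) = _).
    2: by rewrite !pED pE_cst !pEZ mulNr.
  apply: pE_le => x; case/andP: (fe x) => fx0 fxe.
  apply: (le_trans (expRN_le_quadratic _)); first exact: mulr_ge0.
  rewrite mulNr lerD2l exprMn -mulrA ler_wpM2l ?exprn_ge0//.
  by rewrite expr2 ler_wpM2r.
have lo' : 1 - t * m <= expR (- (t * m)) by exact: expR_ge1Dx.
have hi' : expR (- (t * m)) <= 1 - t * m + t ^+ 2 * e * m.
  apply: (le_trans (expRN_le_quadratic _)); first exact: mulr_ge0.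
  rewrite lerD2l exprMn -mulrA ler_wpM2l ?exprn_ge0//.
  by rewrite expr2 ler_wpM2r.
by rewrite ler_norml; lra.
Qed.

Definition lln_const (M eta : R) : R :=
  24 / (expR (- M) * (1 - expR (- eta))) ^+ 2.

(** A deviation of [S] from [m] remains visible after the strictly decreasing
map [exp (- x)], in proportion to its slope, which is bounded below as long as
[m] is bounded above. *)
Lemma expRN_dist (M eta S m : R) : 0 <= eta -> m <= M -> eta < `|S - m| ->
  (expR (- M) * (1 - expR (- eta))) ^+ 2 <= (expR (- S) - expR (- m)) ^+ 2.
Proof.
move=> eta0 mM far.
have e1 : expR (- eta) <= 1 by rewrite -expR0 ler_expR; lra.
have k0 : 0 <= expR (- M) * (1 - expR (- eta)) by rewrite mulr_ge0 ?expR_ge0 ?subr_ge0.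
have kk : expR (- M) * (1 - expR (- eta)) <= expR (- m) * (1 - expR (- eta)).
  by rewrite ler_wpM2r ?subr_ge0 // ler_expR lerN2.
rewrite -[X in _ <= X]real_normK ?num_real// lerXn2r ?nnegrE ?normr_ge0//.
apply: le_trans kk _.
case: (lerP m S) far => mS far.
  rewrite distrC; apply: le_trans (ler_norm _); rewrite mulrBr mulr1 lerD2l lerN2.
  by rewrite -expRD ler_expR; lra.
apply: le_trans (ler_norm _).
have : expR (- m) * expR eta <= expR (- S) by rewrite -expRD ler_expR; lra.
have h := expRxMexpNx_1 eta.
have hm := expR_gt0 (- m).
have : expR (- eta) + expR eta >= 2.
  by have := expR_ge1Dx eta; have := expR_ge1Dx (- eta); lra.
nra.
Qed.

Section blocks.
Variables (r l J : nat) (beta e M eta : R) (b : nat -> pat -> R).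
Hypotheses (lr : (l <= r)%N) (mix : weakly_dependent p l beta).
Hypotheses (b_range : forall j x, 0 <= b j x <= e).
Hypothesis b_dep : forall j, depends_on (in_block r j) (b j).
Hypotheses (eta0 : 0 < eta).
Hypothesis sum_le : \sum_(0 <= j < J) pE p (b j) <= M.

Let Eb0 j : 0 <= pE p (b j).
Proof. by have /andP[] := pE_itv (b_range j). Qed.

Let e0 : 0 <= e.
Proof. by case/andP: (b_range 0%N [ffun=> false]) => ? ?; lra. Qed.

Let M0 : 0 <= M.
Proof. by apply: le_trans sum_le; apply: sumr_ge0. Qed.

Section one_parity.
Variable par : pred nat.
Hypothesis parS : forall j, par j -> ~~ par j.+1.
Let S x := \sum_(0 <= j < J | par j) b j x.
Let m := \sum_(0 <= j < J | par j) pE p (b j).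

Let mM : m <= M.
Proof.
apply: le_trans sum_le; rewrite /m big_mkcond; apply: ler_sum => j _.
by case: ifP.
Qed.

Lemma pE_laplace t : 0 <= t ->
  `|pE p (fun x => expR (- (t * S x))) - expR (- (t * m))|
    <= J%:R * beta + t ^+ 2 * e * M.
Proof.
move=> t0.
have xi01 j x : 0 <= expR (- (t * b j x)) <= 1.
  rewrite expR_ge0/= -expR0 ler_expR oppr_le0 mulr_ge0//.
  by case/andP: (b_range j x).
rewrite (eq_pE (g := fun x => \prod_(0 <= j < J | par j) expR (- (t * b j x)))).
  2: by move=> x; rewrite -expR_sum /S mulr_sumr -sumrN.
have -> : expR (- (t * m)) = \prod_(0 <= j < J | par j) expR (- (t * pE p (b j))).
  by rewrite -expR_sum /m mulr_sumr -sumrN.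
rewrite -(subrKA (\prod_(0 <= j < J | par j) pE p (fun x => expR (- (t * b j x))))).
apply: (le_trans (ler_normD _ _)); rewrite lerD//.
  apply: (pE_prod_decoupling (xi := fun j x => expR (- (t * b j x))) lr mix) => //.
  by move=> j x y xy; rewrite (b_dep xy).
apply: (le_trans (dist_prod_le _ _ _ _)).
- by move=> j; apply: pE_itv.
- by move=> j; rewrite expR_ge0/= -expR0 ler_expR oppr_le0 mulr_ge0.
apply: (@le_trans _ _ (\sum_(0 <= j < J | par j) t ^+ 2 * e * pE p (b j))).
  by apply: ler_sum => j _; exact: pE_expR_small.
by rewrite -mulr_sumr ler_wpM2l // mulr_ge0 // exprn_ge0.
Qed.

(** The Laplace transforms at 1 and 2 determine the second moment of
[exp (- S) - exp (- m)], to which Markov's inequality applies. *)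
Lemma parity_lln : pE p (fun x => (eta < `|S x - m|)%R%:R)
   <= (3 * (J%:R * beta) + 6 * (e * M)) / (expR (- M) * (1 - expR (- eta))) ^+ 2.
Proof.
have k0 : 0 < (expR (- M) * (1 - expR (- eta))) ^+ 2.
  by rewrite exprn_gt0 // mulr_gt0 ?expR_gt0// subr_gt0 expR_lt1 oppr_lt0.
apply: (le_trans (pE_markov (f := fun x => (expR (- S x) - expR (- m)) ^+ 2) k0 _ _)).
- by move=> x; rewrite sqr_ge0.
- by move=> x; apply: expRN_dist => //; exact: ltW.
rewrite ler_pM2r ?invr_gt0//.
rewrite (eq_pE (g := fun x => expR (- (2 * S x)) + ((- 2 * expR (- m)) * expR (- (1 * S x))
   + expR (- m) ^+ 2))); last first.
  by move=> x; rewrite mul1r -mulrN [2 * _]mulrDl !mul1r expRD; ring.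
rewrite !pED pEZ pE_cst.
have := pE_laplace (ler0n R 2); have := pE_laplace ler01; rewrite !mul1r.
have -> : expR (- (2 * m)) = expR (- m) ^+ 2.
  by rewrite -mulrN [2 * _]mulrDl !mul1r expRD.
have em1 : expR (- m) <= 1 by rewrite -expR0 ler_expR oppr_le0 /m; apply: sumr_ge0.
have em0 := expR_gt0 (- m).
rewrite (eq_pE (f := fun x => expR (- (1 * S x))) (g := fun x => expR (- S x))); last first.
  by move=> x; rewrite mul1r.
set A := pE p (fun x => expR (- (2 * _))); set B := pE p (fun x => expR (- _)).
have B0 : 0 <= J%:R * beta + 1 ^+ 2 * e * M by apply: le_trans (normr_ge0 _) (pE_laplace _).
rewrite !ler_norml => /andP[h1 h2] /andP[h3 h4].
set X := J%:R * beta in h1 h2 h3 h4 B0 *; set Y := e * M.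
have -> : A + (-2 * expR (- m) * B + expR (- m) ^+ 2) =
  (A - expR (- m) ^+ 2) + 2 * (expR (- m) * (expR (- m) - B)) by ring.
have : expR (- m) * (expR (- m) - B) <= X + Y.
  have : expR (- m) - B <= X + Y by rewrite /Y; lra.
  have : 0 <= X + Y by rewrite /Y; lra.
  nra.
have e4 : 2 ^+ 2 * e * M = 4 * Y by rewrite /Y; ring.
rewrite e4 in h4; lra.
Qed.

End one_parity.

(** Summands of one parity are nearly independent, so that the Laplace
transform of their sum almost factorises; being of size at most [e] each, they
then behave like their means. *)
Theorem block_lln :
  pE p (fun x => (2 * eta < `|\sum_(0 <= j < J) b j x - \sum_(0 <= j < J) pE p (b j)|)%R%:R)
  <= lln_const M eta * (J%:R * beta + e * M).
Proof.
have pev j : ~~ odd j -> ~~ ~~ odd j.+1 by rewrite /= negbK.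
have pod j : odd j -> ~~ odd j.+1 by rewrite /= negbK.
have h1 := parity_lln pev; have h2 := parity_lln pod.
set A := pE _ _ in h1; set B := pE _ _ in h2.
apply: (@le_trans _ _ (A + B)).
  rewrite /A /B -pED; apply: pE_le => x.
  rewrite (bigID odd)/= [X in _ - X](bigID odd)/=.
  set s1 := \sum_(_ <= _ < _ | odd _) _; set s2 := \sum_(_ <= _ < _ | ~~ odd _) _.
  set m1 := \sum_(_ <= _ < _ | odd _) _; set m2 := \sum_(_ <= _ < _ | ~~ odd _) _.
  have tri : `|s1 + s2 - (m1 + m2)| <= `|s1 - m1| + `|s2 - m2|.
    have -> : s1 + s2 - (m1 + m2) = s1 - m1 + (s2 - m2) by ring.
    exact: ler_normD.
  case: (ltrP eta `|s1 - m1|) => a1; case: (ltrP eta `|s2 - m2|) => a2;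
    case: ltrP => a3 /=; lra.
apply: (le_trans (lerD h1 h2)).
rewrite /lln_const -mulrDl mulrAC ler_wpM2r ?invr_ge0 ?sqr_ge0//.
suff : 0 <= J%:R * beta by have := mulr_ge0 e0 M0; lra.
by rewrite mulr_ge0// (weakly_dependent_ge0 mix).
Qed.

End blocks.
End expectation.
End finite_lln.

(** * Mixing of patterns of exceedances *)

Section patterns.
Context {R : realType} d (T : measurableType d).

Definition patt (I : finType) (e : I -> T -> bool) (w : T) : {ffun I -> bool} :=
  [ffun i => e i w].

Lemma measurable_patt (I : finType) (e : I -> T -> bool) (Q : {ffun I -> bool} -> Prop) :
  (forall i, measurable [set w | e i w]) -> measurable [set w | Q (patt e w)].
Proof.
move=> me.
have -> : [set w | Q (patt e w)] = \bigcup_(x in [set x | Q x])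
    \bigcap_(i in [set: I]) [set w | e i w = x i].
  apply/seteqP; split=> [w Qw|w [x Qx h]] /=.
    by exists (patt e w) => // i _ /=; rewrite ffunE.
  suff -> : patt e w = x by [].
  by apply/ffunP => i; rewrite ffunE; exact: h.
apply: fin_bigcup_measurable => [|x _]; first exact: finite_finset.
apply: fin_bigcap_measurable => [|i _]; first exact: finite_finset.
case: (x i); first exact: me.
have -> : [set w | e i w = false] = ~` [set w | e i w].
  by apply/seteqP; split=> w /=; case: (e i w).
exact: measurableC.
Qed.

Variable P : probability T R.

Lemma sum_prob_partition (I : finType) (A : I -> set T) (B : set T) :
  (forall i, measurable (A i)) -> trivIset [set: I] A ->
  \bigcup_(i in [set: I]) A i = [set: T] -> measurable B ->
  \sum_i fine (P (A i `&` B)) = fine (P B).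
Proof.
move=> mA tA cA mB.
have eB : \bigcup_(x in [set` enum I]) (A x `&` B) = B.
  apply/seteqP; split=> [w [x _ []//]|w Bw].
  have : [set: T] w by [].
  by rewrite -cA => -[i _ Aiw]; exists i => //=; rewrite mem_enum.
rewrite -[in RHS]eB measure_fin_bigcup//.
- rewrite -fsbig_seq ?enum_uniq // big_enum/= sum_fine //.
  by move=> i _; rewrite fin_num_measure//; exact: measurableI.
- by move=> x y _ _ [w [[Ax _] [Ay _]]]; apply: (tA x y) => //; exists w.
- by move=> i _; exact: measurableI.
Qed.

Lemma trivIset_fibres (I : Type) (f : T -> I) :
  trivIset [set: I] (fun i => [set w | f w = i]).
Proof. by move=> x y _ _ [w [/= <- <-]]. Qed.

Lemma cover_fibres (I : Type) (f : T -> I) :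
  \bigcup_(i in [set: I]) [set w | f w = i] = [set: T].
Proof. by apply/seteqP; split=> // w _; exists (f w). Qed.

Definition pat_law (I : finType) (e : I -> T -> bool) (x : {ffun I -> bool}) : R :=
  fine (P [set w | patt e w = x]).

Lemma patt_prob (I : finType) (e : I -> T -> bool) (Q : pred {ffun I -> bool}) :
  (forall i, measurable [set w | e i w]) ->
  P [set w | Q (patt e w)] = (\sum_(x | Q x) pat_law e x)%:E.
Proof.
move=> me.
have mQ : measurable [set w | Q (patt e w)] by exact: (measurable_patt (fun y => Q y)).
rewrite -[LHS]fineK ?fin_num_measure//; congr EFin.
rewrite -(sum_prob_partition _ (@trivIset_fibres _ (patt e)) (@cover_fibres _ _) mQ).
  rewrite [RHS]big_mkcond/=; apply: eq_bigr => x _; case: ifPn => Qx; rewrite ?/pat_law.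
    by congr (fine (P _)); apply/seteqP; split => [w [] //|w /= wx]; rewrite wx.
  rewrite (_ : _ `&` _ = set0) ?measure0//.
  by apply/seteqP; split => // w [/= ->]; rewrite (negbTE Qx).
by move=> x; exact: (measurable_patt (fun y => y = x)).
Qed.

Lemma pat_law_prob n (e : 'I_n -> T -> bool) :
  (forall i, measurable [set w | e i w]) -> prob_weights (pat_law e).
Proof.
move=> me; split; first by move=> x; exact: fine_ge0.
have := patt_prob predT me.
rewrite (_ : [set w | _] = setT); first by rewrite probability_setT => -[].
by apply/seteqP; split.
Qed.

Lemma pE_pat_law n (e : 'I_n -> T -> bool) (Q : pred {ffun 'I_n -> bool}) :
  (forall i, measurable [set w | e i w]) ->
  P [set w | Q (patt e w)] = (pE (pat_law e) (fun x => (Q x)%:R))%:E.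
Proof.
move=> me; rewrite patt_prob// /pE big_mkcond/=; congr EFin.
by apply: eq_bigr => x _; case: (Q x); rewrite ?mulr1 ?mulr0.
Qed.

Lemma patt_markov n (e : 'I_n -> T -> bool) (f : {ffun 'I_n -> bool} -> R) t :
  (forall i, measurable [set w | e i w]) -> 0 < t -> (forall x, 0 <= f x) ->
  (P [set w | t <= f (patt e w)]%R <= (pE (pat_law e) f / t)%:E)%E.
Proof.
move=> me t0 f0.
rewrite (pE_pat_law (fun x => t <= f x) me) lee_fin.
by apply: pE_markov => //; exact: pat_law_prob.
Qed.

End patterns.

Section same_law_patterns.
Context {R : realType} d (T : measurableType d) (P : probability T R).
Context d' (T' : measurableType d') (P' : probability T' R).

Lemma measurable_gt_RV (X : {RV P >-> R}) (a : R) : measurable [set w | a < X w].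
Proof.
have -> : [set w | a < X w] = X @^-1` `]a, +oo[.
  by apply/seteqP; split=> w /=; rewrite in_itv/= andbT.
by apply: measurable_funPTI; exact: measurable_itv.
Qed.

Lemma same_law_patt (V : int -> {RV P >-> R}) (U : int -> {RV P' >-> R}) m
    (t : 'I_m -> int) (a : 'I_m -> R) (Q : {ffun 'I_m -> bool} -> Prop) :
  same_law V U ->
  P [set w | Q (patt (fun i w => a i < V (t i) w) w)] =
  P' [set w | Q (patt (fun i w => a i < U (t i) w) w)].
Proof.
move=> VU.
pose E := g_sigma_algebraType (@open 'rV[R]_m).
pose B := [set v : E | Q (patt (fun i (v : E) => a i < (v : 'rV[R]_m) 0 i) v)].
have mB : <<s @open 'rV[R]_m >> B.
  apply: (@measurable_patt _ E _ (fun i (v : E) => a i < (v : 'rV[R]_m) 0 i)) => i.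
  apply: sub_sigma_algebra.
  have -> : [set v : 'rV[R]_m | a i < v 0 i]
      = (fun v : 'rV[R]_m => v 0 i) @^-1` [set x | a i < x] by [].
  apply: open_comp; last exact: open_gt.
  by move=> v _; exact: coord_continuous.
have := VU m t B mB.
have e1 : [set w | B (path_at V t w)] = [set w | Q (patt (fun i w => a i < V (t i) w) w)].
  congr mkset; apply/funext => z; rewrite /B/=; congr Q.
  by apply/ffunP => i; rewrite !ffunE mxE.
have e2 : [set w | B (path_at U t w)] = [set w | Q (patt (fun i w => a i < U (t i) w) w)].
  congr mkset; apply/funext => z; rewrite /B/=; congr Q.
  by apply/ffunP => i; rewrite !ffunE mxE.
by rewrite e1 e2.
Qed.

End same_law_patterns.

Section mixing.
Context {R : realType} d (T : measurableType d) (P : probability T R).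
Variable U : int -> {RV P >-> R}.

Lemma sub_sigma_process (D : set int) (B : set T) :
  sigma_process U D B -> measurable B.
Proof.
apply: smallest_sub; first exact: sigma_algebra_measurable.
by move=> _ [t _ [C mC <-]]; exact: (measurable_funP (U t)).
Qed.

(** The joint and the product probabilities both sum to 1. Boundedness is what
makes the supremum in the mixing coefficient dominate its members. *)
Lemma beta_mixing_ubound (n : nat) : has_ubound
  [set b | exists m p (A : 'I_m -> set T) (B : 'I_p -> set T),
    [/\ finite_partition (sigma_process U [set t | t <= 0]) A,
        finite_partition (sigma_process U [set t | n%:Z <= t]) B
      & b = 2^-1 * \sum_(i < m) \sum_(j < p)
          `| fine (P (A i `&` B j)) - fine (P (A i)) * fine (P (B j)) | ]].
Proof.
exists 1 => _ [m [p [A [B [[sA tA cA] [sB tB cB] ->]]]]].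
have mA i : measurable (A i) by exact: sub_sigma_process (sA i).
have mB i : measurable (B i) by exact: sub_sigma_process (sB i).
have PA : \sum_i fine (P (A i)) = 1.
  have := sum_prob_partition P mA tA cA measurableT.
  by rewrite probability_setT /= => <-; apply: eq_bigr => i _; rewrite setIT.
have PB : \sum_i fine (P (B i)) = 1.
  have := sum_prob_partition P mB tB cB measurableT.
  by rewrite probability_setT /= => <-; apply: eq_bigr => i _; rewrite setIT.
have PAB : \sum_i \sum_j fine (P (A i `&` B j)) = 1.
  rewrite exchange_big/= -PB; apply: eq_bigr => j _.
  exact: (sum_prob_partition P mA tA cA).
have PAPB : \sum_i \sum_j fine (P (A i)) * fine (P (B j)) = 1.
  by rewrite -[RHS]PA; apply: eq_bigr => i _; rewrite -mulr_sumr PB mulr1.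
rewrite ler_pdivrMl// mulr1 -[2]/(1 + 1) -{1}PAB -PAPB -big_split/=.
apply: ler_sum => i _; rewrite -big_split/=; apply: ler_sum => j _.
apply: (le_trans (ler_normB _ _)); rewrite !ger0_norm// ?mulr_ge0//; exact: fine_ge0.
Qed.

Lemma beta_mixing_fibres n (I I' : finType) (f : T -> I) (g : T -> I') :
  (forall i, sigma_process U [set t | t <= 0] [set w | f w = i]) ->
  (forall i, sigma_process U [set t | n%:Z <= t] [set w | g w = i]) ->
  \sum_i \sum_j `| fine (P ([set w | f w = i] `&` [set w | g w = j]))
     - fine (P [set w | f w = i]) * fine (P [set w | g w = j])|
  <= 2 * beta_mixing U n.
Proof.
move=> sf sg; rewrite -ler_pdivrMl//; apply: ub_le_sup; first exact: beta_mixing_ubound.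
exists #|I|, #|I'|, (fun i => [set w | f w = enum_val i]),
  (fun i => [set w | g w = enum_val i]); split.
- split => //; first by move=> x y _ _ [w [/= fx fy]]; apply: enum_val_inj; rewrite -fx -fy.
  by apply/seteqP; split=> // w _; exists (enum_rank (f w)) => //=; rewrite enum_rankK.
- split => //; first by move=> x y _ _ [w [/= fx fy]]; apply: enum_val_inj; rewrite -fx -fy.
  by apply/seteqP; split=> // w _; exists (enum_rank (g w)) => //=; rewrite enum_rankK.
congr (_ * _); rewrite (reindex _ (onW_bij _ (enum_val_bij I)))/=; apply: eq_bigr => i _.
by rewrite (reindex _ (onW_bij _ (enum_val_bij I'))).
Qed.

Lemma sigma_process_patt (D : set int) (I : finType) (e : I -> T -> bool)
    (Q : {ffun I -> bool} -> Prop) :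
  (forall i, sigma_process U D [set w | e i w]) ->
  sigma_process U D [set w | Q (patt e w)].
Proof.
pose G := \bigcup_(t in D) preimage_set_system [set: T] (U t) measurable.
by move=> he; apply: (@measurable_patt _ (g_sigma_algebraType G)).
Qed.

Lemma sigma_process_gt (D : set int) t (a : R) : D t ->
  sigma_process U D [set w | a < U t w].
Proof.
move=> Dt; apply: sub_sigma_algebra; exists t => //; exists `]a, +oo[%classic.
  exact: measurable_itv.
by rewrite setTI; apply/seteqP; split=> w /=; rewrite in_itv/= andbT.
Qed.

Lemma sum_patt_map n (e : 'I_n -> T -> bool) (I : finType)
    (phi : {ffun 'I_n -> bool} -> I) (f : I -> R) :
  (forall i, measurable [set w | e i w]) ->
  \sum_y fine (P [set w | phi (patt e w) = y]) * f y
    = pE (pat_law P e) (fun x => f (phi x)).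
Proof.
move=> me; rewrite /pE (partition_big phi predT)//=; apply: eq_bigr => y _.
rewrite [RHS](eq_bigr (fun x => pat_law P e x * f y)); last by move=> x /eqP ->.
rewrite -mulr_suml; congr (_ * _).
rewrite -[RHS]/(fine (_%:E)) -(patt_prob _ (fun x => phi x == y) me).
by congr (fine (P _)); apply/seteqP; split=> w /= /eqP.
Qed.

(** By stationarity the time axis may be shifted so that the earlier indices
fall into the past [t <= 0] and the later ones into the future [l <= t]. *)
Lemma beta_weakly_dependent n (a : 'I_n -> R) l : strictly_stationary U ->
  weakly_dependent (pat_law P (fun i w => a i < U (i.+1)%:Z w)) l (2 * beta_mixing U l).
Proof.
move=> st s f g f01 g01 df dg.
pose e' (i : 'I_n) w := a i < U (i.+1%:Z + (- s%:Z)) w.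
have me' i : measurable [set w | e' i w] by exact: measurable_gt_RV.
have -> : pat_law P (fun i w => a i < U (i.+1)%:Z w) = pat_law P e'.
  apply/funext => x; congr fine; apply: esym.
  exact: (same_law_patt (fun i : 'I_n => i.+1%:Z) a (fun y => y = x) (st (- s%:Z))).
pose phi (x : {ffun 'I_n -> bool}) : {ffun 'I_n -> bool} := [ffun i : 'I_n => (i < s)%N && x i].
pose psi (x : {ffun 'I_n -> bool}) : {ffun 'I_n -> bool} := [ffun i : 'I_n => (s + l <= i)%N && x i].
have fphi x : f x = f (phi x).
  by apply: df => i /= ilts; rewrite ffunE ilts.
have gpsi x : g x = g (psi x).
  by apply: dg => i /= ilts; rewrite ffunE ilts.
pose p1 y := fine (P [set w | phi (patt e' w) = y]).
pose p2 y := fine (P [set w | psi (patt e' w) = y]).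
pose p12 y z := fine (P ([set w | phi (patt e' w) = y] `&` [set w | psi (patt e' w) = z])).
have E12 : pE (pat_law P e') (fun x => f x * g x) = \sum_y \sum_z p12 y z * (f y * g z).
  rewrite pair_bigA/= (eq_pE _ (g := fun x => (fun u => f u.1 * g u.2) (phi x, psi x))); last first.
    by move=> x; rewrite fphi gpsi.
  rewrite -(sum_patt_map (fun x => (phi x, psi x)) (fun u => f u.1 * g u.2) me'); apply: eq_bigr => -[y z] _ /=.
  congr (fine (P _) * _).
  by apply/seteqP; split => w /=; [case=> -> ->|case=> -> ->].
rewrite E12 (eq_pE _ fphi) (eq_pE _ gpsi) -!sum_patt_map//.
rewrite (_ : _ - _ = \sum_y \sum_z (p12 y z - p1 y * p2 z) * (f y * g z)); last first.
  rewrite mulr_suml -sumrB.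
  apply: eq_bigr => y _; rewrite mulr_sumr -sumrB; apply: eq_bigr => z _.
  by rewrite /p1 /p2; ring.
apply: le_trans (@beta_mixing_fibres l _ _ (phi \o patt e') (psi \o patt e') _ _).
- apply: (le_trans (ler_norm_sum _ _ _)); apply: ler_sum => y _.
  apply: (le_trans (ler_norm_sum _ _ _)); apply: ler_sum => z _.
  rewrite normrM ler_piMr// ger0_norm.
    by case/andP: (f01 y) => ? ?; case/andP: (g01 z) => ? ?; rewrite mulr_ile1.
  by case/andP: (f01 y) => ? ?; case/andP: (g01 z) => ? ?; rewrite mulr_ge0.
- move=> y.
  have -> : [set w | (phi \o patt e') w = y] = [set w | patt (fun (i : 'I_n) w => (i < s)%N && e' i w) w = y].
    by apply/seteqP; split => w /= <-; apply/ffunP => i; rewrite !ffunE.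
  apply: (sigma_process_patt (fun x => x = y)) => i.
  case: (ltnP i s) => ilts /=; last first.
    rewrite (_ : [set _ | is_true false] = set0); last by apply/seteqP; split.
    by rewrite /sigma_process; exact: sigma_algebra0.
  by apply: sigma_process_gt => /=; lia.
- move=> y.
  have -> : [set w | (psi \o patt e') w = y] = [set w | patt (fun (i : 'I_n) w => (s + l <= i)%N && e' i w) w = y].
    by apply/seteqP; split => w /= <-; apply/ffunP => i; rewrite !ffunE.
  apply: (sigma_process_patt (fun x => x = y)) => i.
  case: (leqP (s + l) i) => ilts /=; last first.
    rewrite (_ : [set _ | is_true false] = set0); last by apply/seteqP; split.
    by rewrite /sigma_process; exact: sigma_algebra0.
  by apply: sigma_process_gt => /=; lia.
Qed.

End mixing.

(** * Exceedances of the triangular array *)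

Section real_probability.
Context {R : realType} d (T : measurableType d) (P : probability T R).
Implicit Types A B : set T.

Lemma fine_prob_le A B : measurable A -> measurable B -> A `<=` B ->
  fine (P A) <= fine (P B).
Proof.
by move=> mA mB AB; rewrite fine_le ?fin_num_measure// le_measure ?inE.
Qed.

Lemma fine_prob_setC A : measurable A -> fine (P (~` A)) = 1 - fine (P A).
Proof.
by move=> mA; rewrite probability_setC// fineB ?fin_num_measure.
Qed.

Lemma fine_prob_le1 A : measurable A -> fine (P A) <= 1.
Proof.
by move=> mA; rewrite -lee_fin fineK ?fin_num_measure// probability_le1.
Qed.

Lemma fine_prob_setU_le A B : measurable A -> measurable B ->
  fine (P (A `|` B)) <= fine (P A) + fine (P B).
Proof.
move=> mA mB; have mAB := measurableU _ _ mA mB.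
by rewrite -lee_fin EFinD !fineK ?fin_num_measure// measureU2.
Qed.

Variable X : {RV P >-> R}.

Lemma cdfRE x : cdfR X x = fine (P [set w | X w <= x]).
Proof.
rewrite /cdfR; congr (fine (P _)); apply/seteqP; split=> w /=; by rewrite in_itv.
Qed.

Lemma measurable_le_RV (a : R) : measurable [set w | X w <= a].
Proof.
have -> : [set w | X w <= a] = ~` [set w | a < X w].
  by apply/seteqP; split=> w /=; rewrite leNgt => /negP.
by apply: measurableC; exact: measurable_gt_RV.
Qed.

Lemma prob_gt_RV x : fine (P [set w | x < X w]) = 1 - cdfR X x.
Proof.
rewrite cdfRE -fine_prob_setC; last exact: measurable_le_RV.
congr (fine (P _)); apply/seteqP; split=> w /=; by rewrite ltNge => /negP.
Qed.

Lemma cdfR_homo x y : x <= y -> cdfR X x <= cdfR X y.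
Proof.
move=> xy; rewrite !cdfRE fine_prob_le//; try exact: measurable_le_RV.
by move=> w /= h; exact: le_trans h xy.
Qed.

Hypothesis cX : continuous (cdfR X).

Lemma measurable_cdfR_gt (v : R) : measurable [set w | v < cdfR X (X w)].
Proof.
have mc : measurable_fun setT (cdfR X) by exact: measurable_realfun.continuous_measurable_fun.
have -> : [set w | v < cdfR X (X w)] = (cdfR X \o X) @^-1` `]v, +oo[.
  by apply/seteqP; split=> w /=; rewrite in_itv/= andbT.
rewrite -[X in measurable X]setTI.
exact: (measurableT_comp mc (measurable_funPT X) measurableT (measurable_itv _)).
Qed.

(** The probability integral transform: [cdfR X] may be flat, but only where
[X] has no mass. *)
Lemma cdfR_transform_gt u : fine (P [set w | cdfR X u < cdfR X (X w)]) = 1 - cdfR X u.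
Proof.
apply/eqP; rewrite eq_le; apply/andP; split.
  rewrite -prob_gt_RV; apply: fine_prob_le.
  - exact: measurable_cdfR_gt.
  - exact: measurable_gt_RV.
  - by move=> w /=; apply: contraTT; rewrite -!leNgt; exact: cdfR_homo.
rewrite leNgt; apply/negP; set p := fine _ => pv.
have p0 : 0 <= p by exact: fine_ge0.
set v := cdfR X u in pv *.
pose e := (1 - v - p) / 2.
have e0 : 0 < e by rewrite /e; lra.
have ve1 : v + e < 1 by rewrite /e; lra.
have [b vb] : exists b, v + e < cdfR X b.
  have h : cdfR X x @[x --> +oo] --> (1 : R).
    by apply: fine_cvg; exact: cvg_cdfy1.
  near (pinfty_nbhs R) => b; exists b; near: b.
  exact: (cvgr_gt _ h).
have ub : u <= b.
  by case: leP => // /ltW /cdfR_homo; rewrite -/v; lra.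
have vvb : v <= cdfR X b by lra.
have [u' _ Gu'] : exists2 u', u' \in `[u, b] & cdfR X u' = v + e.
  apply: IVT => //; first by exact: continuous_subspaceT.
  by rewrite -/v min_l// max_r//; lra.
have : 1 - (v + e) <= p.
  rewrite -Gu' -prob_gt_RV; apply: fine_prob_le.
  - exact: measurable_gt_RV.
  - exact: measurable_cdfR_gt.
  - move=> w /= /ltW /cdfR_homo; rewrite Gu'; apply: lt_le_trans; rewrite -/v ltrDl//.
by rewrite /e; lra.
Unshelve. all: end_near. Qed.

Lemma cdfR_transform_null u :
  fine (P ([set w | u < X w] `\` [set w | cdfR X u < cdfR X (X w)])) = 0.
Proof.
have m1 := measurable_gt_RV X u; have m2 := measurable_cdfR_gt (cdfR X u).
have sub : [set w | cdfR X u < cdfR X (X w)] `<=` [set w | u < X w].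
  by move=> w /=; apply: contraTT; rewrite -!leNgt; exact: cdfR_homo.
rewrite measureD ?(setIidr sub)//; last by rewrite ltey_eq fin_num_measure.
by rewrite fineB ?fin_num_measure// prob_gt_RV cdfR_transform_gt subrr.
Qed.

End real_probability.

Lemma eq_prob_patt_ae {R : realType} d (T : measurableType d) (P : probability T R)
  (I : finType) (e1 e2 : I -> T -> bool) (Q : {ffun I -> bool} -> Prop) :
  (forall i, measurable [set w | e1 i w]) ->
  (forall i, measurable [set w | e2 i w]) ->
  (forall i, fine (P ([set w | e1 i w] `\` [set w | e2 i w])) = 0) ->
  (forall i w, e2 i w -> e1 i w) ->
  P [set w | Q (patt e1 w)] = P [set w | Q (patt e2 w)].
Proof.
move=> m1 m2 null sub.
pose N := \big[setU/set0]_(i : I) ([set w | e1 i w] `\` [set w | e2 i w]).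
have mN : measurable N by apply: bigsetU_measurable => i _; exact: measurableD.
have PN : fine (P N) = 0.
  apply/eqP; rewrite eq_le fine_ge0// andbT /N.
  suff [] : measurable N /\ fine (P N) <= 0 by [].
  rewrite /N; elim/big_ind: _.
  - by rewrite measure0.
  - move=> A B [mA PA] [mB PB]; split; first exact: measurableU.
    apply: le_trans (fine_prob_setU_le P mA mB) _; lra.
  - by move=> i _; rewrite null; split => //; exact: measurableD.
have mQ1 := measurable_patt Q m1; have mQ2 := measurable_patt Q m2.
have same w : ~ N w -> patt e1 w = patt e2 w.
  move=> Nw; apply/ffunP => i; rewrite !ffunE.
  case e2i : (e2 i w); first by rewrite (sub _ _ e2i).
  apply/negP => e1i; apply: Nw; rewrite /N (bigD1 i)//=; left; split => //=.
  by rewrite e2i.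
rewrite -[LHS]fineK ?fin_num_measure// -[RHS]fineK ?fin_num_measure//; congr EFin.
apply/eqP; rewrite eq_le; apply/andP; split.
  rewrite -[leRHS]addr0 -[in leRHS]PN; apply: le_trans (fine_prob_setU_le P mQ2 mN).
  apply: fine_prob_le => //; first exact: measurableU.
  by move=> w /= Qw; have [?|/same <-] := pselect (N w); [right|left].
rewrite -[leRHS]addr0 -[in leRHS]PN; apply: le_trans (fine_prob_setU_le P mQ1 mN).
apply: fine_prob_le => //; first exact: measurableU.
by move=> w /= Qw; have [?|/same ->] := pselect (N w); [right|left].
Qed.

Section thresholds.
Context {R : realType} (F : cumulativeBounded (0 : R) (1 : R)).

Lemma cumulative_homo x y : x <= y -> F x <= F y.
Proof. by move=> xy; exact: cumulative_is_nondecreasing. Qed.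

Lemma cumulative_lt x y : F x < F y -> x < y.
Proof. by apply: contraTT; rewrite -!leNgt; exact: cumulative_homo. Qed.

Lemma cumulative_ge0 x : 0 <= F x.
Proof.
rewrite leNgt; apply/negP => Fx.
have [b [bx Fb]] : exists b, b <= x /\ F x < F b.
  near (ninfty_nbhs R) => b; exists b; split; near: b.
    by apply: nbhs_ninfty_le; exact: num_real.
  exact: (cvgr_gt _ (cumulativeNy F)).
by have := cumulative_homo bx; lra.
Unshelve. all: end_near. Qed.

Lemma cumulative_le1 x : F x <= 1.
Proof.
rewrite leNgt; apply/negP => Fx.
have [b [bx Fb]] : exists b, x <= b /\ F b < F x.
  near (pinfty_nbhs R) => b; exists b; split; near: b.
    by apply: nbhs_pinfty_ge; exact: num_real.
  exact: (cvgr_lt _ (cumulativey F)).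
by have := cumulative_homo bx; lra.
Unshelve. all: end_near. Qed.

Hypothesis cF : continuous F.

Lemma threshold_exists v : 0 < v -> v < 1 -> exists u, 1 - F u = v.
Proof.
move=> v0 v1.
have [b Fb] : exists b, 1 - v < F b.
  near (pinfty_nbhs R) => b; exists b; near: b.
  by apply: (cvgr_gt _ (cumulativey F)); lra.
have [a Fa] : exists a, F a < 1 - v.
  near (ninfty_nbhs R) => a; exists a; near: a.
  by apply: (cvgr_lt _ (cumulativeNy F)); lra.
have ab : a <= b by apply: ltW; apply: cumulative_lt; lra.
have [u _ Fu] : exists2 u, u \in `[a, b] & F u = 1 - v.
  apply: IVT => //; first by exact: continuous_subspaceT.
  by rewrite min_l ?max_r ?cumulative_homo//; lra.
by exists u; rewrite Fu; lra.
Unshelve. all: end_near. Qed.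

End thresholds.

Lemma card_in_block n r j : (0 < r)%N -> (#|@in_block n r j| <= r)%N.
Proof.
case: r => // r' _.
pose f (i : 'I_n) : 'I_r'.+1 := inord (i - j * r'.+1).
have inj : {in @in_block n r'.+1 j &, injective f}.
  move=> i i'; rewrite !inE => /andP[h1 h2] /andP[h3 h4] /(congr1 val).
  rewrite /f/= !inordK; try (by rewrite ltn_subLR// -mulSnr).
  by move=> h; apply: val_inj; rewrite /= -(subnK h1) -(subnK h3) h.
by have <- := card_in_imset inj; rewrite -[leqRHS]card_ord; exact: max_card.
Qed.

Section model_consequences.
Context {R : realType} (d : nat -> measure_display) (T : forall n : nat, measurableType (d n))
  (P : forall n : nat, probability (T n) R)
  (X : forall n : nat, nat -> {RV (P n) >-> R})
  (d0 : measure_display) (T0 : measurableType d0) (P0 : probability T0 R)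
  (U : int -> {RV P0 >-> R})
  (F : cumulativeBounded (0 : R) (1 : R)) (c A : R -> R).

(** A level close to 0 forces [u] close to the end point, where the rate [A] is
small; the bound depends neither on the sample size nor on the index. *)
Lemma uniform_tail : continuous F -> second_order X F c A ->
  forall e : R, 0 < e -> exists2 v0 : R, 0 < v0 &
    forall u, 0 < 1 - F u -> 1 - F u < v0 -> forall n i, (1 <= i <= n)%N ->
      `|(1 - cdfR (X n i) u) / (1 - F u) - c (i%:R / n%:R)| <= e.
Proof.
move=> cF [_ _ A0 [C [y yx hC]]] e e0.
have [M hM] : exists M, forall t, M < t -> `|A t| < e / (`|C| + 1).
  have e'0 : 0 < e / (`|C| + 1) by rewrite divr_gt0// ltr_wpDl.
  have /cvgr0Pnorm_lt/(_ _ e'0) [M [_ hM]] := A0.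
  by exists M => t Mt; exact: hM.
have [_ [z /= Fz <-] yz] := ereal_sup_gt yx.
exists (Num.min (1 - F z) (`|M| + 1)^-1).
  by rewrite lt_min subr_gt0 Fz/= invr_gt0 ltr_wpDl.
move=> u u0; rewrite lt_min => /andP[uz uM] n i ni.
have zu : z < u by apply: (@cumulative_lt _ F); lra.
have [u' Fu'] : exists u', 1 - F u' = (1 - F u) / 2.
  by have F0 := cumulative_ge0 F u; apply: (threshold_exists cF); lra.
have uu' : u < u' by apply: (@cumulative_lt _ F); lra.
have ux : (u%:E < right_endpoint F)%E.
  apply: (@lt_le_trans _ _ u'%:E); first by rewrite lte_fin.
  by apply: ereal_sup_ubound; exists u' => //=; lra.
have yu : y < u by rewrite lte_fin in yz; exact: lt_trans yz zu.
apply: le_trans (hC u (conj yu ux) n i ni) _.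
have Mu : `|M| + 1 < (1 - F u)^-1.
  by rewrite -[ltLHS]invrK ltf_pV2 ?posrE ?invr_gt0// ltr_wpDl.
have /hM : M < (1 - F u)^-1 by have := ler_norm M; lra.
rewrite ltr_pdivlMr ?ltr_wpDl// => hA.
apply: le_trans (ler_norm _) _; rewrite normrM.
by have := normr_ge0 (A (1 - F u)^-1); lra.
Qed.

Hypothesis hmodel : model X F c U.

Definition exceed n (u : R) (i : 'I_n) (w : T n) : bool := u < X n i.+1 w.

Lemma measurable_exceed n u (i : 'I_n) : measurable [set w | exceed u i w].
Proof. exact: measurable_gt_RV. Qed.

Lemma measurable_exceed_event n u (Q : ('I_n -> R) -> Prop) :
  measurable [set w : T n | Q (fun i => (exceed u i w)%:R)].
Proof.
rewrite (_ : [set w | _] = [set w | (fun x : {ffun 'I_n -> bool} => Q (fun i => (x i)%:R))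
    (patt (@exceed n u) w)]).
  apply: (measurable_patt (fun x : {ffun 'I_n -> bool} => Q (fun i => (x i)%:R))) => i.
  exact: measurable_exceed.
by congr mkset; apply/funext => w; congr Q; apply/funext => i; rewrite ffunE.
Qed.

Lemma index_range n (i : 'I_n) : (1 <= i.+1 <= n)%N.
Proof. by rewrite ltn_ord. Qed.

(** Up to null events, an observation exceeds [u] exactly when its uniform
transform exceeds the transformed threshold. The thresholds then vary with the
index, which is why patterns are studied for a threshold per index. *)
Lemma exceed_transfer n u (Q : {ffun 'I_n -> bool} -> Prop) : (0 < n)%N ->
  P n [set w | Q (patt (@exceed n u) w)] =
  P0 [set w | Q (patt (fun (i : 'I_n) w => cdfR (X n i.+1) u < U i.+1%:Z w) w)].
Proof.
move=> n0; have [V VU hV] := model_excerpt hmodel n0.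
have cX (i : 'I_n) : continuous (cdfR (X n i.+1)).
  by apply: (model_cdf_continuous hmodel); exact: index_range.
rewrite (@eq_prob_patt_ae _ _ _ _ _ _
   (fun (i : 'I_n) w => cdfR (X n i.+1) u < cdfR (X n i.+1) (X n i.+1 w))).
- rewrite -(same_law_patt (fun i : 'I_n => i.+1%:Z) _ Q VU); congr (P n _).
  congr mkset; apply/funext => w; congr Q; apply/ffunP => i; rewrite !ffunE.
  by rewrite (hV i.+1)// index_range.
- by move=> i; exact: measurable_exceed.
- by move=> i; exact: measurable_cdfR_gt.
- by move=> i; exact: cdfR_transform_null.
- by move=> i w; apply: contraTT; rewrite -!leNgt; exact: cdfR_homo.
Qed.

Lemma exceed_weakly_dependent n u l : (0 < n)%N ->
  weakly_dependent (pat_law (P n) (@exceed n u)) l (2 * beta_mixing U l).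
Proof.
move=> n0.
have -> : pat_law (P n) (@exceed n u) =
    pat_law P0 (fun (i : 'I_n) w => cdfR (X n i.+1) u < U i.+1%:Z w).
  by apply/funext => x; congr fine; exact: (exceed_transfer u (fun y => y = x) n0).
exact: beta_weakly_dependent (model_stationary hmodel).
Qed.

Lemma exceed_law_prob n u : prob_weights (pat_law (P n) (@exceed n u)).
Proof. by apply: pat_law_prob => i; exact: measurable_exceed. Qed.

Lemma pE_exceed n u (i : 'I_n) :
  pE (pat_law (P n) (@exceed n u)) (fun x => (x i)%:R) = 1 - cdfR (X n i.+1) u.
Proof.
have := pE_pat_law (P n) (fun x : {ffun 'I_n -> bool} => x i) (measurable_exceed u).
move/(congr1 fine) => /= <-; rewrite -prob_gt_RV; congr (fine (P n _)).
by congr mkset; apply/funext => w; rewrite ffunE.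
Qed.

(** The patterns of exceedances have the mixing property of the stationary
sequence, so that [block_lln] applies to them. *)
Lemma exceed_block_lln n u r l J (e M eta : R) (b : nat -> {ffun 'I_n -> bool} -> R) :
  let p := pat_law (P n) (@exceed n u) in
  (0 < n)%N -> (l <= r)%N -> (forall j x, 0 <= b j x <= e) ->
  (forall j, depends_on (in_block r j) (b j)) -> 0 < eta ->
  \sum_(0 <= j < J) pE p (b j) <= M ->
  (P n [set w | 2 * eta < `|\sum_(0 <= j < J) b j (patt (@exceed n u) w)
                            - \sum_(0 <= j < J) pE p (b j)|]%R
   <= (lln_const M eta * (J%:R * (2 * beta_mixing U l) + e * M))%:E)%E.
Proof.
move=> p n0 lr be bdep eta0 hM.
rewrite (pE_pat_law (P n) (fun x => 2 * eta < `|\sum_(0 <= j < J) b j x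
   - \sum_(0 <= j < J) pE p (b j)|) (measurable_exceed u)) lee_fin.
apply: block_lln lr _ be bdep eta0 hM; first exact: exceed_law_prob.
exact: exceed_weakly_dependent.
Qed.

(** The incomplete last block counts as one more block; a block contains at most
[r] summands of size at most [W]. *)
Lemma weighted_exceed_lln n u r l (wt : 'I_n -> R) (W M eta : R) :
  (0 < n)%N -> (0 < r)%N -> (l <= r)%N -> (forall i, 0 <= wt i <= W) ->
  0 < eta -> \sum_(i < n) wt i * (1 - cdfR (X n i.+1) u) <= M ->
  (P n [set w | 2 * eta < `|\sum_(i < n) wt i * (exceed u i w)%:R
                            - \sum_(i < n) wt i * (1 - cdfR (X n i.+1) u)|]%R
   <= (lln_const M eta * ((n %/ r).+1%:R * (2 * beta_mixing U l) + r%:R * W * M))%:E)%E.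
Proof.
move=> n0 r0 lr wtW eta0 hM.
pose b j (x : {ffun 'I_n -> bool}) := \sum_(i < n | in_block r j i) wt i * (x i)%:R.
have split_blocks (f : 'I_n -> R) :
    \sum_(0 <= j < (n %/ r).+1) \sum_(i < n | in_block r j i) f i = \sum_(i < n) f i.
  have hi (i : 'I_n) : (i %/ r < (n %/ r).+1)%N.
    by rewrite ltnS leq_div2r// ltnW.
  rewrite big_mkord [RHS](partition_big (fun i => Ordinal (hi i)) predT)//=.
  apply: eq_bigr => j _; apply: eq_bigl => i.
  rewrite -val_eqE/= eqn_leq leq_divRL// -ltnS ltn_divLR// andbC.
  by rewrite /in_block/=.
have bE j : pE (pat_law (P n) (@exceed n u)) (b j)
    = \sum_(i < n | in_block r j i) wt i * (1 - cdfR (X n i.+1) u).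
  by rewrite pE_sum; apply: eq_bigr => i _; rewrite pEZ pE_exceed.
have bs x : \sum_(0 <= j < (n %/ r).+1) b j x = \sum_(i < n) wt i * (x i)%:R.
  exact: (split_blocks (fun i => wt i * (x i)%:R)).
have Ebs : \sum_(0 <= j < (n %/ r).+1) pE (pat_law (P n) (@exceed n u)) (b j)
    = \sum_(i < n) wt i * (1 - cdfR (X n i.+1) u).
  by rewrite -[RHS]split_blocks; apply: eq_bigr => j _.
have W0 : 0 <= W by have /andP[] := wtW (Ordinal n0); exact: le_trans.
have := @exceed_block_lln n u r l (n %/ r).+1 (r%:R * W) M eta b n0 lr _ _ eta0 _.
rewrite Ebs; set S1 := [set w | _]; set S2 := [set w | _] => h.
have -> : S2 = S1.
  congr mkset; apply/funext => w; rewrite bs; congr (_ < `|_ - _|).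
  by apply: eq_bigr => i _; rewrite ffunE.
apply: h => //.
- move=> j x; apply/andP; split.
    by apply: sumr_ge0 => i _; rewrite mulr_ge0//; case/andP: (wtW i).
  apply: (@le_trans _ _ (\sum_(i < n | in_block r j i) W)).
    apply: ler_sum => i _; case/andP: (wtW i) => w0 w1.
    by case: (x i); rewrite ?mulr1 ?mulr0.
  rewrite sumr_const -[W *+ _]mulr_natl ler_wpM2r// ler_nat.
  exact: card_in_block.
- move=> j x y xy; apply: eq_bigr => i ij; congr (_ * _%:R).
  by rewrite xy.
Qed.
End model_consequences.

(** * Riemann sums of discontinuous functions *)

Section real_integrals.
Context {R : realType}.
Local Notation mu := (@lebesgue_measure R).

Lemma measurable_inv : measurable_fun [set: R] (fun x : R => x^-1).
Proof.
rewrite (_ : [set: R] = [set x | x != 0] `|` [set 0]); last first.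
  by apply/seteqP; split=> // x _; case: (eqVneq x 0) => [->|]; [right|left].
have o0 : open [set x : R | x != 0] by exact: open_neq.
apply/measurable_funU => //; first exact: measurable_realfun.open_measurable.
split; last exact: measurable_fun_set1.
apply: measurable_realfun.open_continuous_measurable_fun => // x.
by rewrite inE /= => x0; exact: inv_continuous.
Qed.

Lemma bounded_integrable (D : set R) (f : R -> R) (B : R) : measurable D ->
  (mu D < +oo)%E -> measurable_fun D f -> (forall x, D x -> `|f x| <= B) ->
  mu.-integrable D (EFin \o f).
Proof.
move=> mD fD mf fB; apply: measurable_bounded_integrable => //.
by exists B; split; rewrite ?num_real// => M BM x Dx /=; apply: le_trans (fB x Dx) (ltW BM).
Qed.

Lemma integrable_subR (D : set R) (f g : R -> R) : measurable D ->
  mu.-integrable D (EFin \o f) -> mu.-integrable D (EFin \o g) ->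
  mu.-integrable D (EFin \o (fun x => f x - g x)).
Proof.
move=> mD fi gi.
rewrite (_ : EFin \o _ = ((EFin \o f) \- (EFin \o g))%E)//.
exact: integrableB.
Qed.
Lemma integrable_addR (D : set R) (f g : R -> R) : measurable D ->
  mu.-integrable D (EFin \o f) -> mu.-integrable D (EFin \o g) ->
  mu.-integrable D (EFin \o (fun x => f x + g x)).
Proof.
move=> mD fi gi.
rewrite (_ : EFin \o _ = ((EFin \o f) \+ (EFin \o g))%E)//.
exact: integrableD.
Qed.
Lemma integrable_normR (D : set R) (f : R -> R) : measurable D ->
  mu.-integrable D (EFin \o f) -> 
  mu.-integrable D (EFin \o (fun x => `|f x|)).
Proof.
move=> mD fi.
rewrite (_ : EFin \o _ = (abse \o (EFin \o f)))//.
exact: integrable_abse.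
Qed.

(** The integral of a nonnegative function is a supremum over the simple
functions below it, so that pointwise comparison suffices. *)
Lemma ge0_le_integral_restrict (D D' : set R) (f g : R -> \bar R) :
  (forall x, D x -> 0 <= f x)%E -> (forall x, D' x -> 0 <= g x)%E ->
  (forall x, ((f \_ D) x <= (g \_ D') x)%E) ->
  (\int[mu]_(x in D) f x <= \int[mu]_(x in D') g x)%E.
Proof.
move=> f0 g0 fg.
have fD0 x : (0 <= (f \_ D) x)%E.
  by rewrite /patch; case: ifP => // /set_mem /f0.
have gD0 x : (0 <= (g \_ D') x)%E.
  by rewrite /patch; case: ifP => // /set_mem /g0.
rewrite integral_mkcond [leRHS]integral_mkcond.
rewrite !ge0_integralTE//; apply: le_ereal_sup => _ [k /= hk <-].
by exists k => //= x; apply: le_trans (hk x) (fg x).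
Qed.

(** Measurability is asked on the interior, where boundary kernels agree with
the plain kernel; the rest of the unit interval has length [2 h]. *)
Lemma Rintegral_crop (f : R -> R) (h B : R) : 0 < h -> h < 2^-1 ->
  (forall x, 0 <= x <= 1 -> 0 <= f x <= B) -> measurable_fun `]h, (1 - h)[ f ->
  \int[mu]_(x in `]h, (1 - h)[) f x <= \int[mu]_(x in `[0, 1]) f x
    <= \int[mu]_(x in `]h, (1 - h)[) f x + B * (2 * h).
Proof.
move=> h0 h2 fB mf.
set I : set R := `]h, (1 - h)[%classic; set D : set R := `[0, 1]%classic.
have mI : measurable I by exact: measurable_itv.
have mD : measurable D by exact: measurable_itv.
have B0 : 0 <= B by have := fB 0; rewrite lexx ler01 => /(_ isT); lra.
have ID : I `<=` D by move=> x; rewrite /I /D /= !in_itv/=; lra.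
have fB' x : D x -> 0 <= f x <= B by rewrite /D /= in_itv/=; exact: fB.
have muI : (mu I = (1 - 2 * h)%:E)%E.
  rewrite /I lebesgue_measure_itv/= lte_fin ifT; last lra.
  by rewrite EFinN -EFinB; congr EFin; ring.
have muD : mu D = 1%:E by rewrite /D lebesgue_measure_itv/= lte_fin ltr01 oppr0 adde0.
have muDI : (mu (D `\` I) = (2 * h)%:E)%E.
  rewrite measureD//; last by rewrite ltey_eq; apply/orP; left; rewrite [X in X \is a fin_num]muD.
  rewrite (setIidr ID) [X in (X - _)%E]muD [X in (_ - X)%E]muI -EFinB; congr EFin; ring.
have If : mu.-integrable I (EFin \o f).
  apply: (@bounded_integrable _ _ B) => //; first by rewrite [ltLHS]muI ltry.
  by move=> x /ID /fB' /andP[? ?]; rewrite ger0_norm.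
have fin_I : (\int[mu]_(x in I) (f x)%:E)%E \is a fin_num by exact: integrable_fin_num.
have f0 x : D x -> (0 <= (f x)%:E)%E by move=> /fB' /andP[? _]; rewrite lee_fin.
have le1 : (\int[mu]_(x in I) (f x)%:E <= \int[mu]_(x in D) (f x)%:E)%E.
  apply: ge0_le_integral_restrict => // [x /ID /f0//|x].
  rewrite /patch; case: ifPn => [/set_mem Ix|_]; first by rewrite mem_set//; exact: ID.
  by case: ifP => // /set_mem /f0.
have le2 : (\int[mu]_(x in D) (f x)%:E <= \int[mu]_(x in I) (f x)%:E + (B * (2 * h))%:E)%E.
  have -> : (\int[mu]_(x in I) (f x)%:E + (B * (2 * h))%:E =
     \int[mu]_x (((EFin \o f) \_ I) x + ((EFin \o cst B) \_ (D `\` I)) x))%E.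
    rewrite ge0_integralD//.
    - rewrite -!integral_mkcond; congr (_ + _)%E.
      rewrite EFinM -[X in (_ * X)%E]muDI -integral_cst//; exact: measurableD.
    - by move=> x _; rewrite /patch; case: ifP => // /set_mem /ID /f0.
    - rewrite (_ : (EFin \o f) \_ I = EFin \o (f \_ I)).
        by apply/measurable_realfun.measurable_EFinP; apply/(measurable_restrictT _ mI).
      by apply/funext => x; rewrite /patch/=; case: ifP.
    - by move=> x _; rewrite /patch; case: ifP => //=; rewrite lee_fin.
    - rewrite (_ : (EFin \o cst B) \_ _ = EFin \o (cst B \_ (D `\` I))).
        apply/measurable_realfun.measurable_EFinP.
        by apply/(measurable_restrictT _ (measurableD mD mI)); exact: measurable_cst.
      by apply/funext => x; rewrite /patch/=; case: ifP.
  rewrite -[leRHS]/(\int[mu]_(x in setT) _)%E.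
  apply: ge0_le_integral_restrict => //.
    move=> x _; apply: adde_ge0.
      by rewrite /patch; case: ifP => // /set_mem /ID /f0.
    by rewrite /patch; case: ifP => //=; rewrite lee_fin.
  move=> x; rewrite [X in (_ <= X)%E]patchT ?inE// /patch.
  case: ifPn => [/set_mem Dx|Dx].
    case: ifPn => [/set_mem Ix|/negP nIx].
      rewrite ifF ?adde0//; apply/negP => /set_mem [_]; exact.
    rewrite ifT ?add0e ?lee_fin; first by case/andP: (fB' x Dx).
    by apply/mem_set; split => // Ix; apply: nIx; apply/mem_set.
  rewrite ifF ?add0e; last by apply/negP => /set_mem /ID Dx'; move/negP: Dx; apply; exact/mem_set.
  by case: ifP => //=; rewrite lee_fin.
have fin_D : (\int[mu]_(x in D) (f x)%:E)%E \is a fin_num.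
  rewrite ge0_fin_numE; last exact: integral_ge0.
  by apply: le_lt_trans le2 _; rewrite -(fineK fin_I) -EFinD ltry.
rewrite /Rintegral; apply/andP; split; first by rewrite fine_le.
by rewrite -lee_fin EFinD !fineK.
Qed.

Lemma Rintegral_itv_split (f : R -> R) (a b c : R) : a <= b -> b <= c ->
  mu.-integrable `[a, c] (EFin \o f) ->
  \int[mu]_(x in `[a, c]) f x =
    \int[mu]_(x in `[a, b]) f x + \int[mu]_(x in `]b, c]) f x.
Proof.
move=> ab bc fi.
by rewrite -(Rintegral_itvB (x := b) fi) ?bnd_simp//; ring.
Qed.

Lemma Rintegral_cell (f w : R -> R) (s t : R) : s <= t ->
  mu.-integrable `]s, t] (EFin \o f) -> mu.-integrable `]s, t] (EFin \o w) ->
  (forall x, s < x <= t -> `|f t - f x| <= w x) ->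
  `|(t - s) * f t - \int[mu]_(x in `]s, t]) f x| <= \int[mu]_(x in `]s, t]) w x.
Proof.
move=> st fi wi fw.
have m1 : measurable `]s, t]%classic by exact: measurable_itv.
have mst : fine (mu `]s, t]%classic) = t - s.
  rewrite lebesgue_measure_itv/= lte_fin; case: ltP => //= ts; lra.
have ci : mu.-integrable `]s, t] (EFin \o cst (f t)).
  apply: (@bounded_integrable _ _ `|f t|) => //.
  by rewrite lebesgue_measure_itv/=; case: ifP; rewrite ?ltry// -EFinB ltry.
rewrite -mst mulrC -(Rintegral_cst mu m1) -RintegralB//.
have di : mu.-integrable `]s, t] (EFin \o (fun x => f t - f x)).
  exact: (integrable_subR m1 ci fi).
apply: (@le_trans _ _ (\int[mu]_(x in `]s, t]) `|f t - f x|)).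
  exact: le_normr_Rintegral.
apply: le_Rintegral => //.
exact: (integrable_normR m1 di).
Qed.

(** Error of a Riemann sum with right end points, bounded by the integral of a
local modulus of continuity; an integrable modulus allows jumps. *)
Lemma riemann_sum_error (f w : R -> R) (a dl : R) : 0 <= dl -> forall n : nat,
  mu.-integrable `[a, a + n%:R * dl] (EFin \o f) ->
  mu.-integrable `[a, a + n%:R * dl] (EFin \o w) ->
  (forall x y, a <= x -> x <= y -> y <= x + dl -> y <= a + n%:R * dl -> `|f y - f x| <= w x) ->
  (forall x, 0 <= w x) ->
  `|dl * (\sum_(i < n) f (a + i.+1%:R * dl)) - \int[mu]_(x in `[a, a + n%:R * dl]) f x|
    <= \int[mu]_(x in `[a, a + n%:R * dl]) w x.
Proof.
move=> dl0; elim=> [|n ih] fi wi fw w0.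
  by rewrite big_ord0 mulr0 mul0r addr0 set_itv1 !Rintegral_set1 subrr normr0.
set b := a + n%:R * dl; set c := a + n.+1%:R * dl.
have cb : c - b = dl by rewrite /c /b -natr1; ring.
have ab : a <= b by rewrite lerDl mulr_ge0.
have bc : b <= c by lra.
have m1 : measurable `]b, c]%classic by exact: measurable_itv.
have m2 : measurable `[a, b]%classic by exact: measurable_itv.
have m3 : measurable `[a, c]%classic by exact: measurable_itv.
have s1 : `[a, b]%classic `<=` `[a, c]%classic by move=> x /=; rewrite !in_itv/=; lra.
have s2 : `]b, c]%classic `<=` `[a, c]%classic by move=> x /=; rewrite !in_itv/=; lra.
rewrite (Rintegral_itv_split ab bc fi) (Rintegral_itv_split ab bc wi).
rewrite big_ord_recr/= mulrDr opprD addrACA.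
apply: (le_trans (ler_normD _ _)); rewrite lerD//.
  apply: ih => //.
  - exact: integrableS fi.
  - exact: integrableS wi.
  - by move=> x y ax xy yx yb; apply: fw => //; apply: le_trans yb bc.
rewrite -/c -{1}cb; apply: Rintegral_cell => //.
- exact: integrableS fi.
- exact: integrableS wi.
- by move=> x /andP[bx xc]; apply: fw => //; lra.
Qed.

Lemma integrable_cst_itv (a b r : R) : mu.-integrable `[a, b] (EFin \o cst r).
Proof.
apply: (@bounded_integrable _ _ `|r|) => //.
by rewrite lebesgue_measure_itv/=; case: ifP; rewrite ?ltry// -EFinB ltry.
Qed.

Lemma hoelder_riemann_sum (f : R -> R) (C : R) (n : nat) : (0 < n)%N -> 0 <= C ->
  mu.-integrable `[0, 1] (EFin \o f) ->
  (forall x y, 0 <= x <= 1 -> 0 <= y <= 1 -> `|f x - f y| <= C * Num.sqrt `|x - y|) ->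
  `|n%:R^-1 * (\sum_(i < n) f (i.+1%:R / n%:R)) - \int[mu]_(x in `[0, 1]) f x|
    <= C * Num.sqrt n%:R^-1.
Proof.
move=> n0 C0 fi hf.
have nR : (0 : R) < n%:R by rewrite ltr0n.
have n1 : n%:R / n%:R = 1 :> R by rewrite divff// gt_eqF.
have -> : C * Num.sqrt n%:R^-1 =
    \int[mu]_(x in `[0, 0 + n%:R * n%:R^-1]) (cst (C * Num.sqrt n%:R^-1) x).
  have m01 : fine (mu `[0, 1]%classic) = 1.
    by rewrite lebesgue_measure_itv/= lte_fin ltr01 oppr0 adde0.
  rewrite n1 add0r Rintegral_cst// -[LHS]mulr1. by congr (_ * _).
have E := @riemann_sum_error f (cst (C * Num.sqrt n%:R^-1)) 0 n%:R^-1 _ n.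
rewrite n1 add0r in E *; under eq_bigr do rewrite -[_ / _]add0r.
apply: E => //.
- exact: integrable_cst_itv.
- move=> x y x0 xy yx y1; apply: le_trans (hf _ _ _ _) _; try lra.
  rewrite ler_wpM2l// ler_wsqrtr// ger0_norm; lra.
- by move=> x; rewrite mulr_ge0// sqrtr_ge0.
Qed.

Lemma Rintegral_cst_itv (a b r : R) : a <= b -> \int[mu]_(_ in `[a, b]) r = r * (b - a).
Proof.
move=> ab; have E : fine (mu `[a, b]%classic) = b - a.
  rewrite lebesgue_measure_itv/= lte_fin; case: ltP => //= ba; lra.
by rewrite Rintegral_cst//; congr (_ * _).
Qed.

Lemma Rintegral_restrict_itv (f : R -> R) (a b s t : R) : a <= s -> t <= b ->
  \int[mu]_(x in `[a, b]) (f \_ `[s, t]) x = \int[mu]_(x in `[s, t]) f x.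
Proof.
move=> as_ tb; rewrite [LHS]Rintegral_mkcond [RHS]Rintegral_mkcond.
apply: eq_Rintegral => x _; rewrite /patch.
case: ifPn => // xab; case: ifPn => // xst; exfalso; move/negP: xab; apply.
by move: xst; rewrite !inE/= !in_itv/=; lra.
Qed.

Lemma restrict_cst_integrable (a b s t r : R) :
  mu.-integrable `[a, b] (EFin \o ((cst r) \_ `[s, t])).
Proof.
apply: (@bounded_integrable _ _ `|r|) => //.
- by rewrite lebesgue_measure_itv/=; case: ifP; rewrite ?ltry// -EFinB ltry.
- apply: (@measurable_funS _ _ _ _ setT) => //.
  by apply/(measurable_restrictT _ (measurable_itv _)); exact: measurable_cst.
- by move=> x _; rewrite /patch; case: ifP; rewrite ?normr0.
Qed.

(** The kernel jumps at [-1] and [1]; the modulus pays for the jumps on two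
intervals of the length of a cell. *)
Lemma kernel_riemann_sum (g : R -> R) (Lam B a dl : R) (n : nat) :
  0 < dl -> dl <= 1 -> 0 <= Lam -> measurable_fun [set: R] g ->
  (forall x, `|g x| <= B) -> (forall x, 1 < `|x| -> g x = 0) ->
  (forall x y, `|x| <= 1 -> `|y| <= 1 -> `|g x - g y| <= Lam * `|x - y|) ->
  a <= -1 -> 1 <= a + n%:R * dl ->
  `|dl * (\sum_(i < n) g (a + i.+1%:R * dl)) - \int[mu]_(x in `[-1, 1]) g x|
    <= 2 * (Lam + B) * dl.
Proof.
move=> dl0 dl1 L0 mg gB g0 gL a1 b1; set b := a + n%:R * dl in b1 *.
have B0 : 0 <= B by apply: le_trans (gB 0).
pose w1 : R -> R := (cst (Lam * dl)) \_ `[-1, 1].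
pose w2 : R -> R := (cst B) \_ `[-1 - dl, -1].
pose w3 : R -> R := (cst B) \_ `[1 - dl, 1].
have i1 := restrict_cst_integrable a b (-1) 1 (Lam * dl).
have i2 := restrict_cst_integrable a b (-1 - dl) (-1) B.
have i3 := restrict_cst_integrable a b (1 - dl) 1 B.
have mab : measurable `[a, b]%classic by exact: measurable_itv.
have ge0_restrict (r s t x : R) : 0 <= r -> 0 <= ((cst r) \_ `[s, t]) x.
  by move=> r0; rewrite /patch; case: ifP.
have le_restrict (r s t : R) : 0 <= r -> s <= t ->
    \int[mu]_(x in `[a, b]) ((cst r) \_ `[s, t]) x <= r * (t - s).
  move=> r0 st; rewrite -(Rintegral_cst_itv r st).
  have cI : mu.-integrable `[s, t] (EFin \o cst r) by exact: integrable_cst_itv.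
  rewrite /Rintegral fine_le//.
  - by apply: integrable_fin_num => //; exact: restrict_cst_integrable.
  - by apply: integrable_fin_num.
  apply: ge0_le_integral_restrict => [x _|x _|x]; rewrite ?lee_fin//.
    exact: ge0_restrict.
  rewrite /patch/=; case: ifP => _; case: ifP => _ //=; by rewrite lee_fin.
have gi : mu.-integrable `[a, b] (EFin \o g).
  apply: (@bounded_integrable _ _ B) => //.
    by rewrite lebesgue_measure_itv/=; case: ifP; rewrite ?ltry// -EFinB ltry.
  exact: measurable_funTS.
have -> : \int[mu]_(x in `[-1, 1]) g x = \int[mu]_(x in `[a, b]) g x.
  rewrite -(Rintegral_restrict_itv g a1 b1); apply: eq_Rintegral => x _.
  rewrite /patch; case: ifPn => //; rewrite notin_setE/= in_itv/= => xn.
  by rewrite g0// ltNge ler_norml; apply/negP.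
have w10 x : 0 <= w1 x by apply: ge0_restrict; rewrite mulr_ge0// ltW.
have w20 x : 0 <= w2 x by exact: ge0_restrict.
have w30 x : 0 <= w3 x by exact: ge0_restrict.
pose w x := w1 x + (w2 x + w3 x).
have wi : mu.-integrable `[a, b] (EFin \o w).
  exact: (integrable_addR mab i1 (integrable_addR mab i2 i3)).
apply: le_trans (@riemann_sum_error g w a dl (ltW dl0) n gi wi _ _) _.
- move=> x y ax xy yx yb.
  case: (lerP `|x| 1) => x1; case: (lerP `|y| 1) => y1.
  + apply: le_trans (gL _ _ y1 x1) _; rewrite /w.
    rewrite (_ : w1 x = Lam * dl); last first.
      by rewrite /w1 /patch ifT// inE/= in_itv/= -ler_norml.
    rewrite ler_wpDr//; first by rewrite addr_ge0.
    by rewrite ler_wpM2l// ger0_norm; lra.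
  + rewrite (g0 y)// sub0r normrN; apply: le_trans (gB x) _.
    rewrite /w (_ : w3 x = B); last first.
      rewrite /w3 /patch ifT// inE/= in_itv/=.
      move: x1 y1; rewrite ler_norml lter_normr; lra.
    by rewrite addrA ler_wpDl// addr_ge0.
  + rewrite (g0 x)// subr0; apply: le_trans (gB y) _.
    rewrite /w (_ : w2 x = B); last first.
      rewrite /w2 /patch ifT// inE/= in_itv/=.
      move: x1 y1; rewrite ler_norml lter_normr; lra.
    by rewrite addrCA ler_wpDr// addr_ge0.
  + by rewrite !g0// subrr normr0 !addr_ge0.
- by move=> x; rewrite !addr_ge0.
rewrite RintegralD// ?RintegralD//; last exact: (integrable_addR mab i2 i3).
apply: (@le_trans _ _ (Lam * dl * (1 - -1) + (B * (-1 - (-1 - dl)) + B * (1 - (1 - dl))))).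
  rewrite lerD//; first by apply: le_restrict; [rewrite mulr_ge0// ltW|lra].
  by rewrite lerD//; apply: le_restrict => //; lra.
by rewrite le_eqVlt; apply/orP; left; apply/eqP; ring.
Qed.

End real_integrals.

(** * Events of small probability and exceedance counts *)

Section vanishing.
Context {R : realType} (d : nat -> measure_display) (T : forall n : nat, measurableType (d n))
  (P : forall n : nat, probability (T n) R).

(** Asymptotic smallness of events through measurable covers, so that events
can be combined without measurability side conditions. *)
Definition eventually_le (e : R) (B : forall n, set (T n)) : Prop :=
  \forall n \near \oo, exists C, [/\ measurable C, B n `<=` C & (P n C <= e%:E)%E].

Definition vanishing (B : forall n, set (T n)) : Prop :=
  forall e : R, 0 < e -> eventually_le e B.

Lemma eventually_le_sub e (B B' : forall n, set (T n)) :
  (\forall n \near \oo, B n `<=` B' n) -> eventually_le e B' -> eventually_le e B.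
Proof.
move=> BB' eB'; near=> n.
have [C [mC B'C PC]] : exists C, [/\ measurable C, B' n `<=` C & (P n C <= e%:E)%E].
  by near: n.
exists C; split => //; apply: subset_trans B'C; near: n; exact: BB'.
Unshelve. all: end_near. Qed.

Lemma eventually_leU e e' (B B' : forall n, set (T n)) :
  eventually_le e B -> eventually_le e' B' ->
  eventually_le (e + e') (fun n => B n `|` B' n).
Proof.
move=> eB eB'; near=> n.
have [C [mC BC PC]] : exists C, [/\ measurable C, B n `<=` C & (P n C <= e%:E)%E].
  by near: n.
have [C' [mC' BC' PC']] : exists C, [/\ measurable C, B' n `<=` C & (P n C <= e'%:E)%E].
  by near: n.
exists (C `|` C'); split; first exact: measurableU.
  exact: setUSS.
apply: le_trans (measureU2 _ mC mC') _.
by rewrite EFinD; exact: leeD.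
Unshelve. all: end_near. Qed.

Lemma vanishing_sub (B B' : forall n, set (T n)) :
  (\forall n \near \oo, B n `<=` B' n) -> vanishing B' -> vanishing B.
Proof. by move=> BB' vB' e e0; exact: eventually_le_sub (vB' e e0). Qed.

Lemma vanishingU (B B' : forall n, set (T n)) :
  vanishing B -> vanishing B' -> vanishing (fun n => B n `|` B' n).
Proof.
move=> vB vB' e e0; rewrite (splitr e).
by apply: eventually_leU; [apply: vB|apply: vB']; rewrite divr_gt0.
Qed.

Lemma vanishing_exists (N : nat) (B : nat -> forall n, set (T n)) :
  (forall i, (i < N)%N -> vanishing (B i)) ->
  vanishing (fun n => [set w | exists2 i, (i < N)%N & B i n w]).
Proof.
elim: N => [|N ih] vB.
  by move=> e e0; near=> n; exists set0; split => //; [move=> w []|rewrite measure0 lee_fin ltW].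
apply: (@vanishing_sub _ (fun n => [set w | exists2 i, (i < N)%N & B i n w] `|` B N n)).
  near=> n => w [i]; rewrite ltnS leq_eqVlt => /orP[/eqP ->|iN Bi]; first by right.
  by left; exists i.
by apply: vanishingU; [apply: ih => i iN; apply: vB; exact: ltnW|exact: vB].
Unshelve. all: end_near. Qed.

Lemma cvg_in_prob_vanishing (Y : forall n, T n -> R) (a : R) :
  (\forall n \near \oo, forall e, measurable [set w | e < `|Y n w - a|]) ->
  (forall e, 0 < e -> vanishing (fun n => [set w | e < `|Y n w - a|])) ->
  cvg_in_prob P Y a.
Proof.
move=> mY vY e e0.
apply/fine_cvgP; split.
  near=> n; rewrite fin_num_measure//.
  by have : forall e, measurable [set w | e < `|Y n w - a|]; [near: n|exact].
apply/cvgr0Pnorm_lt => b b0; have b20 : 0 < b / 2 by rewrite divr_gt0.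
near=> n.
have mS : measurable [set w | e < `|Y n w - a|].
  by have : forall e, measurable [set w | e < `|Y n w - a|]; [near: n|exact].
have [C [mC SC PC]] : exists C, [/\ measurable C, [set w | e < `|Y n w - a|] `<=` C & (P n C <= (b / 2)%:E)%E].
  by near: n; exact: vY.
rewrite ger0_norm ?fine_ge0//; apply: (@le_lt_trans _ _ (b / 2)); last lra.
rewrite -lee_fin fineK ?fin_num_measure//; apply: le_trans PC.
by rewrite le_measure ?inE.
Unshelve. all: end_near. Qed.

End vanishing.

Section levels.
Context {R : realType} (d : nat -> measure_display) (T : forall n : nat, measurableType (d n))
  (P : forall n : nat, probability (T n) R)
  (X : forall n : nat, nat -> {RV (P n) >-> R})
  (d0 : measure_display) (T0 : measurableType d0) (P0 : probability T0 R)
  (U : int -> {RV P0 >-> R})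
  (F : cumulativeBounded (0 : R) (1 : R)) (c A : R -> R) (cmin cmax : R).
Hypotheses (hmodel : model X F c U) (hF2 : second_order X F c A).
Hypotheses (hc : forall s : R, 0 <= s <= 1 -> cmin < c s <= cmax) (cmin0 : 0 < cmin).
Hypothesis hold : hoelder_half c.

(** [F] may be flat, and any point with the given tail probability serves. *)
Definition level (v : R) : R := xget 0 [set u | 1 - F u = v].

Lemma levelE v : 0 < v -> v < 1 -> 1 - F (level v) = v.
Proof.
move=> v0 v1; rewrite /level; apply: (@xgetPex _ 0 [set u | 1 - F u = v]).
exact: (threshold_exists (model_F_continuous hmodel)).
Qed.

Lemma level_tail e : 0 < e -> exists2 v0, 0 < v0 <= 1 & forall v, 0 < v -> v < v0 ->
  forall n i, (1 <= i <= n)%N ->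
    `|(1 - cdfR (X n i) (level v)) - c (i%:R / n%:R) * v| <= e * v.
Proof.
move=> e0; have [v0 v00 hv] := uniform_tail (model_F_continuous hmodel) hF2 e0.
exists (Num.min v0 1); first by rewrite lt_min v00 ltr01 ge_min lexx orbT.
move=> v vp; rewrite lt_min => /andP[vv0 v1] n i ni.
have lv := levelE vp v1; have := hv (level v); rewrite lv => /(_ vp vv0 n i ni).
rewrite -(ler_pM2r vp); apply: le_trans; rewrite -[X in _ <= _ * X](gtr0_norm vp) -normrM.
by rewrite mulrBl divfK// gt_eqF.
Qed.

Lemma grid01 n (i : 'I_n) : 0 <= (i.+1%:R / n%:R : R) <= 1.
Proof.
have n0 : (0 : R) < n%:R by rewrite ltr0n; case: n i => // -[].
by rewrite divr_ge0//= ler_pdivrMr// mul1r ler_nat.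
Qed.

Lemma c_integrable : lebesgue_measure.-integrable `[0, 1] (EFin \o c).
Proof.
apply: continuous_compact_integrable; first exact: segment_compact.
exact: model_c_continuous hmodel.
Qed.

Lemma sqrt_inv_cvg0 (f : nat -> R) : f n @[n --> \oo] --> +oo ->
  Num.sqrt (f n)^-1 @[n --> \oo] --> (0 : R).
Proof.
move=> fy; rewrite -(@sqrtr0 R); apply: continuous_cvg; first exact: sqrt_continuous.
apply/gtr0_cvgV0 => //; near=> n; near: n; move/cvgryPgt : fy; exact.
Unshelve. all: end_near. Qed.

Lemma mean_c_cvg : n%:R^-1 * \sum_(i < n) c (i.+1%:R / n%:R) @[n --> \oo] --> (1 : R).
Proof.
have [Kc Kc0 hK] := hold; apply/cvgrPdist_le => e e0.
have s0 : Kc * Num.sqrt n%:R^-1 @[n --> \oo] --> (0 : R).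
  rewrite -[X in _ --> X](mulr0 Kc); apply: cvgMr; apply: sqrt_inv_cvg0; exact: cvgr_idn.
near=> n.
have n0 : (0 < n)%N by near: n; exact: nbhs_infty_gt.
rewrite distrC -[X in `|_ - X|](model_c_density hmodel).
apply: (@le_trans _ _ (Kc * Num.sqrt n%:R^-1)).
  exact: (hoelder_riemann_sum n0 (ltW Kc0) c_integrable hK).
apply: ltW; near: n; exact: (cvgr_lt _ s0).
Unshelve. all: end_near. Qed.

Section lln.
Variables (kap : nat -> R) (r l : nat -> nat) (y : R).
Hypotheses (kap0 : \forall n \near \oo, 0 < kap n)
  (kap_cvg : kap n @[n --> \oo] --> (0 : R))
  (hrl : \forall n \near \oo, (0 < r n)%N && (l n <= r n)%N)
  (hmix : (n %/ r n).+1%:R * beta_mixing U (l n) @[n --> \oo] --> (0 : R))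
  (y0 : 0 < y).

(** Uniformity over the weights is needed for kernel sums at a varying
location. *)
Lemma weighted_level_lln (S : Type) (D : nat -> S -> Prop)
    (wt : forall n, S -> 'I_n -> R) (W : nat -> R) (B : R) :
  (\forall n \near \oo, forall s, D n s ->
     (forall i, 0 <= wt n s i <= W n) /\ \sum_(i < n) wt n s i * kap n <= B) ->
  (r n)%:R * W n @[n --> \oo] --> (0 : R) ->
  forall eta e, 0 < eta -> 0 < e -> \forall n \near \oo, forall s, D n s ->
    (P n [set w | eta < `|\sum_(i < n) wt n s i * (exceed X (level (y * kap n)) i w)%:R
       - \sum_(i < n) wt n s i * (c (i.+1%:R / n%:R) * (y * kap n))|]%R <= e%:E)%E.
Proof.
move=> hwt hW eta e eta0 e0.
pose B' := `|B| + 1; have B'0 : 0 < B' by rewrite /B' ltr_wpDl.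
have BB' : B <= B' by rewrite /B'; have := ler_norm B; lra.
pose e1 := Num.min 1 (eta / (2 * y * B')).
have e10 : 0 < e1 by rewrite /e1 lt_min ltr01/= divr_gt0// !mulr_gt0.
have [v0 /andP[v00 v01] hv] := level_tail e10.
pose M := (cmax + 1) * y * B'.
have hlim : lln_const M (eta / 4) * ((n %/ r n).+1%:R * (2 * beta_mixing U (l n))
     + (r n)%:R * W n * M) @[n --> \oo] --> (0 : R).
  rewrite -[X in _ --> X](mulr0 (lln_const M (eta / 4))); apply: cvgMr.
  rewrite -[X in _ --> X](addr0 0); apply: cvgD.
    have h2 : 2 * ((n %/ r n).+1%:R * beta_mixing U (l n)) @[n --> \oo] --> (0 : R).
      by rewrite -[X in _ --> X](mulr0 2); apply: cvgMr.
    by under eq_fun do rewrite mulrCA.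
  by rewrite -[X in _ --> X](mul0r M); apply: cvgMl.
have yk_cvg : y * kap n @[n --> \oo] --> (0 : R).
  by rewrite -[X in _ --> X](mulr0 y); apply: cvgMr.
near=> n => s Dns.
have n0 : (0 < n)%N by near: n; exact: nbhs_infty_gt.
have kn0 : 0 < kap n by near: n.
have yk0 : 0 < y * kap n by rewrite mulr_gt0.
have ykv : y * kap n < v0 by near: n; exact: (cvgr_lt _ yk_cvg).
have [wtW wtB] : (forall i, 0 <= wt n s i <= W n) /\ \sum_(i < n) wt n s i * kap n <= B.
  have : forall s, D n s ->
     (forall i, 0 <= wt n s i <= W n) /\ \sum_(i < n) wt n s i * kap n <= B by near: n.
  exact.
have /andP[rn0 ln] : (0 < r n)%N && (l n <= r n)%N by near: n.
have wt0 i : 0 <= wt n s i by case/andP: (wtW i).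
have tail (i : 'I_n) : `|(1 - cdfR (X n i.+1) (level (y * kap n))) - c (i.+1%:R / n%:R) * (y * kap n)|
    <= e1 * (y * kap n) by apply: hv => //; exact: index_range.
have ES : \sum_(i < n) wt n s i * (1 - cdfR (X n i.+1) (level (y * kap n))) <= M.
  apply: (@le_trans _ _ (\sum_(i < n) (cmax + 1) * y * (wt n s i * kap n))); last first.
    rewrite -mulr_sumr /M ler_wpM2l//; last exact: le_trans wtB BB'.
    have /andP[c1 c2] := hc (grid01 (Ordinal n0)).
    have cm0 : 0 <= cmax + 1 by have := lt_trans cmin0 (lt_le_trans c1 c2); lra.
    by rewrite mulr_ge0// ltW.
  apply: ler_sum => i _.
  have -> : (cmax + 1) * y * (wt n s i * kap n) = wt n s i * ((cmax + 1) * (y * kap n)) by ring.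
  rewrite ler_wpM2l//; have := tail i; rewrite ler_norml => /andP[_ h].
  have /andP[_ cm] := hc (grid01 i).
  have e1le : e1 <= 1 by rewrite /e1 ge_min lexx.
  nra.
apply: (le_trans _ (_ : (lln_const M (eta / 4) * ((n %/ r n).+1%:R * (2 * beta_mixing U (l n))
     + (r n)%:R * W n * M))%:E <= e%:E)%E); last first.
  rewrite lee_fin; apply: ltW; near: n; exact: (cvgr_lt _ hlim).
have eta40 : 0 < eta / 4 by rewrite divr_gt0.
apply: le_trans (weighted_exceed_lln hmodel n0 rn0 ln wtW eta40 ES).
have mT (m t : R) : measurable [set w | t < `|\sum_(i < n) wt n s i * (exceed X (level (y * kap n)) i w)%:R - m|].
  exact: (@measurable_exceed_event _ _ _ _ X n _ (fun b => t < `|\sum_(i < n) wt n s i * b i - m|)).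
apply: le_measure; rewrite ?inE; [exact: mT|exact: mT|].
move=> w /= h.
have close : `|\sum_(i < n) wt n s i * (1 - cdfR (X n i.+1) (level (y * kap n)))
   - \sum_(i < n) wt n s i * (c (i.+1%:R / n%:R) * (y * kap n))| <= eta / 2.
  rewrite -sumrB; apply: (le_trans (ler_norm_sum _ _ _)).
  apply: (@le_trans _ _ (\sum_(i < n) e1 * y * (wt n s i * kap n))).
    apply: ler_sum => i _; rewrite -mulrBr normrM (ger0_norm (wt0 i)).
    have -> : e1 * y * (wt n s i * kap n) = wt n s i * (e1 * (y * kap n)) by ring.
    by rewrite ler_wpM2l.
  rewrite -mulr_sumr.
  have e1eta : e1 * (2 * y * B') <= eta.
    by rewrite -ler_pdivlMr ?mulr_gt0// /e1 ge_min lexx orbT.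
  have s0 : 0 <= \sum_(i < n) wt n s i * kap n.
    by apply: sumr_ge0 => i _; rewrite mulr_ge0// ltW.
  have ey0 : 0 < e1 * y by rewrite mulr_gt0.
  have : e1 * y * (\sum_(i < n) wt n s i * kap n) <= e1 * y * B'.
    by rewrite ler_wpM2l ?(ltW ey0)//; exact: le_trans wtB BB'.
  by lra.
move: h close; set a := \sum_(i < n) _; set b := \sum_(i < n) _; set m := \sum_(i < n) _.
move=> h close; have := ler_distD m a b; lra.
Unshelve. all: end_near. Qed.

(** Constant weights; the limit is [y] because [c] is a density. *)
Lemma count_lln : (r n)%:R / (n%:R * kap n) @[n --> \oo] --> (0 : R) ->
  forall eta, 0 < eta -> vanishing P (fun n => [set w | eta <
    `|(n%:R * kap n)^-1 * \sum_(i < n) (exceed X (level (y * kap n)) i w)%:R - y|]).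
Proof.
move=> hr eta eta0.
have mc : y * (n%:R^-1 * \sum_(i < n) c (i.+1%:R / n%:R)) @[n --> \oo] --> y.
  by rewrite -[X in _ --> X]mulr1; apply: cvgMr; exact: mean_c_cvg.
have e2 : 0 < eta / 2 by rewrite divr_gt0.
have := @weighted_level_lln unit (fun _ _ => True) (fun n _ _ => (n%:R * kap n)^-1)
  (fun n => (n%:R * kap n)^-1) 1 _ hr (eta / 2).
have hyp : \forall n \near \oo, forall s : unit, True ->
     ('I_n -> 0 <= (n%:R * kap n)^-1 <= (n%:R * kap n)^-1) /\
     \sum_(i < n) (n%:R * kap n)^-1 * kap n <= 1.
  near=> n => _ _.
  have n0 : (0 < n)%N by near: n; exact: nbhs_infty_gt.
  have kn0 : 0 < kap n by near: n.
  have nk0 : 0 < n%:R * kap n by rewrite mulr_gt0// ltr0n.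
  split; first by rewrite lexx invr_ge0 ltW.
  rewrite sumr_const card_ord -[_ *+ _]mulr_natl mulrA.
  rewrite (_ : n%:R * _ * kap n = 1)//.
  by rewrite mulrAC divff// gt_eqF.
move=> /(_ hyp) main e e0; have := main e e2 e0 => {}main.
near=> n.
have n0 : (0 < n)%N by near: n; exact: nbhs_infty_gt.
have kn0 : 0 < kap n by near: n.
exists [set w | eta / 2 < `|\sum_(i < n) (n%:R * kap n)^-1 * (exceed X (level (y * kap n)) i w)%:R
       - \sum_(i < n) (n%:R * kap n)^-1 * (c (i.+1%:R / n%:R) * (y * kap n))|]; split.
- exact: (@measurable_exceed_event _ _ _ _ X n _ (fun b => eta / 2 < `|\sum_(i < n) (n%:R * kap n)^-1 * b i
       - \sum_(i < n) (n%:R * kap n)^-1 * (c (i.+1%:R / n%:R) * (y * kap n))|)).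
- move=> w /=; rewrite -mulr_sumr.
  have -> : \sum_(i < n) (n%:R * kap n)^-1 * (c (i.+1%:R / n%:R) * (y * kap n))
    = y * (n%:R^-1 * \sum_(i < n) c (i.+1%:R / n%:R)).
    rewrite -mulr_sumr -mulr_suml invfM; field.
    by rewrite !gt_eqF// ltr0n.
  have : `|y - y * (n%:R^-1 * \sum_(i < n) c (i.+1%:R / n%:R))| < eta / 2.
    by near: n; move/cvgrPdist_lt : mc; apply.
  set m := y * (n%:R^-1 * _); set a := (n%:R * kap n)^-1 * _ => h1 h2.
  have := ler_distD m a y; rewrite (distrC m y); lra.
- have : forall s : unit, True -> (P n [set w | eta / 2 < `|\sum_(i < n) (n%:R * kap n)^-1 * (exceed X (level (y * kap n)) i w)%:R
       - \sum_(i < n) (n%:R * kap n)^-1 * (c (i.+1%:R / n%:R) * (y * kap n))|]%R <= e%:E)%E.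
    by near: n.
  by move=> /(_ tt I).
Unshelve. all: end_near. Qed.

End lln.
End levels.

(** * Order statistics and kernels *)

Section order_statistics.
Context {R : realType} (d : nat -> measure_display) (T : forall n : nat, measurableType (d n))
  (P : forall n : nat, probability (T n) R)
  (X : forall n : nat, nat -> {RV (P n) >-> R}).

Lemma count_sample n (w : T n) (a : pred R) :
  count a [seq X n i w | i <- index_iota 1 n.+1] = #|[pred i : 'I_n | a (X n i.+1 w)]|.
Proof.
by rewrite count_map -sum1_count -[RHS]sum1_card big_add1/= big_mkord.
Qed.

Lemma order_stat_lt n (j : nat) (w : T n) (x : R) : (0 < j <= n)%N ->
  (order_stat X j w < x) = (j <= #|[pred i : 'I_n | (X n i.+1 w < x)%R]|)%N.
Proof.
move=> /andP[j0 jn]; rewrite -(count_sample w (fun y => y < x)) /order_stat.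
set s := [seq _ | _ <- _]; have so : sorted <=%R (sort <=%R s) by exact: sort_le_sorted.
have sz : size (sort <=%R s) = n by rewrite size_sort size_map size_iota subn1.
have ct : count (fun y => y < x) s = count (< x) (sort <=%R s).
  by apply/esym/permP; rewrite perm_sort.
rewrite ct; apply/idP/idP => h.
  rewrite leqNgt; apply/negP => h'; move: h; rewrite ltNge => /negP; apply.
  apply: nth_count_ge => //; rewrite sz -ltnS prednK// h' /=.
  by rewrite (leq_trans _ jn)// prednK.
by apply: nth_count_lt => //; lia.
Qed.

Lemma measurable_lt_RV d' (T' : measurableType d') (P' : probability T' R)
  (Y Z : {RV P' >-> R}) : measurable [set w | Y w < Z w].
Proof.
have mB : measurable_fun setT (fun w => Z w - Y w) by exact: measurable_realfun.measurable_funB.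
have -> : [set w | Y w < Z w] = setT `&` (fun w => Z w - Y w) @^-1` `]0, +oo[.
  by rewrite setTI; apply/seteqP; split=> w /=; rewrite in_itv/= andbT subr_gt0.
exact: (mB measurableT _ (measurable_itv _)).
Qed.

(** The observations enter the estimators only through their mutual order. *)
Definition comparisons n (w : T n) : {ffun 'I_n * 'I_n -> bool} :=
  patt (fun (ij : 'I_n * 'I_n) w => X n ij.1.+1 w < X n ij.2.+1 w) w.

Lemma measurable_comparisons n (Q : {ffun 'I_n * 'I_n -> bool} -> Prop) :
  measurable [set w | Q (comparisons w)].
Proof. by apply: measurable_patt => i; exact: measurable_lt_RV. Qed.

Lemma measurable_through_comparisons n (Y : T n -> R) :
  (exists f : {ffun 'I_n * 'I_n -> bool} -> R, forall w, Y w = f (comparisons w)) ->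
  forall a e, measurable [set w | e < `|Y w - a|].
Proof.
move=> [f Yf] a e.
rewrite (_ : [set w | _] = [set w | (fun x => e < `|f x - a|) (comparisons w)]).
  exact: (measurable_comparisons (fun x => e < `|f x - a|)).
by congr mkset; apply/funext => w; rewrite Yf.
Qed.

Definition top (k : nat -> nat) n (i : 'I_n) (w : T n) : bool :=
  order_stat X (n - k n)%N w < X n i.+1 w.

Lemma topE (k : nat -> nat) n (i : 'I_n) (w : T n) : (k n < n)%N ->
  top k i w = (n - k n <= #|[pred j : 'I_n | (X n j.+1 w < X n i.+1 w)%R]|)%N.
Proof. by move=> kn; rewrite /top order_stat_lt//; lia. Qed.

Lemma top_comparisons (k : nat -> nat) n (i : 'I_n) (w : T n) : (k n < n)%N ->
  top k i w = (n - k n <= #|[pred j : 'I_n | comparisons w (j, i)]|)%N.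
Proof.
move=> kn; rewrite topE//; congr (_ <= _)%N; apply: eq_card => j.
by rewrite !inE ffunE.
Qed.

(** A deterministic level with more than [k] exceedances lies below the random
threshold, one with at most [k] exceedances above it. *)
Lemma top_le_exceed (k : nat -> nat) n (u : R) (w : T n) : (k n < n)%N ->
  (k n < #|[pred j : 'I_n | exceed X u j w]|)%N ->
  forall i : 'I_n, top k i w -> exceed X u i w.
Proof.
move=> kn ku i; rewrite topE// => h; rewrite /exceed ltNge; apply/negP => Xu.
have sub : [pred j : 'I_n | exceed X u j w] \subset [predC [pred j : 'I_n | (X n j.+1 w < X n i.+1 w)%R]].
  by apply/fintype.subsetP => j; rewrite !inE /exceed -leNgt => uj; apply: le_trans Xu (ltW uj).
have := cardC [pred j : 'I_n | (X n j.+1 w < X n i.+1 w)%R]; rewrite card_ord.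
move: (subset_leq_card sub) h ku.
have aux (a b b' m kk : nat) : (b <= b' -> m - kk <= a -> kk < b -> a + b' = m -> kk < m -> False)%N by lia.
by move=> h1 h2 h3 h4; exact: aux h1 h2 h3 h4 kn.
Qed.

Lemma exceed_le_top (k : nat -> nat) n (u : R) (w : T n) : (k n < n)%N ->
  (#|[pred j : 'I_n | exceed X u j w]| <= k n)%N ->
  forall i : 'I_n, exceed X u i w -> top k i w.
Proof.
move=> kn ku i ui; rewrite topE//.
have sub : [predC [pred j : 'I_n | (X n j.+1 w < X n i.+1 w)%R]] \subset [pred j : 'I_n | exceed X u j w].
  by apply/fintype.subsetP => j; rewrite !inE -leNgt /exceed => ij; apply: lt_le_trans ui ij.
have := cardC [pred j : 'I_n | (X n j.+1 w < X n i.+1 w)%R]; rewrite card_ord.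
move: (subset_leq_card sub) ku.
have aux (a b b' m kk : nat) : (b' <= b -> b <= kk -> a + b' = m -> m - kk <= a)%N by lia.
by move=> h1 h2 h3; exact: aux h1 h2 h3.
Qed.

Lemma card_exceedE n (u : R) (w : T n) :
  (#|[pred j : 'I_n | exceed X u j w]|)%:R = \sum_(i < n) (exceed X u i w)%:R :> R.
Proof.
rewrite -sum1_card natr_sum big_mkcond/=; apply: eq_bigr => i _.
by rewrite inE; case: exceed.
Qed.

End order_statistics.

Section kernel_facts.
Context {R : realType} (K : R -> R).
Hypotheses (hK : kernel_function K) (LK : [lipschitz K x | x in `[-1, 1]]).

Lemma kernel_lipschitz : exists2 Lam : R, 0 <= Lam &
  forall x y, `|x| <= 1 -> `|y| <= 1 -> `|K x - K y| <= Lam * `|x - y|.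
Proof.
have [M hM] : exists M : R, 0 <= M /\ forall z : R * R, (`[-1, 1] `*` `[-1, 1])%classic z ->
    `|K z.1 - K z.2| <= M * `|z.1 - z.2|.
  near (pinfty_nbhs R) => M; exists M; split.
    by near: M; apply: nbhs_pinfty_ge; exact: num_real.
  by near: M.
exists M; first by case: hM.
move=> x y x1 y1; apply: ((proj2 hM) (x, y)); split => /=; by rewrite in_itv/= -ler_norml.
Unshelve. all: end_near. Qed.

Lemma kernel_bounded : exists2 B : R, 0 <= B & forall x, `|K x| <= B.
Proof.
have [Lam L0 hL] := kernel_lipschitz.
exists (`|K 0| + Lam) => [|x]; first by rewrite addr_ge0.
case: (lerP `|x| 1) => x1; last by rewrite (kernel_support hK)// normr0 addr_ge0.
have := hL x 0 x1; rewrite normr0 ler01 subr0 => /(_ isT) h.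
have := ler_normD (K x - K 0) (K 0); rewrite subrK.
have : Lam * `|x| <= Lam by rewrite ler_piMr.
lra.
Qed.

Lemma kernel_measurable : measurable_fun [set: R] K.
Proof.
have -> : K = K \_ `[-1, 1].
  apply/funext => x; rewrite /patch; case: ifPn => //; rewrite notin_setE/= in_itv/= => xn.
  by rewrite (kernel_support hK)// ltNge ler_norml; apply/negP.
apply/(measurable_restrictT _ (measurable_itv _)).
apply: measurable_realfun.subspace_continuous_measurable_fun; first exact: measurable_itv.
exact: kernel_continuous hK.
Qed.

End kernel_facts.

(** * The kernel estimator at a deterministic threshold *)

Section kernel_estimator.
Context {R : realType} (d : nat -> measure_display) (T : forall n : nat, measurableType (d n))
  (P : forall n : nat, probability (T n) R)
  (X : forall n : nat, nat -> {RV (P n) >-> R})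
  (d0 : measure_display) (T0 : measurableType d0) (P0 : probability T0 R)
  (U : int -> {RV P0 >-> R})
  (F : cumulativeBounded (0 : R) (1 : R)) (c A : R -> R) (cmin cmax : R).
Hypotheses (hmodel : model X F c U) (hF2 : second_order X F c A).
Hypotheses (hc : forall s : R, 0 <= s <= 1 -> cmin < c s <= cmax) (cmin0 : 0 < cmin).
Hypothesis hold : hoelder_half c.
Variables (K : R -> R) (k l r : nat -> nat) (h : nat -> R).
Hypotheses (hK : kernel_function K) (LK : [lipschitz K x | x in `[-1, 1]]).
Hypotheses (k_range : \forall n \near \oo, (0 < k n)%N && (k n < n)%N)
  (k_cvg : (k n)%:R / n%:R @[n --> \oo] --> (0 : R))
  (hrl : \forall n \near \oo, (0 < r n)%N && (l n <= r n)%N)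
  (hmix : (n %/ r n).+1%:R * beta_mixing U (l n) @[n --> \oo] --> (0 : R))
  (h0 : forall n, 0 < h n) (h_cvg : h n @[n --> \oo] --> (0 : R))
  (nh_cvg : (n%:R * h n)^-1 @[n --> \oo] --> (0 : R))
  (hrkh : (r n)%:R / ((k n)%:R * h n) @[n --> \oo] --> (0 : R)).

Definition kernel_sum n (b : 'I_n -> R) (s : R) : R :=
  ((k n)%:R * h n)^-1 * \sum_(i < n) b i * K ((s - i.+1%:R / n%:R) / h n).

(** Seen from [s], the grid is a Riemann partition of mesh [1 / (n h)] which
covers the support of the kernel when [s] is at distance [h] from 0 and 1. *)
Lemma kernel_grid_sum (g : R -> R) (Lam B : R) n s : (0 < n)%N -> (n%:R * h n)^-1 <= 1 ->
  0 <= Lam -> measurable_fun [set: R] g -> (forall x, g (- x) = g x) ->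
  (forall x, `|g x| <= B) -> (forall x, 1 < `|x| -> g x = 0) ->
  (forall x y, `|x| <= 1 -> `|y| <= 1 -> `|g x - g y| <= Lam * `|x - y|) ->
  h n < s -> s < 1 - h n ->
  `|(n%:R * h n)^-1 * (\sum_(i < n) g ((s - i.+1%:R / n%:R) / h n))
     - \int[lebesgue_measure]_(x in `[-1, 1]) g x| <= 2 * (Lam + B) * (n%:R * h n)^-1.
Proof.
move=> n0 nh1 L0 mg gs gB g0 gL hs s1.
have nR : (0 : R) < n%:R by rewrite ltr0n.
have hn := h0 n.
have -> : \sum_(i < n) g ((s - i.+1%:R / n%:R) / h n)
   = \sum_(i < n) g (- (s / h n) + i.+1%:R * (n%:R * h n)^-1).
  apply: eq_bigr => i _; rewrite -gs; congr g; field.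
  by rewrite !gt_eqF.
apply: kernel_riemann_sum => //.
- by rewrite invr_gt0 mulr_gt0.
- by rewrite lerN2 ler_pdivlMr// mul1r ltW.
- rewrite invfM mulrA divff ?gt_eqF// mul1r.
  by rewrite -mulNr -[X in _ + X]mul1r -mulrDl ler_pdivlMr// mul1r; lra.
Qed.

Let kap n : R := (k n)%:R / n%:R.
Let u1 n := level F (1 * kap n).

(** The law of large numbers requires nonnegative weights, hence the splitting of
the kernel into its positive and negative parts. The bias consists of the
oscillation of [c] over a window of width [h] and of the error of a Riemann
sum. *)
Lemma kernel_level_lln eta e : 0 < eta -> 0 < e -> \forall n \near \oo, forall s,
  h n < s < 1 - h n ->
  (P n [set w | eta < `|kernel_sum (fun i => (exceed X (u1 n) i w)%:R) s - c s|]%R <= e%:E)%E.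
Proof.
move=> eta0 e0.
have [Lam L0 hL] := kernel_lipschitz LK.
have [B B0 hB] := kernel_bounded hK LK.
have [Kc Kc0 hKc] := hold.
have mK := kernel_measurable hK.
pose Kp x := Num.max (K x) 0; pose Kn x := Num.max (- K x) 0.
have KpB x : 0 <= Kp x <= B.
  rewrite /Kp le_max lexx orbT/= ge_max B0 andbT.
  by apply: le_trans (hB x); exact: ler_norm.
have KnB x : 0 <= Kn x <= B.
  rewrite /Kn le_max lexx orbT/= ge_max B0 andbT.
  by apply: le_trans (hB x); rewrite -normrN; exact: ler_norm.
have KE x : K x = Kp x - Kn x by rewrite /Kp /Kn; case: (lerP (K x) 0); case: (lerP (- K x) 0); lra.
have Kabs x : Kp x <= `|K x| /\ Kn x <= `|K x|.
  by rewrite /Kp /Kn !ge_max normr_ge0 ler_norm -normrN ler_norm.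
pose Cst : R := 2 * B + 2 * (Lam + B).
have C0 : 0 <= Cst by rewrite /Cst; lra.
have absgrid n s : (0 < n)%N -> (n%:R * h n)^-1 <= 1 -> h n < s -> s < 1 - h n ->
    (n%:R * h n)^-1 * (\sum_(i < n) `|K ((s - i.+1%:R / n%:R) / h n)|) <= Cst.
  move=> n0 nh1 hs s1.
  have aL x y : `|x| <= 1 -> `|y| <= 1 -> `| `|K x| - `|K y| | <= Lam * `|x - y|.
    by move=> x1 y1; apply: le_trans (hL x y x1 y1); exact: ler_dist_dist.
  have := @kernel_grid_sum (fun x => `|K x|) Lam B n s n0 nh1 L0.
  have ma : measurable_fun [set: R] (fun x => `|K x|) by exact: measurableT_comp.
  have as_ x : `|K (- x)| = `|K x| by rewrite (kernel_symmetric hK).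
  have aB x : `| `|K x| | <= B by rewrite normr_id.
  have a0 x : 1 < `|x| -> `|K x| = 0 by move=> /(kernel_support hK) ->; rewrite normr0.
  move=> /(_ ma as_ aB a0 aL hs s1).
  have : \int[lebesgue_measure]_(x in `[-1, 1]) `|K x| <= 2 * B.
    rewrite (_ : 2 * B = B * (1 - -1)); last by ring.
    rewrite -Rintegral_cst_itv; last lra.
    apply: le_Rintegral => //.
    - apply: (@bounded_integrable _ _ _ B) => //.
        by rewrite lebesgue_measure_itv/=; case: ifP; rewrite ?ltry// -EFinB ltry.
      exact: measurable_funTS.
    - exact: integrable_cst_itv.
  move=> I2 /(le_trans (ler_norm _)).
  have : 2 * (Lam + B) * (n%:R * h n)^-1 <= 2 * (Lam + B) by rewrite ler_piMr//; lra.
  rewrite /Cst; lra.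
pose dev (g : R -> R) n s : set (T n) := [set w |
    eta / 3 < `|\sum_(i < n) ((k n)%:R * h n)^-1 * g ((s - i.+1%:R / n%:R) / h n)
        * (exceed X (u1 n) i w)%:R
       - \sum_(i < n) ((k n)%:R * h n)^-1 * g ((s - i.+1%:R / n%:R) / h n)
          * (c (i.+1%:R / n%:R) * (1 * kap n))|].
have wlln (g : R -> R) : (forall x, 0 <= g x <= B) -> (forall x, g x <= `|K x|) ->
  \forall n \near \oo, forall s, h n < s < 1 - h n ->
    (P n (dev g n s) <= (e / 2)%:E)%E.
  move=> gB gK.
  have kap0 : \forall n \near \oo, 0 < kap n.
    near=> n; have /andP[k0 kn] : (0 < k n)%N && (k n < n)%N by near: n.
    by rewrite divr_gt0// ltr0n//; exact: leq_trans kn.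
  rewrite /dev; apply: (@weighted_level_lln _ _ _ _ _ _ _ _ _ _ _ _ _ _ hmodel hF2 hc cmin0 _ _ _ _ kap0
     k_cvg hrl hmix ltr01 R (fun n s => h n < s < 1 - h n)
     (fun n s i => ((k n)%:R * h n)^-1 * g ((s - i.+1%:R / n%:R) / h n))
     (fun n => ((k n)%:R * h n)^-1 * B) Cst); last 2 first.
  - by rewrite divr_gt0.
  - by rewrite divr_gt0.
  - near=> n => s /andP[hs s1].
    have /andP[k0 kn] : (0 < k n)%N && (k n < n)%N by near: n.
    have n0 : (0 < n)%N by exact: leq_trans kn.
    have kh0 : 0 < (k n)%:R * h n by rewrite mulr_gt0// ltr0n.
    have nh1 : (n%:R * h n)^-1 <= 1 by apply: ltW; near: n; exact: (cvgr_lt _ nh_cvg).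
    split=> [i|].
      case/andP: (gB ((s - i.+1%:R / n%:R) / h n)) => g0 gb.
      by rewrite mulr_ge0 ?invr_ge0 ?(ltW kh0)//= ler_wpM2l// invr_ge0 ltW.
    apply: le_trans (absgrid n s n0 nh1 hs s1); rewrite mulr_sumr; apply: ler_sum => i _.
    have -> : ((k n)%:R * h n)^-1 * g ((s - i.+1%:R / n%:R) / h n) * kap n
      = (n%:R * h n)^-1 * g ((s - i.+1%:R / n%:R) / h n).
      by rewrite /kap; field; rewrite !gt_eqF// ltr0n.
    by rewrite ler_wpM2l// invr_ge0 mulr_ge0// ltW.
  - have hB' : (r n)%:R / ((k n)%:R * h n) * B @[n --> \oo] --> (0 : R).
      by rewrite -[X in _ --> X](mul0r B); apply: cvgMl.
    by under eq_fun do rewrite mulrA.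
have wp := wlln Kp KpB (fun x => (Kabs x).1).
have wn := wlln Kn KnB (fun x => (Kabs x).2).
have bias : Kc * Num.sqrt (h n) * Cst + cmax * (2 * (Lam + B) * (n%:R * h n)^-1)
    @[n --> \oo] --> (0 : R).
  rewrite -[X in _ --> X](addr0 0); apply: cvgD.
    rewrite -[X in _ --> X](mul0r Cst); apply: cvgMl.
    rewrite -[X in _ --> X](mulr0 Kc); apply: cvgMr.
    by rewrite -(@sqrtr0 R); apply: continuous_cvg => //; exact: sqrt_continuous.
  rewrite -[X in _ --> X](mulr0 cmax); apply: cvgMr.
  by rewrite -[X in _ --> X](mulr0 (2 * (Lam + B))); apply: cvgMr.
near=> n => s hs1; have /andP[hs s1] := hs1.
have /andP[k0 kn] : (0 < k n)%N && (k n < n)%N by near: n.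
have n0 : (0 < n)%N by exact: leq_trans kn.
have nR : (0 : R) < n%:R by rewrite ltr0n.
have kR : (0 : R) < (k n)%:R by rewrite ltr0n.
have hn := h0 n.
have nh1 : (n%:R * h n)^-1 <= 1 by apply: ltW; near: n; exact: (cvgr_lt _ nh_cvg).
have Pp : forall s, h n < s < 1 - h n ->
    (P n (dev Kp n s) <= (e / 2)%:E)%E by near: n.
have Pn : forall s, h n < s < 1 - h n ->
    (P n (dev Kn n s) <= (e / 2)%:E)%E by near: n.
have {}Pp := Pp s hs1; have {}Pn := Pn s hs1.
have biasn : Kc * Num.sqrt (h n) * Cst + cmax * (2 * (Lam + B) * (n%:R * h n)^-1) < eta / 3.
  by near: n; apply: (cvgr_lt _ bias); rewrite divr_gt0.
have mdev g : measurable (dev g n s).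
  exact: (@measurable_exceed_event _ _ _ _ X n (u1 n) (fun b => eta / 3 < `|\sum_(i < n)
    ((k n)%:R * h n)^-1 * g ((s - i.+1%:R / n%:R) / h n) * b i
       - \sum_(i < n) ((k n)%:R * h n)^-1 * g ((s - i.+1%:R / n%:R) / h n)
          * (c (i.+1%:R / n%:R) * (1 * kap n))|)).
have mS : measurable [set w : T n | eta < `|kernel_sum (fun i => (exceed X (u1 n) i w)%:R) s - c s|].
  exact: (@measurable_exceed_event _ _ _ _ X n (u1 n) (fun b => eta < `|kernel_sum b s - c s|)).
apply: (@le_trans _ _ (P n (dev Kp n s `|` dev Kn n s))); last first.
  apply: le_trans (measureU2 _ (mdev Kp) (mdev Kn)) _.
  by rewrite [e in leRHS]splitr EFinD; exact: leeD.
apply: le_measure; rewrite ?inE//; first by apply: measurableU; exact: mdev.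
move=> w /= bad; apply: contrapT => /not_orP[/negP + /negP].
rewrite /dev /= -!leNgt.
set Sump := \sum_(i < n) _; set mp := \sum_(i < n) _ => dp.
set Sumn := \sum_(i < n) _; set mn := \sum_(i < n) _ => dn.
have sumE : kernel_sum (fun i => (exceed X (u1 n) i w)%:R) s = Sump - Sumn.
  rewrite /kernel_sum /Sump /Sumn -sumrB mulr_sumr; apply: eq_bigr => i _.
  by rewrite KE; ring.
pose t (i : 'I_n) : R := i.+1%:R / n%:R.
pose Ki (i : 'I_n) := K ((s - t i) / h n).
have mE : mp - mn = (n%:R * h n)^-1 * (\sum_(i < n) Ki i * c (t i)).
  rewrite /mp /mn -sumrB mulr_sumr; apply: eq_bigr => i _.
  rewrite /Ki KE /kap /t; field.
  by rewrite !gt_eqF.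
have s01 : 0 <= s <= 1 by lra.
have g1 := kernel_grid_sum n0 nh1 L0 mK (kernel_symmetric hK) hB (kernel_support hK) hL hs s1.
rewrite (kernel_integral hK) in g1.
have g2 := absgrid n s n0 nh1 hs s1.
have /andP[cs0 cs1] := hc s01.
have biasE : `|(mp - mn) - c s| <= eta / 3.
  apply: le_trans (ltW biasn).
  have -> : mp - mn - c s = (n%:R * h n)^-1 * (\sum_(i < n) Ki i * (c (t i) - c s))
     + c s * ((n%:R * h n)^-1 * (\sum_(i < n) Ki i) - 1).
    rewrite mE.
    have -> : \sum_(i < n) Ki i * (c (t i) - c s) = \sum_(i < n) Ki i * c (t i) - c s * \sum_(i < n) Ki i.
      by rewrite mulr_sumr -sumrB; apply: eq_bigr => i _; ring.
    by ring.
  apply: (le_trans (ler_normD _ _)); rewrite lerD//; last first.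
    rewrite normrM gtr0_norm; last exact: lt_trans cs0.
    by apply: ler_pM => //; exact: ltW (lt_trans cmin0 cs0).
  have nhi0 : 0 <= (n%:R * h n)^-1 by rewrite invr_ge0 mulr_ge0// ltW.
  rewrite normrM (ger0_norm nhi0).
  apply: (@le_trans _ _ ((n%:R * h n)^-1 * (\sum_(i < n) (Kc * Num.sqrt (h n)) * `|Ki i|))).
    rewrite ler_wpM2l//; apply: (le_trans (ler_norm_sum _ _ _)); apply: ler_sum => i _.
    rewrite normrM mulrC; case: (lerP `|(s - t i) / h n| 1) => x1; last first.
      by rewrite /Ki (kernel_support hK)// normr0 !mulr0.
    rewrite ler_wpM2r//; apply: le_trans (hKc _ _ (grid01 i) s01) _.
    rewrite ler_wpM2l ?(ltW Kc0)// ler_wsqrtr// distrC.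
    by move: x1; rewrite normrM normfV (gtr0_norm hn) ler_pdivrMr// mul1r.
  rewrite -mulr_sumr mulrCA ler_wpM2l// mulr_ge0 ?sqrtr_ge0// ltW//.
move: bad; rewrite sumE.
have e3 : Sump - Sumn - c s = (Sump - mp) - (Sumn - mn) + (mp - mn - c s) by ring.
rewrite e3; have := ler_normD ((Sump - mp) - (Sumn - mn)) (mp - mn - c s).
have := ler_normB (Sump - mp) (Sumn - mn); lra.
Unshelve. all: end_near. Qed.

Variable kappa : R.
Hypotheses (kappa0 : 0 < kappa) (kappac : kappa < cmin).
Local Notation mu := (@lebesgue_measure R).

Let inv_max (a : R) : R := (Num.max a kappa)^-1.

Lemma inv_max_range a : 0 <= inv_max a <= kappa^-1.
Proof.
have m0 : 0 < Num.max a kappa by rewrite lt_max kappa0 orbT.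
by rewrite /inv_max invr_ge0 (ltW m0)/= lef_pV2 ?posrE// le_max lexx orbT.
Qed.

Lemma inv_max_lipschitz a b : `|inv_max a - inv_max b| <= kappa ^- 2 * `|a - b|.
Proof.
rewrite /inv_max; set x := Num.max a kappa; set y := Num.max b kappa.
have xk : kappa <= x by rewrite le_max lexx orbT.
have yk : kappa <= y by rewrite le_max lexx orbT.
have x0 : 0 < x by exact: lt_le_trans xk.
have y0 : 0 < y by exact: lt_le_trans yk.
have xy : `|x - y| <= `|a - b|.
  rewrite /x /y; case: (lerP a kappa) => ak; case: (lerP b kappa) => bk.
  - by rewrite subrr normr0.
  - by rewrite distrC (distrC a) !gtr0_norm ?subr_gt0//; lra.
  - by rewrite !gtr0_norm ?subr_gt0//; lra.
  - by [].
have -> : x^-1 - y^-1 = (y - x) / (x * y) by field; rewrite !gt_eqF.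
rewrite normrM normfV (gtr0_norm (mulr_gt0 x0 y0)) distrC mulrC.
apply: ler_pM => //; first by rewrite invr_ge0 mulr_ge0// ltW.
rewrite lef_pV2 ?posrE ?mulr_gt0 ?exprn_gt0// expr2.
by apply: ler_pM => //; exact: ltW.
Qed.

Lemma inv_max_c s : 0 <= s <= 1 -> inv_max (c s) = (c s)^-1.
Proof.
by move=> /hc /andP[cs _]; rewrite /inv_max max_l//; apply: ltW; exact: lt_trans cs.
Qed.

Lemma measurable_kernel_sum n (b : 'I_n -> R) (D : set R) :
  measurable_fun D (kernel_sum b).
Proof.
apply: measurable_funTS; rewrite /kernel_sum.
apply: measurable_realfun.measurable_funM; first exact: measurable_cst.
apply: measurable_sum => i.
apply: measurable_realfun.measurable_funM; first exact: measurable_cst.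
have mi : measurable_fun [set: R] (fun s : R => (s - i.+1%:R / n%:R) / h n).
  apply: measurable_realfun.measurable_funM; last exact: measurable_cst.
  by apply: measurable_realfun.measurable_funB; [exact: measurable_id|exact: measurable_cst].
exact: (measurableT_comp (kernel_measurable hK) mi).
Qed.

Lemma measurable_inv_max (D : set R) (f : R -> R) : measurable_fun D f ->
  measurable_fun D (fun s => inv_max (f s)).
Proof.
move=> mf; rewrite /inv_max.
have mm : measurable_fun D (fun s => Num.max (f s) kappa).
  by apply: measurable_realfun.measurable_maxr => //; exact: measurable_cst.
exact: (measurableT_comp measurable_inv mm).
Qed.

Lemma measurable_c (D : set R) : measurable D -> D `<=` `[0, 1] -> measurable_fun D c.
Proof.
move=> mD D01; apply: (measurable_funS _ D01) => //.
apply: measurable_realfun.subspace_continuous_measurable_fun; first exact: measurable_itv.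
exact: model_c_continuous hmodel.
Qed.

(** Integrated error away from the boundary when the threshold is exceeded by
the observations marked in [b]. *)
Definition pattern_error n (b : 'I_n -> R) : R :=
  \int[mu]_(s in `]h n, (1 - h n)[) `|inv_max (kernel_sum b s) - inv_max (c s)|.

Lemma interior_finite n : (mu [set` `]h n, (1 - h n)[%R] < +oo)%E.
Proof. by rewrite lebesgue_measure_itv/=; case: ifP; rewrite ?ltry// -EFinB ltry. Qed.

Lemma interior_sub n : `]h n, (1 - h n)[%classic `<=` `[0, 1]%classic.
Proof. by move=> x /=; rewrite !in_itv/=; have := h0 n; lra. Qed.

Lemma inv_max_kernel_integrable n (b : 'I_n -> R) :
  mu.-integrable `]h n, (1 - h n)[ (EFin \o (fun s => inv_max (kernel_sum b s))).
Proof.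
apply: (@bounded_integrable _ _ _ kappa^-1) => //; first exact: interior_finite.
  by apply: measurable_inv_max; exact: measurable_kernel_sum.
by move=> x _; have /andP[? ?] := inv_max_range (kernel_sum b x); rewrite ger0_norm.
Qed.

Lemma inv_max_c_integrable n :
  mu.-integrable `]h n, (1 - h n)[ (EFin \o (fun s => inv_max (c s))).
Proof.
apply: (@bounded_integrable _ _ _ kappa^-1) => //; first exact: interior_finite.
  by apply: measurable_inv_max; apply: measurable_c => //; exact: interior_sub.
by move=> x _; have /andP[? ?] := inv_max_range (c x); rewrite ger0_norm.
Qed.

Lemma Rintegral_sum (D : set R) (I : Type) (q : seq I) (f : I -> R -> R) : measurable D ->
  (forall i, mu.-integrable D (EFin \o f i)) ->
  \int[mu]_(x in D) (\sum_(i <- q) f i x) = \sum_(i <- q) \int[mu]_(x in D) f i x /\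
  mu.-integrable D (EFin \o (fun x => \sum_(i <- q) f i x)).
Proof.
move=> mD fi; elim: q => [|i q [ih1 ih2]].
  split.
    by under eq_Rintegral do rewrite big_nil; rewrite big_nil Rintegral_cst// mul0r.
  rewrite (_ : EFin \o _ = cst 0%E); first exact: integrable0.
  by apply/funext => x /=; rewrite big_nil.
have E : (fun x => \sum_(j <- i :: q) f j x) = (fun x => f i x + \sum_(j <- q) f j x).
  by apply/funext => x; rewrite big_cons.
rewrite E big_cons; split; last exact: (integrable_addR mD (fi i) ih2).
by rewrite RintegralD// ih1.
Qed.

Lemma pattern_error_integrable n (b : 'I_n -> R) :
  mu.-integrable `]h n, (1 - h n)[
    (EFin \o (fun s => `|inv_max (kernel_sum b s) - inv_max (c s)|)).
Proof.
have mI : measurable (`]h n, (1 - h n)[%classic : set R) by exact: measurable_itv.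
apply: (integrable_normR mI); apply: (integrable_subR mI).
  exact: inv_max_kernel_integrable.
exact: inv_max_c_integrable.
Qed.

Lemma Rintegral_interior_cst n (a : R) : 0 <= a ->
  \int[mu]_(_ in `]h n, (1 - h n)[) a <= a.
Proof.
move=> a0.
have E : fine (mu [set` `]h n, (1 - h n)[%R]) <= 1.
  rewrite lebesgue_measure_itv/= lte_fin; case: ltP => _ //=; have := h0 n; lra.
rewrite Rintegral_cst//; apply: (@le_trans _ _ (a * 1)); last by rewrite mulr1.
by rewrite ler_wpM2l.
Qed.

(** For a law on finitely many patterns the mean can be taken under the integral,
where it is controlled by the probability of a deviation at one location. *)
Lemma pattern_error_mean n (p : {ffun 'I_n -> bool} -> R) (eta e : R) :
  prob_weights p -> 0 <= eta -> 0 <= e ->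
  (forall s, h n < s < 1 - h n ->
    pE p (fun x => (eta < `|kernel_sum (fun i => (x i)%:R) s - c s|)%R%:R) <= e) ->
  pE p (fun x => pattern_error (fun i => (x i)%:R)) <= kappa ^- 2 * eta + kappa^-1 * e.
Proof.
move=> hp eta0 e0 hs; have [p0 _] := hp.
have mI : measurable (`]h n, (1 - h n)[%classic : set R) by exact: measurable_itv.
have kk : 0 <= kappa ^- 2 by rewrite invr_ge0 exprn_ge0// ltW.
have k1 : 0 <= kappa^-1 by rewrite invr_ge0 ltW.
have int1 (x : {ffun 'I_n -> bool}) := pattern_error_integrable (fun i => (x i)%:R : R).
have intZ (x : {ffun 'I_n -> bool}) : mu.-integrable `]h n, (1 - h n)[ (EFin \o
    (fun s => p x * `|inv_max (kernel_sum (fun i => (x i)%:R) s) - inv_max (c s)|)).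
  have mf : measurable_fun `]h n, (1 - h n)[%classic
      (fun s => inv_max (kernel_sum (fun i => (x i)%:R : R) s) - inv_max (c s)).
    apply: measurable_realfun.measurable_funB.
      by apply: measurable_inv_max; exact: measurable_kernel_sum.
    by apply: measurable_inv_max; apply: measurable_c => //; exact: interior_sub.
  apply: (@bounded_integrable _ _ _ (p x * kappa^-1)) => //; first exact: interior_finite.
    apply: measurable_realfun.measurable_funM; first exact: measurable_cst.
    exact: measurableT_comp.
  move=> s _; rewrite normrM normr_id (ger0_norm (p0 x)) ler_wpM2l//.
  have /andP[? ?] := inv_max_range (kernel_sum (fun i => (x i)%:R : R) s).
  have /andP[? ?] := inv_max_range (c s).
  by rewrite ler_norml; lra.
have -> : pE p (fun x => pattern_error (fun i => (x i)%:R)) =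
    \int[mu]_(s in `]h n, (1 - h n)[)
      (\sum_x p x * `|inv_max (kernel_sum (fun i => (x i)%:R) s) - inv_max (c s)|).
  rewrite (Rintegral_sum (index_enum {ffun 'I_n -> bool}) mI intZ).1.
  by apply: eq_bigr => x _; rewrite RintegralZl.
apply: (@le_trans _ _ (\int[mu]_(s in `]h n, (1 - h n)[) (kappa ^- 2 * eta + kappa^-1 * e))).
  apply: le_Rintegral => //.
  - exact: (Rintegral_sum (index_enum {ffun 'I_n -> bool}) mI intZ).2.
  - apply: (@bounded_integrable _ _ _ `|kappa ^- 2 * eta + kappa^-1 * e|) => //.
    exact: interior_finite.
  move=> s /=; rewrite in_itv/= => hs1.
  have s01 : 0 <= s <= 1 by have := h0 n; lra.
  apply: (@le_trans _ _ (pE p (fun x => kappa ^- 2 * eta + kappa^-1 *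
      (eta < `|kernel_sum (fun i => (x i)%:R) s - c s|)%R%:R))).
    apply: ler_sum => x _; rewrite ler_wpM2l//.
    case: ltrP => hx /=.
      rewrite mulr1; apply: (@le_trans _ _ kappa^-1); last by rewrite ler_wpDl// mulr_ge0.
      have /andP[? ?] := inv_max_range (kernel_sum (fun i => (x i)%:R : R) s).
      have /andP[? ?] := inv_max_range (c s).
      by rewrite ler_norml; lra.
    rewrite mulr0 addr0; apply: le_trans (inv_max_lipschitz _ _) _.
    by rewrite ler_wpM2l.
  rewrite pED (pE_cst hp) pEZ lerD2l ler_wpM2l//; exact: hs.
by apply: Rintegral_interior_cst; rewrite addr_ge0// mulr_ge0.
Qed.

(** An observation counted in only one of the two sums changes the estimator by at
most [B / (k h)] on a window of length [2 h], so that the bandwidth cancels. *)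
Lemma kernel_sum_dist n (b b' xm xp : 'I_n -> bool) (B : R) : (0 < k n)%N ->
  (forall x, `|K x| <= B) ->
  (forall i, xm i -> b i /\ b' i) -> (forall i, b i || b' i -> xp i) ->
  \int[mu]_(s in `]h n, (1 - h n)[)
     `|inv_max (kernel_sum (fun i => (b i)%:R) s) - inv_max (kernel_sum (fun i => (b' i)%:R) s)|
  <= kappa ^- 2 * (2 * B * (\sum_(i < n) ((xp i)%:R - (xm i)%:R)) / (k n)%:R).
Proof.
move=> k0 hB hm hp.
have hn := h0 n; have kR : (0 : R) < (k n)%:R by rewrite ltr0n.
have B0 : 0 <= B by apply: le_trans (hB 0).
have kk : 0 <= kappa ^- 2 by rewrite invr_ge0 exprn_ge0// ltW.
have mI : measurable (`]h n, (1 - h n)[%classic : set R) by exact: measurable_itv.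
pose t (i : 'I_n) : R := i.+1%:R / n%:R.
pose a := kappa ^- 2 * ((k n)%:R * h n)^-1.
have a0 : 0 <= a by rewrite mulr_ge0// invr_ge0 mulr_ge0// ltW.
have dx0 i : 0 <= (xp i)%:R - (xm i)%:R :> R.
  have : xm i -> xp i by move=> /hm[bi _]; apply: hp; rewrite bi.
  by case: (xm i) (xp i) => -[] //=; rewrite ?subrr ?subr0 ?ler01// => /(_ isT).
pose f (i : 'I_n) : R -> R := (cst (a * ((xp i)%:R - (xm i)%:R) * B)) \_ `[t i - h n, t i + h n].
have fi i : mu.-integrable `]h n, (1 - h n)[ (EFin \o f i).
  apply: (@bounded_integrable _ _ _ `|a * ((xp i)%:R - (xm i)%:R) * B|) => //.
  - exact: interior_finite.
  - apply: measurable_funTS.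
    by apply/(measurable_restrictT _ (measurable_itv _)); exact: measurable_cst.
  - by move=> x _; rewrite /f /patch; case: ifP; rewrite ?normr0.
have [Isum Iint] := Rintegral_sum (index_enum 'I_n) mI fi.
apply: (@le_trans _ _ (\int[mu]_(s in `]h n, (1 - h n)[) (\sum_(i < n) f i s))).
  apply: le_Rintegral => //.
    apply: (integrable_normR mI); apply: (integrable_subR mI); exact: inv_max_kernel_integrable.
  move=> s /= sI; apply: le_trans (inv_max_lipschitz _ _) _.
  rewrite /kernel_sum -mulrBr normrM (ger0_norm (_ : 0 <= ((k n)%:R * h n)^-1)); last first.
    by rewrite invr_ge0 mulr_ge0// ltW.
  rewrite mulrA -/a -sumrB; apply: (@le_trans _ _ (a * \sum_(i < n)
     `|(b i)%:R * K ((s - t i) / h n) - (b' i)%:R * K ((s - t i) / h n)|)).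
    by rewrite ler_wpM2l// ler_norm_sum.
  rewrite mulr_sumr; apply: ler_sum => i _.
  rewrite -mulrBl normrM /f /patch.
  have bb : `|(b i)%:R - (b' i)%:R| <= (xp i)%:R - (xm i)%:R :> R.
    case bi: (b i); case bi': (b' i); rewrite ?subrr ?normr0//.
      have -> : xp i by apply: hp; rewrite bi.
      have -> : xm i = false by apply/negP => /hm[_]; rewrite bi'.
      by rewrite !subr0 normr1.
    have -> : xp i by apply: hp; rewrite bi' orbT.
    have -> : xm i = false by apply/negP => /hm[]; rewrite bi.
    by rewrite sub0r subr0 normrN normr1.
  case: ifPn => si.
    by rewrite -mulrA ler_wpM2l//; apply: ler_pM.
  rewrite (kernel_support hK) ?normr0 ?mulr0//.
  move: si; rewrite notin_setE/= in_itv/= normrM normfV (gtr0_norm hn) => /negP.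
  rewrite ltr_pdivlMr// mul1r negb_and -!ltNge lter_normr; lra.
have fle i : \int[mu]_(s in `]h n, (1 - h n)[) f i s <= a * ((xp i)%:R - (xm i)%:R) * B * (2 * h n).
  have cst0 : 0 <= a * ((xp i)%:R - (xm i)%:R) * B by rewrite mulr_ge0// mulr_ge0// dx0.
  have -> : 2 * h n = (t i + h n) - (t i - h n) by ring.
  rewrite -Rintegral_cst_itv; last lra.
  rewrite /Rintegral fine_le//.
  - by apply: integrable_fin_num => //; exact: fi.
  - by apply: integrable_fin_num => //; exact: integrable_cst_itv.
  apply: ge0_le_integral_restrict => [x _|x _|x]; rewrite ?lee_fin//.
    by rewrite /f /patch; case: ifP.
  rewrite /f /patch/=; case: ifP => _; case: ifP => _ //=; by rewrite lee_fin.
rewrite Isum; apply: le_trans (ler_sum _ (fun i _ => fle i)) _.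
rewrite le_eqVlt; apply/orP; left; apply/eqP.
transitivity (\sum_(i < n) kappa ^- 2 * (2 * B * ((xp i)%:R - (xm i)%:R) / (k n)%:R)).
  apply: eq_bigr => i _; rewrite /a; field.
  by rewrite !gt_eqF.
by rewrite -mulr_sumr -mulr_suml -mulr_sumr.
Qed.

(** The selections by the random threshold and by a deterministic one both lie
between [xm] and [xp], and therefore differ in few observations. *)
Lemma tauhat_close n (w : T n) (b xm xp : 'I_n -> bool) (B : R) :
  (0 < k n)%N -> h n < 2^-1 -> (forall x, `|K x| <= B) ->
  (forall i, xm i -> b i /\ top X k i w) -> (forall i, b i || top X k i w -> xp i) ->
  `|tauhat X K k h kappa w - tau c| <=
    kappa ^- 2 * (2 * B * (\sum_(i < n) ((xp i)%:R - (xm i)%:R)) / (k n)%:R)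
    + pattern_error (fun i => (b i)%:R) + kappa^-1 * (2 * h n).
Proof.
move=> k0 h2 hB hm hp.
have k1 : 0 <= kappa^-1 by rewrite invr_ge0 ltW.
have hn := h0 n.
have mI : measurable (`]h n, (1 - h n)[%classic : set R) by exact: measurable_itv.
pose tb (i : 'I_n) : R := (top X k i w)%:R.
have chatE s : h n < s < 1 - h n -> (chat X K k h kappa w s)^-1 = inv_max (kernel_sum tb s).
  move=> /andP[hs s1]; rewrite /inv_max /chat; congr (Num.max _ kappa)^-1.
  rewrite /ctilde /kernel_sum; congr (_ * _); rewrite big_add1/= big_mkord.
  by apply: eq_bigr => i _; rewrite /boundary_kernel !ifF//; apply/negbTE; rewrite -ltNge.
have chat_range s : 0 <= (chat X K k h kappa w s)^-1 <= kappa^-1 by exact: inv_max_range.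
have mc : measurable_fun `]h n, (1 - h n)[%classic (fun s => (chat X K k h kappa w s)^-1).
  apply: (@eq_measurable_fun _ _ _ _ _ (fun s => inv_max (kernel_sum tb s))).
    by move=> s; rewrite inE/= in_itv/= => /chatE.
  by apply: measurable_inv_max; exact: measurable_kernel_sum.
have Ec : \int[mu]_(s in `]h n, (1 - h n)[) (chat X K k h kappa w s)^-1 =
    \int[mu]_(s in `]h n, (1 - h n)[) inv_max (kernel_sum tb s).
  by apply: eq_Rintegral => s; rewrite inE/= in_itv/= => /chatE.
have tauE : tau c = \int[mu]_(s in `[0, 1]) inv_max (c s).
  by apply: eq_Rintegral => s; rewrite inE/= in_itv/= => /inv_max_c.
have mcc : measurable_fun `]h n, (1 - h n)[%classic (fun s => inv_max (c s)).
  by apply: measurable_inv_max; apply: measurable_c => //; exact: interior_sub.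
have crop1 := Rintegral_crop hn h2 (fun s _ => chat_range s) mc.
have crop2 := Rintegral_crop hn h2 (fun s _ => inv_max_range (c s)) mcc.
rewrite -tauE in crop2; rewrite -/(tauhat X K k h kappa w) Ec in crop1.
set It := \int[mu]_(s in _) inv_max (kernel_sum tb s) in crop1 *.
set Ic := \int[mu]_(s in _) inv_max (c s) in crop2 *.
have close1 : `|tauhat X K k h kappa w - tau c| <= `|It - Ic| + kappa^-1 * (2 * h n).
  rewrite ler_norml; have := ler_norm (It - Ic); have := ler_norm (Ic - It).
  rewrite (distrC Ic); lra.
apply: le_trans close1 _; rewrite lerD2r.
pose Ib := \int[mu]_(s in `]h n, (1 - h n)[) inv_max (kernel_sum (fun i => (b i)%:R) s).
rewrite -(subrKA Ib); apply: le_trans (ler_normD _ _) _; apply: lerD.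
  apply: le_trans (kernel_sum_dist k0 hB (b := fun i => top X k i w) (b' := b) _ _).
  - rewrite /It /Ib -RintegralB//; try exact: inv_max_kernel_integrable.
    apply: le_normr_Rintegral => //.
    by apply: (integrable_subR mI); exact: inv_max_kernel_integrable.
  - by move=> i /hm[].
  - by move=> i; rewrite orbC; exact: hp.
rewrite /Ib /Ic /pattern_error -RintegralB//.
- apply: le_normr_Rintegral => //; apply: (integrable_subR mI).
    exact: inv_max_kernel_integrable.
  exact: inv_max_c_integrable.
- exact: inv_max_kernel_integrable.
- exact: inv_max_c_integrable.
Qed.

Lemma tauhat_comparisons n : (k n < n)%N -> exists f : {ffun 'I_n * 'I_n -> bool} -> R,
  forall w : T n, tauhat X K k h kappa w = f (comparisons X w).
Proof.
move=> kn.
pose topc (x : {ffun 'I_n * 'I_n -> bool}) (i : 'I_n) : R :=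
  ((n - k n <= #|[pred j : 'I_n | x (j, i)]|)%N)%:R.
exists (fun x => \int[mu]_(s in `[0, 1]) (Num.max (((k n)%:R * h n)^-1 *
  \sum_(i < n) topc x i * boundary_kernel K (h n) ((s - i.+1%:R / n%:R) / h n) s) kappa)^-1) => w.
apply: eq_Rintegral => s _; rewrite /chat /ctilde; congr (Num.max (_ * _) _)^-1.
rewrite big_add1/= big_mkord; apply: eq_bigr => i _; congr (_ * _).
by rewrite /topc -top_comparisons.
Qed.

End kernel_estimator.

(** * Consistency of the integral of the inverse scedasis estimator *)

Section tauhat_consistency.
Context {R : realType} (d : nat -> measure_display) (T : forall n : nat, measurableType (d n))
  (P : forall n : nat, probability (T n) R)
  (X : forall n : nat, nat -> {RV (P n) >-> R})
  (d0 : measure_display) (T0 : measurableType d0) (P0 : probability T0 R)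
  (U : int -> {RV P0 >-> R})
  (F : cumulativeBounded (0 : R) (1 : R)) (c A : R -> R) (cmin cmax : R).
Hypotheses (hmodel : model X F c U) (hF2 : second_order X F c A).
Hypotheses (hc : forall s : R, 0 <= s <= 1 -> cmin < c s <= cmax) (cmin0 : 0 < cmin).
Hypothesis hold : hoelder_half c.
Variables (K : R -> R) (k l r : nat -> nat) (h : nat -> R).
Hypotheses (hK : kernel_function K) (LK : [lipschitz K x | x in `[-1, 1]]).
Hypotheses (k_range : \forall n \near \oo, (0 < k n)%N && (k n < n)%N)
  (k_cvg : (k n)%:R / n%:R @[n --> \oo] --> (0 : R))
  (hrl : \forall n \near \oo, (0 < r n)%N && (l n <= r n)%N)
  (hmix : (n %/ r n).+1%:R * beta_mixing U (l n) @[n --> \oo] --> (0 : R))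
  (hrk : (r n)%:R / (k n)%:R @[n --> \oo] --> (0 : R))
  (h0 : forall n, 0 < h n) (h_cvg : h n @[n --> \oo] --> (0 : R))
  (nh_cvg : (n%:R * h n)^-1 @[n --> \oo] --> (0 : R))
  (hrkh : (r n)%:R / ((k n)%:R * h n) @[n --> \oo] --> (0 : R)).

Variable kappa : R.
Hypotheses (kappa0 : 0 < kappa) (kappac : kappa < cmin).

Let kap n : R := (k n)%:R / n%:R.

Let kap0 : \forall n \near \oo, 0 < kap n.
Proof.
near=> n; have /andP[k0 kn] : (0 < k n)%N && (k n < n)%N by near: n.
by rewrite divr_gt0// ltr0n//; exact: leq_trans kn.
Unshelve. all: end_near. Qed.

Let hrkap : (r n)%:R / (n%:R * kap n) @[n --> \oo] --> (0 : R).
Proof.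
apply: cvg_trans hrk; apply: near_eq_cvg; near=> n.
have /andP[k0 kn] : (0 < k n)%N && (k n < n)%N by near: n.
rewrite /kap mulrCA divff ?mulr1// pnatr_eq0 -lt0n; exact: leq_trans kn.
Unshelve. all: end_near. Qed.

Lemma pattern_error_vanishing e : 0 < e ->
  vanishing P (fun n => [set w | e <= pattern_error c K k h kappa
     (fun i => (exceed X (level F (1 * kap n)) i w)%:R)]).
Proof.
move=> e0 b b0.
pose eta := e * b * kappa ^+ 2 / 2; pose e2 := e * b * kappa / 2.
have eta0 : 0 < eta by rewrite divr_gt0// mulr_gt0 ?exprn_gt0// mulr_gt0.
have e20 : 0 < e2 by rewrite divr_gt0// mulr_gt0// mulr_gt0.
have hl := kernel_level_lln hmodel hF2 hc cmin0 hold hK LK k_range k_cvg hrl hmix h0 h_cvg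
  nh_cvg hrkh eta0 e20.
near=> n.
have hln : forall s, h n < s < 1 - h n -> (P n [set w | eta < `|kernel_sum K k h
   (fun i => (exceed X (level F (1 * ((k n)%:R / n%:R))) i w)%:R) s - c s|]%R <= e2%:E)%E by near: n.
pose u := level F (1 * kap n).
exists [set w : T n | e <= pattern_error c K k h kappa (fun i => (exceed X u i w)%:R)]; split => //.
  exact: (@measurable_exceed_event _ _ _ _ X n u (fun b => e <= pattern_error c K k h kappa b)).
have -> : [set w : T n | e <= pattern_error c K k h kappa (fun i => (exceed X u i w)%:R)]
  = [set w | e <= (fun x : {ffun 'I_n -> bool} => pattern_error c K k h kappa (fun i => (x i)%:R))
       (patt (@exceed _ _ _ _ X n u) w)].
  congr mkset; apply/funext => w; congr (is_true (_ <= pattern_error _ _ _ _ _ _)).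
  by apply/funext => i; rewrite ffunE.
have me (i : 'I_n) : measurable [set w | exceed X u i w] by exact: measurable_exceed.
apply: (le_trans (patt_markov (P n) (f := fun x : {ffun 'I_n -> bool} => pattern_error c K k h kappa (fun i => (x i)%:R)) me e0 _)).
  by move=> x; apply: Rintegral_ge0 => s _.
rewrite lee_fin ler_pdivrMr//.
have hp : prob_weights (pat_law (P n) (@exceed _ _ _ _ X n u)) by exact: exceed_law_prob.
apply: (le_trans (pattern_error_mean hmodel hK h0 kappa0 hp (ltW eta0) (ltW e20) _)).
  move=> s /hln; rewrite -lee_fin; apply: le_trans.
  rewrite -(pE_pat_law (P n) (fun x => eta < `|kernel_sum K k h (fun i => (x i)%:R) s - c s|) me).
  rewrite le_eqVlt; apply/orP; left; apply/eqP; congr (P n _).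
  congr mkset; apply/funext => w; congr (is_true (_ < `|kernel_sum _ _ _ _ _ - _|)).
  by apply/funext => i; rewrite ffunE.
rewrite le_eqVlt; apply/orP; left; apply/eqP; rewrite /eta /e2; field.
by rewrite gt_eqF.
Unshelve. all: end_near. Qed.

(** The levels [(1 - ep) k / n] and [(1 + ep) k / n] enclose with high
probability both the random threshold and the level [k / n]. *)
Theorem tauhat_consistent : cvg_in_prob P (tauhat X K k h kappa) (tau c).
Proof.
apply: cvg_in_prob_vanishing.
  near=> n => e; apply: measurable_through_comparisons; apply: tauhat_comparisons.
  by have /andP[] : (0 < k n)%N && (k n < n)%N by near: n.
move=> e e0.
have [B B0 hB] := kernel_bounded hK LK.
(* at most [3 ep k] observations lie between the two enclosing levels, and they
must contribute at most [e / 4] *)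
pose ep := Num.min 2^-1 (e * kappa ^+ 2 / (24 * (B + 1))).
have B1 : 0 < B + 1 by lra.
have k2 : 0 < kappa ^+ 2 by rewrite exprn_gt0.
have ep0 : 0 < ep by rewrite lt_min invr_gt0 ltr0n/= divr_gt0// mulr_gt0.
have ep2 : ep <= 2^-1 by rewrite ge_min lexx.
have epB : ep * (24 * (B + 1)) <= e * kappa ^+ 2.
  by rewrite -ler_pdivlMr ?mulr_gt0// ge_min lexx orbT.
have ym : 0 < 1 - ep by lra.
have yp : 0 < 1 + ep by lra.
have ep20 : 0 < ep / 2 by lra.
have e40 : 0 < e / 4 by lra.
have vm := count_lln hmodel hF2 hc cmin0 hold kap0 k_cvg hrl hmix ym hrkap ep20.
have vp := count_lln hmodel hF2 hc cmin0 hold kap0 k_cvg hrl hmix yp hrkap ep20.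
have ve := pattern_error_vanishing e40.
apply: vanishing_sub (vanishingU (vanishingU vm vp) ve).
have hkh : kappa^-1 * (2 * h n) @[n --> \oo] --> (0 : R).
  rewrite -[X in _ --> X](mulr0 kappa^-1); apply: cvgMr.
  by rewrite -[X in _ --> X](mulr0 2); apply: cvgMr.
have k2_cvg : 2 * kap n @[n --> \oo] --> (0 : R).
  by rewrite -[X in _ --> X](mulr0 2); apply: cvgMr.
near=> n => w /=.
have /andP[k0 kn] : (0 < k n)%N && (k n < n)%N by near: n.
have n0 : (0 < n)%N by exact: leq_trans kn.
have kR : (0 : R) < (k n)%:R by rewrite ltr0n.
have kapn : 0 < kap n by near: n.
have kap12 : 2 * kap n < 1 by near: n; exact: (cvgr_lt _ k2_cvg).
have h2 : h n < 2^-1 by near: n; apply: (cvgr_lt _ h_cvg); rewrite invr_gt0.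
have hk4 : kappa^-1 * (2 * h n) < e / 4 by near: n; exact: (cvgr_lt _ hkh).
have nk : n%:R * kap n = (k n)%:R by rewrite /kap mulrCA divff ?mulr1// pnatr_eq0 -lt0n.
rewrite nk => far; apply: contrapT => /not_orP[/not_orP[fm fp] fe]; move: fm fp fe => /negP + /negP + /negP.
rewrite -!leNgt -ltNge.
set um := level F ((1 - ep) * kap n); set up := level F ((1 + ep) * kap n).
set u1 := level F (1 * kap n).
set Nm := \sum_(i < n) _; set Np := \sum_(i < n) _ => dm dp pe.
have dmk : `|Nm - (1 - ep) * (k n)%:R| <= ep / 2 * (k n)%:R.
  move: dm; rewrite -(ler_pM2r kR) -[X in _ * X <= _](gtr0_norm kR) -normrM mulrBl.
  by rewrite mulrAC mulVf ?mul1r// gt_eqF.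
have dpk : `|Np - (1 + ep) * (k n)%:R| <= ep / 2 * (k n)%:R.
  move: dp; rewrite -(ler_pM2r kR) -[X in _ * X <= _](gtr0_norm kR) -normrM mulrBl.
  by rewrite mulrAC mulVf ?mul1r// gt_eqF.
have epk : 0 < ep * (k n)%:R by rewrite mulr_gt0.
have Nmk : Nm <= (k n)%:R by move: dmk; rewrite ler_norml; nra.
have Npk : (k n)%:R < Np by move: dpk; rewrite ler_norml; nra.
have Nd : Np - Nm <= 3 * ep * (k n)%:R by move: dmk dpk; rewrite !ler_norml; nra.
have lm : 1 - F um = (1 - ep) * kap n by apply: (levelE hmodel); nra.
have lp : 1 - F up = (1 + ep) * kap n by apply: (levelE hmodel); nra.
have l1 : 1 - F u1 = 1 * kap n by apply: (levelE hmodel); nra.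
have um1 : u1 < um by apply: (@cumulative_lt _ F); nra.
have up1 : up < u1 by apply: (@cumulative_lt _ F); nra.
have top_m (i : 'I_n) : exceed X um i w -> exceed X u1 i w /\ top X k i w.
  move=> xi; split; first by exact: lt_trans um1 xi.
  by apply: exceed_le_top xi => //; rewrite -(ler_nat R) card_exceedE.
have top_p (i : 'I_n) : exceed X u1 i w || top X k i w -> exceed X up i w.
  case/orP => [xi|xi]; first by exact: lt_trans up1 xi.
  by apply: top_le_exceed xi => //; rewrite -(ltr_nat R) card_exceedE.
have := tauhat_close hmodel hc hK h0 kappa0 kappac k0 h2 hB top_m top_p.
rewrite sumrB -/Np -/Nm.
have : kappa ^- 2 * (2 * B * (Np - Nm) / (k n)%:R) <= e / 4.
  rewrite mulrC ler_pdivrMr// ler_pdivrMr//.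
  have h1 : 2 * B * (Np - Nm) <= 2 * B * (3 * ep * (k n)%:R).
    by rewrite ler_wpM2l// mulr_ge0.
  apply: (le_trans h1).
  have : 24 * (B * ep) * (k n)%:R <= e * kappa ^+ 2 * (k n)%:R.
    by rewrite ler_wpM2r ?(ltW kR)//; nra.
  lra.
move: pe far; set pe := pattern_error _ _ _ _ _ _; set dd := `|_ - _|.
lra.
Unshelve. all: end_near. Qed.

End tauhat_consistency.

(** * Block maxima and the empirical distribution function *)

Lemma bigmax_attained {R : realType} (I : eqType) (s : seq I) (f : I -> R) :
  (forall i, 0 <= f i) -> s != [::] -> exists2 i, i \in s & \big[Num.max/0]_(j <- s) f j = f i.
Proof.
move=> f0; elim: s => // i s ih _; rewrite big_cons.
case: (eqVneq s [::]) => [->|/ih[j js ->]].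
  by exists i; rewrite ?mem_head// big_nil max_l.
case: (lerP (f i) (f j)) => ij.
  by exists j => //; rewrite in_cons js orbT.
by exists i => //; rewrite mem_head.
Qed.

Lemma bigmax_ub {R : realType} (I : eqType) (s : seq I) (f : I -> R) i :
  i \in s -> f i <= \big[Num.max/0]_(j <- s) f j.
Proof.
elim: s => // j s ih; rewrite big_cons in_cons le_max => /orP[/eqP ->|/ih ->].
  by rewrite lexx.
by rewrite orbT.
Qed.

(** Each summand is dominated by an increment of [- exp (- s x) / s], and the
increments telescope. *)
Lemma exp_riemann_upper {R : realType} (s : R) (m N : nat) : 0 < s -> (0 < m)%N ->
  m%:R^-1 * (\sum_(1 <= a < N.+1) expR (- (s * (a%:R / m%:R)))) <= s^-1.
Proof.
move=> s0 m0; have mR : (0 : R) < m%:R by rewrite ltr0n.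
pose E (a : nat) : R := expR (- (s * (a%:R / m%:R))).
have step a : s / m%:R * E a.+1 <= E a - E a.+1.
  have -> : E a = E a.+1 * expR (s / m%:R).
    by rewrite /E -expRD; congr expR; rewrite -natr1; field; rewrite gt_eqF.
  have := expR_ge1Dx (s / m%:R); have := expR_gt0 (- (s * (a.+1%:R / m%:R))); rewrite -/(E a.+1); nra.
have : s / m%:R * (\sum_(1 <= a < N.+1) E a) <= 1 - E N.
  elim: N => [|N ih]; first by rewrite big_geq// mulr0 /E mul0r mulr0 oppr0 expR0 subrr.
  by rewrite big_nat_recr//= mulrDr; have := step N; lra.
have EN : 0 < E N by exact: expR_gt0.
move=> h; rewrite -(ler_pM2l s0) divff ?gt_eqF// mulrA; lra.
Qed.

(** The same telescoping from below; the last error is the integral of the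
exponential beyond [L], where [exp (- x) <= 1 / x]. *)
Lemma exp_riemann_lower {R : realType} (s : R) (m L : nat) : 0 < s -> (0 < m)%N -> (0 < L)%N ->
  s^-1 - m%:R^-1 - (s ^+ 2 * L%:R)^-1
    <= m%:R^-1 * (\sum_(1 <= a < (L * m).+1) expR (- (s * (a%:R / m%:R)))).
Proof.
move=> s0 m0 L0; have mR : (0 : R) < m%:R by rewrite ltr0n.
have LR : (0 : R) < L%:R by rewrite ltr0n.
pose E (a : nat) : R := expR (- (s * (a%:R / m%:R))).
have step a : E a - E a.+1 <= s / m%:R * E a.
  have -> : E a.+1 = E a * expR (- (s / m%:R)).
    by rewrite /E -expRD; congr expR; rewrite -natr1; field; rewrite gt_eqF.
  have := expR_ge1Dx (- (s / m%:R)); have := expR_gt0 (- (s * (a%:R / m%:R))); rewrite -/(E a); nra.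
have tel N : 1 - E N <= s / m%:R * (1 - E N + \sum_(1 <= a < N.+1) E a).
  elim: N => [|N ih].
    by rewrite big_geq// addr0 /E mul0r mulr0 oppr0 expR0 subrr mulr0.
  by rewrite big_nat_recr//=; have := step N; lra.
have {tel} := tel (L * m)%N; set S := \sum_(_ <= _ < _) _.
have EL : E (L * m)%N <= (s * L%:R)^-1.
  rewrite /E natrM -mulrA divff ?gt_eqF// mulr1 expRN lef_pV2 ?posrE ?expR_gt0 ?mulr_gt0//.
  by have := expR_ge1Dx (s * L%:R); lra.
have EL0 : 0 < E (L * m)%N by exact: expR_gt0.
move=> tel.
rewrite -(ler_pM2l s0) mulrBr mulrBr divff ?gt_eqF//.
have -> : s * (s ^+ 2 * L%:R)^-1 = (s * L%:R)^-1 by field; rewrite !gt_eqF.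
have sm0 : 0 < s / m%:R by rewrite divr_gt0.
have : s / m%:R * (1 - E (L * m)%N + S) <= s / m%:R + s * (m%:R^-1 * S).
  have -> : s * (m%:R^-1 * S) = s / m%:R * S by ring.
  by nra.
lra.
Qed.

Section blocks.
Context {R : realType} (d : nat -> measure_display) (T : forall n : nat, measurableType (d n))
  (P : forall n : nat, probability (T n) R)
  (X : forall n : nat, nat -> {RV (P n) >-> R}) (q : nat -> nat).

Lemma in_blockP n j i : (0 < q n)%N -> (1 <= j <= nblocks q n)%N ->
  ((j - 1) * q n + 1 <= i < (j * q n).+1)%N ->
  exists2 i' : 'I_n, in_block (q n) j.-1 i' & i = i'.+1.
Proof.
case: j => // j q0 /= jk; rewrite subn1/= => /andP[i1 i2].
have jn : (j.+1 * q n <= n)%N by apply: leq_trans (leq_trunc_div n (q n)); rewrite leq_mul2r jk orbT.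
have hi : (i.-1 < n)%N by apply: leq_trans jn; move: i1 i2; lia.
exists (Ordinal hi); last by rewrite /= prednK//; lia.
rewrite /in_block/=; apply/andP; split; move: i1 i2; lia.
Qed.

Lemma in_block_index n j (i : 'I_n) : (1 <= j)%N -> in_block (q n) j.-1 i ->
  ((j - 1) * q n + 1 <= i.+1 < (j * q n).+1)%N.
Proof. by rewrite /in_block/= => j1 /andP[]; rewrite prednK// subn1; lia. Qed.

Definition quiet n (u : R) (j : nat) (w : T n) : bool :=
  [forall i : 'I_n, in_block (q n) j i ==> ~~ exceed X u i w].

Lemma block_max_le n j (G : R -> R) u (w : T n) : (0 < q n)%N -> (1 <= j <= nblocks q n)%N ->
  {homo G : x y / x <= y} -> 0 <= G u -> quiet u j.-1 w -> block_max X q j G w <= G u.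
Proof.
move=> q0 jk hG G0 /forallP qu; rewrite /block_max big_seq; elim/big_ind: _ => //.
  by move=> x y hx hy; rewrite ge_max hx.
move=> i; rewrite mem_index_iota => hi.
have [i' bi' ->] := in_blockP q0 jk hi.
by apply: hG; have := qu i'; rewrite bi'/= -leNgt.
Qed.

Lemma block_max_ub n j (G : R -> R) (w : T n) (i : 'I_n) : (1 <= j)%N ->
  in_block (q n) j.-1 i -> G (X n i.+1 w) <= block_max X q j G w.
Proof.
move=> j1 /(in_block_index j1) hi; rewrite /block_max.
by apply: (@bigmax_ub _ _ _ (fun i => G (X n i w)) i.+1); rewrite mem_index_iota.
Qed.

Lemma block_max_ge n j (G : R -> R) u (w : T n) : (1 <= j)%N ->
  {homo G : x y / x <= y} -> ~~ quiet u j.-1 w -> G u <= block_max X q j G w.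
Proof.
move=> j1 hG; rewrite negb_forall => /existsP[i]; rewrite negb_imply negbK => /andP[bi ui].
by apply: le_trans (block_max_ub G w j1 bi); apply: hG; exact: ltW.
Qed.

Lemma ecdf_homo n (w : T n) : {homo ecdf X w : x y / x <= y}.
Proof.
move=> x y xy; rewrite /ecdf ler_wpM2l ?invr_ge0//; apply: ler_sum => i _.
by rewrite ler_nat; case: (lerP (X n i w) x) => //= h; rewrite (le_trans h xy).
Qed.

Lemma ecdf_ge0 n (w : T n) x : 0 <= ecdf X w x.
Proof. by rewrite mulr_ge0 ?invr_ge0//; apply: sumr_ge0. Qed.

Definition above n (u : R) (w : T n) : R := \sum_(i < n) (exceed X u i w)%:R.

Lemma one_minus_ecdf n (w : T n) x : (0 < n)%N -> 1 - ecdf X w x = n%:R^-1 * above x w.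
Proof.
move=> n0; have nR : (n%:R : R) != 0 by rewrite pnatr_eq0 -lt0n.
rewrite /ecdf /above big_add1/= big_mkord.
have -> : \sum_(i < n) (exceed X x i w)%:R = n%:R - \sum_(i < n) (X n i.+1 w <= x)%R%:R :> R.
  apply/eqP; rewrite eq_sym subr_eq -big_split/= (eq_bigr (fun=> 1)) ?sumr_const ?card_ord// => i _.
  by rewrite /exceed ltNge; case: (_ <= _); rewrite ?addr0 ?add0r.
by rewrite mulrBr mulVf.
Qed.

Section one_block.
Variables (n j : nat) (w : T n).
Hypotheses (q0 : (0 < q n)%N) (n0 : (0 < n)%N) (jk : (1 <= j <= nblocks q n)%N).

(** When the block is quiet at [u], all sample points above [u] lie above the
block maximum; otherwise the block maximum is itself above [u]. *)
Lemma Zhat_quiet u : quiet u j.-1 w -> (q n)%:R / n%:R * above u w <= Zhat X q j w.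
Proof.
move=> qu; rewrite /Zhat -mulrA -one_minus_ecdf// ler_wpM2l// lerD2l lerN2.
apply: block_max_le => //; [exact: ecdf_homo|exact: ecdf_ge0].
Qed.

Lemma Zhat_not_quiet u : ~~ quiet u j.-1 w -> Zhat X q j w <= (q n)%:R / n%:R * above u w.
Proof.
move=> qu; rewrite /Zhat -mulrA -one_minus_ecdf// ler_wpM2l// lerD2l lerN2.
by apply: block_max_ge => //; [case/andP: jk|exact: ecdf_homo].
Qed.

Lemma Zhat_ge0 : 0 <= Zhat X q j w.
Proof.
rewrite /Zhat mulr_ge0// subr_ge0 /block_max; elim/big_ind: _ => //.
  by move=> x y hx hy; rewrite ge_max hx.
move=> i _; rewrite -subr_ge0 one_minus_ecdf// mulr_ge0 ?invr_ge0//; exact: sumr_ge0.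
Qed.

Variable F : cumulativeBounded (0 : R) (1 : R).

Lemma Zblock_quiet u : quiet u j.-1 w -> (q n)%:R * (1 - F u) <= Zblock X q F j w.
Proof.
move=> qu; rewrite /Zblock ler_wpM2l// lerD2l lerN2.
by apply: block_max_le => //; [exact: cumulative_homo|exact: cumulative_ge0].
Qed.

Lemma Zblock_range : 0 <= Zblock X q F j w <= (q n)%:R.
Proof.
have b0 : 0 <= block_max X q j F w.
  by rewrite /block_max; apply: bigmax_ge_id.
have b1 : block_max X q j F w <= 1.
  rewrite /block_max; elim/big_ind: _ => //.
    by move=> x y hx hy; rewrite ge_max hx.
  by move=> i _; exact: cumulative_le1.
rewrite /Zblock mulr_ge0 ?subr_ge0//=.
by rewrite ler_piMr// gerBl.
Qed.

(** Observations above the block maximum have levels below that of the block. *)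
Lemma Zhat_le_count : Zhat X q j w <=
  (q n)%:R / n%:R * \sum_(i < n) ((q n)%:R * (1 - F (X n i.+1 w)) <= Zblock X q F j w)%R%:R.
Proof.
have /andP[j1 jk'] := jk.
have ne : index_iota ((j - 1) * q n + 1) (j * q n).+1 != [::].
  by rewrite -size_eq0 size_iota; move: q0 j1; case: j => // j'; rewrite subn1/= mulSn; lia.
have [i0] := @bigmax_attained _ _ _ (fun i => F (X n i w)) (fun i => cumulative_ge0 F _) ne.
rewrite mem_index_iota => hi; have [i' bi' ->] := in_blockP q0 jk hi.
rewrite -/(block_max X q j F w) => Fmax.
rewrite /Zhat -mulrA; apply: (@le_trans _ _ ((q n)%:R * (1 - ecdf X w (X n i'.+1 w)))).
  by rewrite ler_wpM2l// lerD2l lerN2; exact: block_max_ub.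
rewrite one_minus_ecdf// ler_wpM2l// ler_wpM2l ?invr_ge0//; apply: ler_sum => i _.
rewrite ler_nat /exceed; case: ltrP => //= h.
rewrite lt0b /Zblock Fmax ler_wpM2l// lerD2l lerN2; exact: cumulative_homo (ltW h).
Qed.

End one_block.
End blocks.

(** * The extremal index and quiet blocks *)

Lemma expR_lipschitz {R : realType} (theta a b : R) : 0 < theta <= 1 -> 0 <= a -> a <= b ->
  expR (- (theta * a)) - expR (- (theta * b)) <= b - a.
Proof.
move=> /andP[th0 th1] a0 ab.
have -> : expR (- (theta * b)) = expR (- (theta * a)) * expR (- (theta * (b - a))).
  by rewrite -expRD; congr expR; ring.
have := expR_ge1Dx (- (theta * (b - a))).
have : expR (- (theta * a)) <= 1.
  by rewrite -expR0 ler_expR oppr_le0 mulr_ge0// ltW.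
have := expR_gt0 (- (theta * a)); have := expR_gt0 (- (theta * (b - a))).
have : theta * (b - a) <= b - a by rewrite ler_piMl// subr_ge0.
have : 0 <= theta * (b - a) by rewrite mulr_ge0 ?subr_ge0// ltW.
nra.
Qed.

Section extremal.
Context {R : realType} (d0 : measure_display) (T0 : measurableType d0) (P0 : probability T0 R)
  (U : int -> {RV P0 >-> R}).

Definition max_cdf (m : nat) (b : R) : R :=
  fine (P0 [set w | forall i : nat, (1 <= i <= m)%N -> U i%:Z w <= b]).

(** By stationarity the maximum may be taken over any window of length [m]. *)
Lemma max_cdf_patt m (b : R) (s : nat) : strictly_stationary U ->
  P0 [set w | forall i : nat, (1 <= i <= m)%N -> U i%:Z w <= b] =
  P0 [set w | forall i : 'I_m, U (i.+1%:Z + s%:Z) w <= b].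
Proof.
move=> st.
have E (f : int -> T0 -> R) (t : 'I_m -> int) :
    [set w | (fun x : {ffun 'I_m -> bool} => forall i, ~~ x i) (patt (fun i w => b < f (t i) w) w)]
    = [set w | forall i : 'I_m, f (t i) w <= b].
  by apply/seteqP; split=> w /= h i; have := h i; rewrite ?ffunE leNgt.
have := same_law_patt (fun i : 'I_m => i.+1%:Z) (fun=> b) (fun x => forall i, ~~ x i) (st s%:Z).
rewrite (E (fun t => U (t + s%:Z))) (E U) => ->; congr (P0 _).
apply/seteqP; split => w /= h i; first by apply: h; rewrite ltn_ord.
by case: i => // i im; exact: (h (Ordinal im)).
Qed.

Lemma measurable_max_le m (b : R) (t : 'I_m -> int) : measurable [set w | forall i : 'I_m, U (t i) w <= b].
Proof.
have -> : [set w | forall i : 'I_m, U (t i) w <= b] = \bigcap_(i in [set: 'I_m]) [set w | U (t i) w <= b].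
  by apply/seteqP; split=> w /= h i; [move=> _|]; exact: h.
by apply: fin_bigcap_measurable => [|i _]; [exact: finite_finset|exact: measurable_le_RV].
Qed.

Lemma max_cdf_homo m : strictly_stationary U -> {homo max_cdf m : x y / x <= y}.
Proof.
move=> st x y xy; rewrite /max_cdf !(max_cdf_patt _ _ 0%N st).
apply: fine_prob_le; [exact: measurable_max_le|exact: measurable_max_le|].
by move=> w /= h i; exact: le_trans (h i) xy.
Qed.

Variables (theta : R) (q : nat -> nat).
Hypotheses (st : strictly_stationary U) (th : 0 < theta <= 1) (ext : extremal_index U theta).
Hypothesis q_cvg : q n @[n --> \oo] --> \oo.

(** Monotone functions converging to a continuous limit converge uniformly on
compact intervals. *)
Lemma extremal_index_uniform a0 a1 e : 0 < a0 -> a0 <= a1 -> 0 < e ->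
  \forall n \near \oo, forall a, a0 <= a <= a1 ->
    `|max_cdf (q n) (1 - a / (q n)%:R) - expR (- (theta * a))| <= e.
Proof.
move=> a00 a01 e0.
pose dl := e / 2; have dl0 : 0 < dl by rewrite divr_gt0.
pose M := (Num.truncn ((a1 - a0) / dl)).+2.
pose x (i : nat) : R := a0 + i%:R * dl.
have x0 i : 0 < x i by rewrite /x ltr_wpDr// mulr_ge0// ltW.
have grid (i : 'I_M) : \forall n \near \oo,
    `|max_cdf (q n) (1 - x i / (q n)%:R) - expR (- (theta * x i))| <= dl.
  have /cvgrPdist_le/(_ _ dl0) := cvg_comp _ _ q_cvg (ext (x0 i)).
  by apply: filterS => n; rewrite distrC.
have {}grid : \forall n \near \oo, forall i : 'I_M,
    `|max_cdf (q n) (1 - x i / (q n)%:R) - expR (- (theta * x i))| <= dl.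
  exact: filter_forall.
near=> n => a /andP[a0a aa1].
have gn : forall i : 'I_M, `|max_cdf (q n) (1 - x i / (q n)%:R) - expR (- (theta * x i))| <= dl.
  by near: n.
pose i := Num.truncn ((a - a0) / dl).
have ad0 : 0 <= (a - a0) / dl by rewrite divr_ge0 ?subr_ge0// ltW.
have /andP[i1 i2] := Num.Theory.truncn_itv ad0; rewrite -/i in i1 i2.
have iM : (i.+1 < M)%N.
  by rewrite ltnS ltnS; apply: Num.Theory.le_truncn; rewrite ler_pM2r ?invr_gt0// lerD2r.
have xi : x i <= a by move: i1; rewrite ler_pdivlMr// /x; lra.
have xi1 : a <= x i.+1 by move: i2; rewrite ltr_pdivrMr// /x; lra.
have xd : x i.+1 = x i + dl by rewrite /x -natr1; ring.
have qn0 : 0 <= (q n)%:R^-1 :> R by rewrite invr_ge0.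
have G1 : max_cdf (q n) (1 - x i.+1 / (q n)%:R) <= max_cdf (q n) (1 - a / (q n)%:R).
  by apply: max_cdf_homo => //; rewrite lerD2l lerN2 ler_wpM2r.
have G2 : max_cdf (q n) (1 - a / (q n)%:R) <= max_cdf (q n) (1 - x i / (q n)%:R).
  by apply: max_cdf_homo => //; rewrite lerD2l lerN2 ler_wpM2r.
have := gn (Ordinal iM); have := gn (Ordinal (ltnW iM)); rewrite /= !ler_norml.
have l1 := expR_lipschitz th (ltW (x0 i)) xi.
have a_ge0 : 0 <= a by apply: le_trans xi; exact: ltW.
have l2 := expR_lipschitz th a_ge0 xi1.
by rewrite /dl in xd *; lra.
Unshelve. all: end_near. Qed.

End extremal.

Section quiet_blocks.
Context {R : realType} (d : nat -> measure_display) (T : forall n : nat, measurableType (d n))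
  (P : forall n : nat, probability (T n) R)
  (X : forall n : nat, nat -> {RV (P n) >-> R})
  (d0 : measure_display) (T0 : measurableType d0) (P0 : probability T0 R)
  (U : int -> {RV P0 >-> R})
  (F : cumulativeBounded (0 : R) (1 : R)) (c A : R -> R) (cmin cmax : R).
Hypotheses (hmodel : model X F c U) (hF2 : second_order X F c A).
Hypotheses (hc : forall s : R, 0 <= s <= 1 -> cmin < c s <= cmax) (cmin0 : 0 < cmin).
Hypothesis hold : hoelder_half c.
Variables (theta : R) (q : nat -> nat).
Hypotheses (th : 0 < theta <= 1) (ext : extremal_index U theta).
Hypothesis q_cvg : q n @[n --> \oo] --> \oo.
Hypothesis kb_cvg : nblocks q n @[n --> \oo] --> \oo.
Hypothesis kb_mix : (nblocks q n)%:R * beta_mixing U (q n) @[n --> \oo] --> (0 : R).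

Lemma quiet_prob n u j bl bh : (0 < n)%N -> (j < nblocks q n)%N ->
  (forall i : 'I_n, in_block (q n) j i -> bl <= cdfR (X n i.+1) u <= bh) ->
  max_cdf U (q n) bl <= fine (P n [set w | quiet X q u j w]) <= max_cdf U (q n) bh.
Proof.
move=> n0 jk hb; have st := model_stationary hmodel.
have -> : [set w : T n | quiet X q u j w] =
    [set w | (fun x : {ffun 'I_n -> bool} => is_true [forall i : 'I_n, in_block (q n) j i ==> ~~ x i])
       (patt (@exceed _ _ _ _ X n u) w)].
  congr mkset; apply/funext => w; congr is_true; apply: eq_forallb => i.
  by rewrite ffunE.
rewrite (exceed_transfer hmodel u (fun x => is_true [forall i : 'I_n, in_block (q n) j i ==> ~~ x i]) n0).
set S := [set w | _]; rewrite /max_cdf !(max_cdf_patt _ _ (j * q n) st).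
have jn : (j.+1 * q n <= n)%N by apply: leq_trans (leq_trunc_div n (q n)); rewrite leq_mul2r jk orbT.
have mS : measurable S.
  apply: (measurable_patt (fun x : {ffun 'I_n -> bool} =>
    is_true [forall i : 'I_n, in_block (q n) j i ==> ~~ x i])) => i.
  exact: measurable_gt_RV.
have blk (i : 'I_n) : in_block (q n) j i -> exists i' : 'I_(q n), i.+1%:Z = i'.+1%:Z + (j * q n)%:Z.
  rewrite /in_block/= => /andP[i1 i2]; have hi : (i - j * q n < q n)%N by move: i1 i2; rewrite mulSn; lia.
  by exists (Ordinal hi) => /=; move: i1; lia.
have blk' (i' : 'I_(q n)) : exists2 i : 'I_n, in_block (q n) j i & i.+1%:Z = i'.+1%:Z + (j * q n)%:Z.
  have i'q := ltn_ord i'.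
  have hi : (i' + j * q n < n)%N by move: jn; rewrite mulSn; lia.
  exists (Ordinal hi) => /=; last by lia.
  by rewrite /in_block/= mulSn; apply/andP; split; lia.
apply/andP; split; apply: fine_prob_le => //; try exact: measurable_max_le.
  move=> w h; apply/forallP => i; apply/implyP => bi; rewrite ffunE -leNgt.
  have [i' E] := blk i bi; rewrite E; apply: le_trans (h i') _.
  by case/andP: (hb i bi).
move=> w /forallP h i'; have [i bi E] := blk' i'; rewrite -E.
have := h i; rewrite bi/= ffunE -leNgt => /le_trans; apply.
by case/andP: (hb i bi).
Qed.

(** A block has length [q], which is at most [n / k'], and [n] exceeds [q k'] by
less than [q]. *)
Lemma block_time n j (i : 'I_n) : (0 < q n)%N -> (j < nblocks q n)%N -> in_block (q n) j i ->
  `|i.+1%:R / n%:R - j.+1%:R / (nblocks q n)%:R| <= 2 / (nblocks q n)%:R :> R.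
Proof.
move=> q0 jk /andP[i1 i2].
have n0 : (0 < n)%N by case: n i i1 i2 q0 jk => // -[].
set kk := nblocks q n in jk *.
have k0 : (0 < kk)%N by exact: leq_trans jk.
have nk1 : (kk * q n <= n)%N by exact: leq_trunc_div.
have nk2 : (n < kk.+1 * q n)%N by exact: ltn_ceil.
have kR : (0 : R) < kk%:R by rewrite ltr0n.
have nR : (0 : R) < n%:R by rewrite ltr0n.
have e1 : (kk * i.+1 <= n * j.+1)%N.
  apply: (@leq_trans (kk * (j.+1 * q n))%N); first by rewrite leq_mul2l i2 orbT.
  by rewrite mulnCA mulnC leq_mul2r nk1 orbT.
have e2 : (n * j.+1 <= kk * i.+1 + n * 2)%N.
  have : (n * j <= kk * i.+1 + n)%N; last by rewrite mulnS; lia.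
  apply: (@leq_trans (kk.+1 * (j * q n))%N).
    by rewrite [leqRHS]mulnCA [leqLHS]mulnC leq_mul2l (ltnW nk2) orbT.
  rewrite mulSn addnC leq_add//; first by rewrite leq_mul2l (leq_trans i1)// orbT.
  by apply: ltnW; apply: leq_ltn_trans i1 _.
have {}e1 : kk%:R * i.+1%:R <= n%:R * j.+1%:R :> R by rewrite -!natrM ler_nat.
have {}e2 : n%:R * j.+1%:R <= kk%:R * i.+1%:R + n%:R * 2 :> R by rewrite -!natrM -natrD ler_nat.
have -> : i.+1%:R / n%:R - j.+1%:R / kk%:R = (kk%:R * i.+1%:R - n%:R * j.+1%:R) / (kk%:R * n%:R) :> R.
  by field; rewrite !gt_eqF.
rewrite normrM [X in _ * X]ger0_norm ?invr_ge0 ?mulr_ge0// ler_pdivrMr ?mulr_gt0//.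
rewrite mulrA divfK ?gt_eqF// ler_norml; lra.
Qed.

(** In the uniform scale the thresholds of block [j] lie between the constants
[1 - (c_j + 2 e1) y / q] and [1 - (c_j - 2 e1) y / q], so that the probability
is enclosed between two values of the distribution function of a stationary
maximum; uniformity in the constants allows [c_j] to depend on the block. *)
Lemma quiet_prob_limit y e : 0 < y -> 0 < e -> \forall n \near \oo,
  forall j, (j < nblocks q n)%N ->
  `|fine (P n [set w | quiet X q (level F (y / (q n)%:R)) j w])
    - expR (- (theta * (c (j.+1%:R / (nblocks q n)%:R) * y)))| <= e.
Proof.
move=> y0 e0; have [Kc Kc0 hKc] := hold.
pose e1 := Num.min (e / (4 * y)) (cmin / 4).
have e10 : 0 < e1 by rewrite lt_min !divr_gt0// mulr_gt0.
have e1y : e1 * y <= e / 4.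
  have : e1 <= e / (4 * y) by rewrite ge_min lexx.
  by rewrite -(ler_pM2r y0); move/le_trans; apply; rewrite le_eqVlt; apply/orP; left;
     apply/eqP; field; rewrite gt_eqF.
have e1c : e1 <= cmin / 4 by rewrite ge_min lexx orbT.
have [v0 /andP[v00 v01] hv] := level_tail hmodel hF2 e10.
have cc : cmin <= cmax by have := hc (s := 0); rewrite lexx ler01 => /(_ isT)/andP[/ltW/le_trans]; apply.
have a00 : 0 < (cmin / 2) * y by rewrite mulr_gt0// divr_gt0.
have a01 : (cmin / 2) * y <= (cmax + cmin) * y by rewrite ler_wpM2r ?(ltW y0)//; lra.
have e20 : 0 < e / 4 by rewrite divr_gt0.
have unif := extremal_index_uniform (model_stationary hmodel) th ext q_cvg a00 a01 e20.
have qy : y / (q n)%:R @[n --> \oo] --> (0 : R).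
  rewrite -[X in _ --> X](mulr0 y); apply: cvgMr; apply/gtr0_cvgV0.
    by near=> n; rewrite ltr0n; near: n; move/cvgnyPgt: q_cvg; exact.
  exact: (cvg_comp _ _ q_cvg (@cvgr_idn R)).
have osc : Kc * Num.sqrt (2 / (nblocks q n)%:R) @[n --> \oo] --> (0 : R).
  rewrite -[X in _ --> X](mulr0 Kc); apply: cvgMr.
  rewrite -(@sqrtr0 R); apply: continuous_cvg; first exact: sqrt_continuous.
  rewrite -[X in _ --> X](mulr0 2); apply: cvgMr; apply/gtr0_cvgV0.
    by near=> n; rewrite ltr0n; near: n; move/cvgnyPgt: kb_cvg; exact.
  exact: (cvg_comp _ _ kb_cvg (@cvgr_idn R)).
near=> n => j jk.
have qn0 : (0 < q n)%N by near: n; move/cvgnyPgt: q_cvg; exact.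
have n0 : (0 < n)%N by near: n; exact: nbhs_infty_gt.
have qR : (0 : R) < (q n)%:R by rewrite ltr0n.
have kR : (0 : R) < (nblocks q n)%:R by rewrite ltr0n; exact: leq_trans jk.
have yqn : y / (q n)%:R < v0 by near: n; exact: (cvgr_lt _ qy).
have yq0 : 0 < y / (q n)%:R by rewrite divr_gt0.
have oscn : Kc * Num.sqrt (2 / (nblocks q n)%:R) < e1 by near: n; exact: (cvgr_lt _ osc).
have un : forall a, cmin / 2 * y <= a <= (cmax + cmin) * y ->
    `|max_cdf U (q n) (1 - a / (q n)%:R) - expR (- (theta * a))| <= e / 4 by near: n.
set cj := c (j.+1%:R / (nblocks q n)%:R).
have j01 : 0 <= (j.+1%:R / (nblocks q n)%:R : R) <= 1.
  by rewrite divr_ge0 ?(ltW kR)//= ler_pdivrMr// mul1r ler_nat.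
have /andP[cj1 cj2] := hc j01; rewrite -/cj in cj1 cj2.
have hb (i : 'I_n) : in_block (q n) j i ->
   1 - (cj + 2 * e1) * y / (q n)%:R <= cdfR (X n i.+1) (level F (y / (q n)%:R))
     <= 1 - (cj - 2 * e1) * y / (q n)%:R.
  move=> bi; have := hv _ yq0 yqn n i.+1 (index_range i).
  have := hKc _ _ (grid01 i) j01; rewrite -/cj.
  have := block_time qn0 jk bi => bt ci.
  have {}ci : `|c (i.+1%:R / n%:R) - cj| <= e1.
    apply: le_trans ci _; apply: le_trans (ltW oscn).
    by rewrite ler_wpM2l ?(ltW Kc0)// ler_wsqrtr.
  move: ci; rewrite !ler_norml -!mulrA => /andP[c1 c2].
  set v := y / (q n)%:R in yq0 *; set G := cdfR _ _; set ci := c _ in c1 c2 * => /andP[g1 g2].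
  by apply/andP; split; nra.
have /andP[p1 p2] := quiet_prob n0 jk hb.
have u1 := un ((cj + 2 * e1) * y); have u2 := un ((cj - 2 * e1) * y).
have r1 : cmin / 2 * y <= (cj + 2 * e1) * y <= (cmax + cmin) * y.
  by rewrite !ler_wpM2r ?(ltW y0)//; lra.
have r2 : cmin / 2 * y <= (cj - 2 * e1) * y <= (cmax + cmin) * y.
  by rewrite !ler_wpM2r ?(ltW y0)//; lra.
move: (u1 r1) (u2 r2); rewrite !ler_norml.
have cy0 : 0 <= (cj - 2 * e1) * y by rewrite mulr_ge0 ?(ltW y0)//; lra.
have cy1 : 0 <= cj * y by rewrite mulr_ge0 ?(ltW y0)//; lra.
have m1 : (cj - 2 * e1) * y <= cj * y by rewrite ler_wpM2r ?(ltW y0)//; lra.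
have m2 : cj * y <= (cj + 2 * e1) * y by rewrite ler_wpM2r ?(ltW y0)//; lra.
have := expR_lipschitz th cy0 m1; have := expR_lipschitz th cy1 m2.
lra.
Unshelve. all: end_near. Qed.

(** Whether a block is quiet is a functional of one block of indicators. *)
Lemma quiet_lln y eta : 0 < y -> 0 < eta -> vanishing P (fun n => [set w | eta <
  `|(nblocks q n)%:R^-1 * \sum_(0 <= j < nblocks q n) (quiet X q (level F (y / (q n)%:R)) j w)%:R
   - (nblocks q n)%:R^-1 * \sum_(0 <= j < nblocks q n)
        expR (- (theta * (c (j.+1%:R / (nblocks q n)%:R) * y)))|]).
Proof.
move=> y0 eta0; have eta20 : 0 < eta / 2 by rewrite divr_gt0.
have lim := quiet_prob_limit y0 eta20.
have kinv : (nblocks q n)%:R^-1 @[n --> \oo] --> (0 : R).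
  apply/gtr0_cvgV0; last exact: (cvg_comp _ _ kb_cvg (@cvgr_idn R)).
  by near=> n; rewrite ltr0n; near: n; move/cvgnyPgt: kb_cvg; exact.
have bound : lln_const 1 (eta / 4) * ((nblocks q n)%:R * (2 * beta_mixing U (q n)) + (nblocks q n)%:R^-1 * 1)
   @[n --> \oo] --> (0 : R).
  rewrite -[X in _ --> X](mulr0 (lln_const 1 (eta / 4))); apply: cvgMr.
  rewrite -[X in _ --> X](addr0 0); apply: cvgD.
    have h2 : 2 * ((nblocks q n)%:R * beta_mixing U (q n)) @[n --> \oo] --> (0 : R).
      by rewrite -[X in _ --> X](mulr0 2); apply: cvgMr.
    by under eq_fun do rewrite mulrCA.
  by rewrite -[X in _ --> X](mul0r 1); apply: cvgMl.
move=> e e0; near=> n.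
have n0 : (0 < n)%N by near: n; exact: nbhs_infty_gt.
have k0 : (0 < nblocks q n)%N by near: n; move/cvgnyPgt: kb_cvg; exact.
have kR : (0 : R) < (nblocks q n)%:R by rewrite ltr0n.
have limn : forall j, (j < nblocks q n)%N ->
  `|fine (P n [set w | quiet X q (level F (y / (q n)%:R)) j w])
    - expR (- (theta * (c (j.+1%:R / (nblocks q n)%:R) * y)))| <= eta / 2 by near: n.
have boundn : lln_const 1 (eta / 4) * ((nblocks q n)%:R * (2 * beta_mixing U (q n)) + (nblocks q n)%:R^-1 * 1)
   < e by near: n; exact: (cvgr_lt _ bound).
set kk := nblocks q n in k0 kR limn boundn *.
set u := level F (y / (q n)%:R) in limn *.
pose b j (x : {ffun 'I_n -> bool}) : R :=
  kk%:R^-1 * ([forall i : 'I_n, in_block (q n) j i ==> ~~ x i])%:R.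
have bq j w : b j (patt (@exceed _ _ _ _ X n u) w) = kk%:R^-1 * (quiet X q u j w)%:R.
  by congr (_ * (nat_of_bool _)%:R); apply: eq_forallb => i; rewrite ffunE.
have Eb j : pE (pat_law (P n) (@exceed _ _ _ _ X n u)) (b j)
    = kk%:R^-1 * fine (P n [set w | quiet X q u j w]).
  rewrite /b pEZ; congr (_ * _).
  have := pE_pat_law (P n) (fun x : {ffun 'I_n -> bool} =>
    [forall i : 'I_n, in_block (q n) j i ==> ~~ x i]) (@measurable_exceed _ _ _ _ X n u).
  move/(congr1 fine) => /= <-; congr (fine (P n _)); congr mkset; apply/funext => w.
  by congr is_true; apply: eq_forallb => i; rewrite ffunE.
have ki0 : 0 <= kk%:R^-1 :> R by rewrite invr_ge0 ltW.
have b01 j x : 0 <= b j x <= kk%:R^-1.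
  by rewrite /b mulr_ge0//= ler_piMr// lern1 leq_b1.
have bdep j : depends_on (in_block (q n) j) (b j).
  move=> x x' xx'; congr (_ * (nat_of_bool _)%:R); apply: eq_forallb => i.
  by case: (boolP (in_block (q n) j i)) => // /xx' ->.
have eta40 : 0 < eta / 4 by rewrite divr_gt0.
have q1 j : fine (P n [set w | quiet X q u j w]) <= 1.
  apply: fine_prob_le1.
  rewrite (_ : [set w | _] = [set w | (fun x : {ffun 'I_n -> bool} =>
    is_true [forall i : 'I_n, in_block (q n) j i ==> ~~ x i]) (patt (@exceed _ _ _ _ X n u) w)]).
    apply: (measurable_patt (fun x : {ffun 'I_n -> bool} =>
      is_true [forall i : 'I_n, in_block (q n) j i ==> ~~ x i])) => i.
    exact: measurable_exceed.
  congr mkset; apply/funext => w; congr is_true; apply: eq_forallb => i; by rewrite ffunE.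
have M1 : \sum_(0 <= j < kk) pE (pat_law (P n) (@exceed _ _ _ _ X n u)) (b j) <= 1.
  apply: (@le_trans _ _ (\sum_(0 <= j < kk) kk%:R^-1)).
    by apply: ler_sum => j _; rewrite Eb ler_piMr.
  by rewrite sumr_const_nat subn0 -[_ *+ _]mulr_natl divff// gt_eqF.
have main := exceed_block_lln (J := kk) hmodel n0 (leqnn (q n)) b01 bdep eta40 M1.
exists [set w | 2 * (eta / 4) < `|\sum_(0 <= j < kk) b j (patt (@exceed _ _ _ _ X n u) w)
   - \sum_(0 <= j < kk) pE (pat_law (P n) (@exceed _ _ _ _ X n u)) (b j)|]; split.
- apply: (measurable_patt (fun x : {ffun 'I_n -> bool} => 2 * (eta / 4) < `|\sum_(0 <= j < kk) b j x
   - \sum_(0 <= j < kk) pE (pat_law (P n) (@exceed _ _ _ _ X n u)) (b j)|)) => i.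
  exact: measurable_exceed.
- move=> w /=.
  under [X in _ -> _ < `|X - _|]eq_bigr do rewrite bq.
  under [X in _ -> _ < `|_ - X|]eq_bigr do rewrite Eb.
  rewrite -!mulr_sumr.
  have close : `|kk%:R^-1 * \sum_(0 <= j < kk) fine (P n [set w | quiet X q u j w])
     - kk%:R^-1 * \sum_(0 <= j < kk) expR (- (theta * (c (j.+1%:R / kk%:R) * y)))| <= eta / 2.
    rewrite -mulrBr -sumrB normrM (ger0_norm ki0).
    rewrite mulrC ler_pdivrMr//; apply: (le_trans (ler_norm_sum _ _ _)).
    apply: (@le_trans _ _ (\sum_(0 <= j < kk) (eta / 2))).
      by rewrite !big_mkord; apply: ler_sum => j _; exact: limn.
    by rewrite sumr_const_nat subn0 -[_ *+ _]mulr_natr.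
  set a := kk%:R^-1 * \sum_(0 <= j < kk) (quiet _ _ _ _ _)%:R.
  set m := kk%:R^-1 * \sum_(0 <= j < kk) fine _ in close *.
  set m' := kk%:R^-1 * \sum_(0 <= j < kk) expR _ in close *.
  by have := ler_distD m a m'; lra.
by apply: le_trans main _; rewrite lee_fin ltW.
Unshelve. all: end_near. Qed.

End quiet_blocks.

(** * Blocks with a large level *)

Section tails.
Context {R : realType} (d : nat -> measure_display) (T : forall n : nat, measurableType (d n))
  (P : forall n : nat, probability (T n) R)
  (X : forall n : nat, nat -> {RV (P n) >-> R})
  (d0 : measure_display) (T0 : measurableType d0) (P0 : probability T0 R)
  (U : int -> {RV P0 >-> R})
  (F : cumulativeBounded (0 : R) (1 : R)) (c A : R -> R) (cmin cmax : R).
Hypotheses (hmodel : model X F c U) (hF2 : second_order X F c A).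
Hypotheses (hc : forall s : R, 0 <= s <= 1 -> cmin < c s <= cmax) (cmin0 : 0 < cmin).
Variable q : nat -> nat.

Lemma measurable_FX n i : measurable_fun [set: T n] (fun w => F (X n i w)).
Proof.
apply: (measurableT_comp (f := F)); last exact: measurable_funPT.
apply: measurable_realfun.continuous_measurable_fun; exact: model_F_continuous hmodel.
Qed.

Definition level_below n (y : R) (i : 'I_n) (w : T n) : bool :=
  (q n)%:R * (1 - F (X n i.+1 w)) <= y.

Lemma measurable_level_below n y (i : 'I_n) : measurable [set w | level_below y i w].
Proof.
have mf : measurable_fun [set: T n] (fun w => (q n)%:R * (1 - F (X n i.+1 w))).
  apply: measurable_realfun.measurable_funM; first exact: measurable_cst.
  by apply: measurable_realfun.measurable_funB; [exact: measurable_cst|exact: measurable_FX].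
have -> : [set w | level_below y i w] = [set: T n] `&` (fun w => (q n)%:R * (1 - F (X n i.+1 w))) @^-1` `]-oo, y].
  by rewrite setTI; apply/seteqP; split=> w /=; rewrite in_itv.
exact: (mf measurableT _ (measurable_itv _)).
Qed.

(** Near the end point this is the tail equivalence; away from it the bound is
trivial. *)
Lemma prob_level_below : exists2 C : R, 0 <= C & forall n y (i : 'I_n), (0 < q n)%N -> 0 < y ->
  fine (P n [set w | level_below y i w]) <= C * (y / (q n)%:R).
Proof.
have [v0 /andP[v00 v01] hv] := level_tail hmodel hF2 (@ltr01 R).
have cc : 0 <= cmax.
  have := hc (s := 0); rewrite lexx ler01 => /(_ isT)/andP[c1 c2].
  by have := lt_trans cmin0 (lt_le_trans c1 c2); exact: ltW.
have vi : 0 <= 2 / v0 by rewrite divr_ge0// ltW.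
exists (2 * (cmax + 1) + 2 / v0) => [|n y i q0 y0]; first by rewrite addr_ge0// mulr_ge0//; lra.
have qR : (0 : R) < (q n)%:R by rewrite ltr0n.
set v := y / (q n)%:R; have v_gt0 : 0 < v by rewrite divr_gt0.
have yE : y = (q n)%:R * v by rewrite /v mulrC divfK// gt_eqF.
case: (ltrP (2 * v) v0) => hv0; last first.
  apply: le_trans (fine_prob_le1 (P n) (measurable_level_below y i)) _.
  have : 1 <= 2 / v0 * v by rewrite mulrAC ler_pdivlMr// mul1r.
  have : 0 <= 2 * (cmax + 1) * v by rewrite !mulr_ge0 ?(ltW v_gt0)//; lra.
  by rewrite mulrDl; lra.
have v2 : 0 < 2 * v by lra.
have := hv _ v2 hv0 n i.+1 (index_range i).
have lE := levelE hmodel v2 (lt_le_trans hv0 v01).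
set u := level F (2 * v) in lE *.
rewrite ler_norml -prob_gt_RV => /andP[_ h].
have /andP[_ ci] := hc (grid01 i).
apply: (@le_trans _ _ (fine (P n [set w | u < X n i.+1 w]))).
  apply: fine_prob_le; [exact: measurable_level_below|exact: measurable_gt_RV|].
  move=> w /=; rewrite /level_below yE ler_pM2l// => hw.
  by apply: (@cumulative_lt _ F); lra.
have : c (i.+1%:R / n%:R) * (2 * v) <= cmax * (2 * v) by rewrite ler_wpM2r// ltW.
have : 0 <= 2 / v0 * v by rewrite mulr_ge0// ltW.
by rewrite mulrDl; lra.
Qed.

Lemma pE_coord n (e : 'I_n -> T n -> bool) (i : 'I_n) : (forall i, measurable [set w | e i w]) ->
  pE (pat_law (P n) e) (fun x => (x i)%:R) = fine (P n [set w | e i w]).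
Proof.
move=> me; have := pE_pat_law (P n) (fun x : {ffun 'I_n -> bool} => x i) me.
move/(congr1 fine) => /= <-; congr (fine (P n _)).
by congr mkset; apply/funext => w; rewrite ffunE.
Qed.

Definition dyadic_count n (m : nat) (w : T n) : R :=
  (q n)%:R / n%:R * \sum_(i < n) (level_below (2 ^+ m) i w)%:R.

(** The mean of the count at the level [2 ^ m] is of order [2 ^ m]; Markov's
inequality leaves the summable failure probabilities [C / (b 2 ^ m)]. *)
Lemma dyadic_count_bound : exists2 C : R, 0 <= C & forall b, 0 < b ->
  (\forall n \near \oo, (0 < q n)%N) ->
  eventually_le P (C / b) (fun n => [set w | exists2 m, (m < (q n).+1)%N & b * 4 ^+ m <= dyadic_count m w]).
Proof.
have [C C0 hC] := prob_level_below.
exists (2 * C) => [|b b0 q0]; first by rewrite mulr_ge0.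
near=> n.
have n0 : (0 < n)%N by near: n; exact: nbhs_infty_gt.
have qn0 : (0 < q n)%N by near: n.
have qR : (0 : R) < (q n)%:R by rewrite ltr0n.
have nR : (0 : R) < n%:R by rewrite ltr0n.
pose B (m : nat) : set (T n) := [set w | b * 4 ^+ m <= dyadic_count m w].
pose f (x : {ffun 'I_n -> bool}) : R := (q n)%:R / n%:R * \sum_(i < n) (x i)%:R.
have BE m : B m = [set w | b * 4 ^+ m <= f (patt (@level_below n (2 ^+ m)) w)].
  congr mkset; apply/funext => w; congr (is_true (_ <= _ * _)).
  by apply: eq_bigr => i _; rewrite ffunE.
have mB m : measurable (B m).
  rewrite BE; apply: (measurable_patt (fun x => b * 4 ^+ m <= f x)) => i.
  exact: measurable_level_below.
have PB m : (P n (B m) <= (C / b * 2^-1 ^+ m)%:E)%E.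
  have b4 : 0 < b * 4 ^+ m by rewrite mulr_gt0// exprn_gt0.
  rewrite BE; apply: le_trans (patt_markov (P n) (f := f) (measurable_level_below _) b4 _) _.
    by move=> x; rewrite /f mulr_ge0 ?divr_ge0// sumr_ge0.
  rewrite lee_fin ler_pdivrMr// /f pEZ pE_sum.
  have -> : C / b * 2^-1 ^+ m * (b * 4 ^+ m) = C * 2 ^+ m.
    have -> : (4 : R) ^+ m = 2 ^+ m * 2 ^+ m by rewrite -exprMn; congr (_ ^+ _); ring.
    rewrite exprVn; field; by rewrite ?gt_eqF ?exprn_gt0.
  apply: (@le_trans _ _ ((q n)%:R / n%:R * \sum_(i < n) C * (2 ^+ m / (q n)%:R))).
    rewrite ler_wpM2l ?divr_ge0//; apply: ler_sum => i _.
    rewrite pE_coord; last exact: measurable_level_below.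
    by apply: hC => //; rewrite exprn_gt0.
  rewrite sumr_const card_ord -[_ *+ _]mulr_natl le_eqVlt; apply/orP; left; apply/eqP; field.
  by rewrite !gt_eqF.
exists (\big[setU/set0]_(m < (q n).+1) B m); split.
- by apply: bigsetU_measurable => m _; exact: mB.
- by move=> w [m mq Bm]; rewrite -bigcup_mkord; exists m.
- apply: (le_trans (Boole_inequality _ _)); first by move=> i _; exact: mB.
  apply: (@le_trans _ _ (\sum_(m < (q n).+1) (C / b * 2^-1 ^+ m)%:E)%E).
    by apply: lee_sum => m _; exact: PB.
  rewrite sumEFin lee_fin -mulr_sumr.
  have geo N : \sum_(m < N) (2^-1 : R) ^+ m = 2 - 2 * 2^-1 ^+ N.
    elim: N => [|N ih]; first by rewrite big_ord0 expr0 mulr1 subrr.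
    by rewrite big_ord_recr/= ih exprS; field.
  rewrite geo; have : 0 <= 2 * (2^-1 : R) ^+ (q n).+1 by rewrite mulr_ge0// exprn_ge0// invr_ge0.
  have : 0 <= C / b by rewrite divr_ge0// ltW.
  have -> : 2 * C / b = 2 * (C / b) by ring.
  nra.
Unshelve. all: end_near. Qed.

(** If [2 ^ m] is the smallest power of 2 above the level [Z] of the block, the
estimated level is at most [b 4 ^ m], and [2 ^ m <= 2 Z]. *)
Lemma Zhat_le_square n j (w : T n) b : (0 < q n)%N -> (0 < n)%N -> (1 <= j <= nblocks q n)%N ->
  (forall m, (m < (q n).+1)%N -> dyadic_count m w <= b * 4 ^+ m) ->
  1 <= Zblock X q F j w -> 0 <= b ->
  Zhat X q j w <= 4 * b * Zblock X q F j w ^+ 2.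
Proof.
move=> q0 n0 jk hm Z1 b0; set Z := Zblock _ _ _ _ _ in Z1 *.
have /andP[_ Zq] := Zblock_range X q j w F.
have exm : exists m, Z <= 2 ^+ m.
  exists (q n); apply: (le_trans Zq); rewrite -natrX ler_nat; apply: ltnW; exact: ltn_expl.
case: (ex_minnP exm) => m Zm mmin.
have mq : (m < (q n).+1)%N.
  rewrite ltnS; apply: mmin; apply: (le_trans Zq); rewrite -natrX ler_nat; apply: ltnW; exact: ltn_expl.
have m2Z : 2 ^+ m <= 2 * Z.
  case: m Zm mmin mq => [|m] Zm mmin mq; first by rewrite expr0; lra.
  rewrite exprS ler_pM2l// leNgt; apply/negP => /ltW /mmin; by rewrite ltnn.
apply: (@le_trans _ _ ((q n)%:R / n%:R *
    \sum_(i < n) ((q n)%:R * (1 - F (X n i.+1 w)) <= Z)%R%:R)); first exact: Zhat_le_count.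
apply: (@le_trans _ _ (dyadic_count m w)).
  rewrite /dyadic_count ler_wpM2l ?divr_ge0//; apply: ler_sum => i _.
  by rewrite ler_nat /level_below -/Z; case: (lerP _ Z) => //= h; rewrite (le_trans h Zm).
apply: le_trans (hm m mq) _.
have -> : (4 : R) ^+ m = 2 ^+ m * 2 ^+ m by rewrite -exprMn; congr (_ ^+ _); ring.
have -> : 4 * b * Z ^+ 2 = b * ((2 * Z) * (2 * Z)) by ring.
by rewrite ler_wpM2l//; apply: ler_pM => //; rewrite exprn_ge0.
Qed.

Lemma measurable_Zblock n j : measurable_fun [set: T n] (fun w => Zblock X q F j w).
Proof.
apply: measurable_realfun.measurable_funM; first exact: measurable_cst.
apply: measurable_realfun.measurable_funB; first exact: measurable_cst.
rewrite /block_max; elim: (index_iota _ _) => [|i s ih].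
  by under eq_fun do rewrite big_nil; exact: measurable_cst.
under eq_fun do rewrite big_cons.
by apply: measurable_realfun.measurable_maxr => //; exact: measurable_FX.
Qed.

Lemma limn_esup_bounded (f : nat -> \bar R) : (limn_esup f < +oo)%E ->
  exists2 M : R, 0 <= M & \forall n \near \oo, (f n <= M%:E)%E.
Proof.
move=> /ereal_inf_lt[_ [V nV <-] sup_lt].
exists (fine (maxe (ereal_sup [set f x | x in V]) 0%E)).
  by rewrite fine_ge0// le_max lexx orbT.
apply: filterS nV => n Vn.
rewrite fineK.
  by rewrite le_max; apply/orP; left; apply: ereal_sup_ubound; exists n.
rewrite ge0_fin_numE ?le_max ?lexx ?orbT//.
by rewrite gt_max sup_lt ltry.
Qed.

Lemma block_moment : block_integrability X q F -> exists2 delta : R, 0 < delta &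
  exists2 M : R, 0 <= M & \forall n \near \oo, forall j, (1 <= j <= nblocks q n)%N ->
  (\int[P n]_w (Zblock X q F j w `^ (2 + delta))%:E <= M%:E)%E.
Proof.
move=> [delta delta0 /limn_esup_bounded[M M0 hM]]; exists delta => //; exists M => //.
apply: filterS hM => n hM j /andP[j1 jk].
have kR : (0 : R) < (nblocks q n)%:R by rewrite ltr0n (leq_trans j1).
apply: le_trans hM; apply: ereal_sup_ubound => /=.
(* the midpoint of the [j]-th cell selects block [j] *)
exists ((j%:R - 2^-1) / (nblocks q n)%:R).
  have j1R : (1 : R) <= j%:R by rewrite ler1n.
  have jkR : (j%:R : R) <= (nblocks q n)%:R by rewrite ler_nat.
  rewrite in_itv/=; apply/andP; split; first by rewrite divr_gt0//; lra.
  by rewrite ltr_pdivrMr// mul1r; lra.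
rewrite unlock; apply: eq_integral => w _; rewrite divfK ?gt_eqF//.
have -> : (Num.truncn (j%:R - 2^-1 : R)).+1 = j.
  case: j j1 {jk} => // j _; congr S; apply: Num.Theory.truncn_def.
  by rewrite -natr1; apply/andP; split; lra.
by rewrite ger0_norm//; case/andP: (Zblock_range X q j w F).
Qed.

Definition large_squares n (L : R) (w : T n) : R :=
  (nblocks q n)%:R^-1 * \sum_(1 <= j < (nblocks q n).+1)
    (L <= Zblock X q F j w)%R%:R * Zblock X q F j w ^+ 2.

(** Where [L <= Z] one has [L ^ delta Z ^ 2 <= Z ^ (2 + delta)], whose mean is
bounded by uniform integrability. *)
Lemma large_squares_bound : block_integrability X q F ->
  (\forall n \near \oo, (0 < nblocks q n)%N) ->
  exists2 delta : R, 0 < delta & exists2 M : R, 0 <= M & forall L rho, 0 < L -> 0 < rho ->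
  eventually_le P (M / (L `^ delta * rho)) (fun n => [set w | rho <= large_squares L w]).
Proof.
move=> /block_moment[delta delta0 [M M0 hM]] k0; exists delta => //; exists M => //.
move=> L rho L0 rho0.
have Ld0 : 0 < L `^ delta by exact: powR_gt0.
have t0 : 0 < L `^ delta * rho by rewrite mulr_gt0.
near=> n.
have kn0 : (0 < nblocks q n)%N by near: n.
have kR : (0 : R) < (nblocks q n)%:R by rewrite ltr0n.
have ki0 : 0 <= (nblocks q n)%:R^-1 :> R by rewrite invr_ge0 ltW.
have hMn : forall j, (1 <= j <= nblocks q n)%N ->
  (\int[P n]_w (Zblock X q F j w `^ (2 + delta))%:E <= M%:E)%E by near: n.
have Z0 j (w : T n) : 0 <= Zblock X q F j w.
  by case/andP: (Zblock_range X q j w F).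
pose Y (j : nat) (w : T n) : R := Zblock X q F j w `^ (2 + delta).
have Y0 j w : 0 <= Y j w by exact: powR_ge0.
have mY j : measurable_fun [set: T n] (Y j).
  have mp := @measurable_realfun.measurable_powR R (2 + delta).
  have mz := @measurable_Zblock n j.
  by have := measurableT_comp mp mz.
pose S (w : T n) : R := (nblocks q n)%:R^-1 * \sum_(1 <= j < (nblocks q n).+1) Y j w.
have S0 w : 0 <= S w by rewrite mulr_ge0// sumr_ge0.
have mS : measurable_fun [set: T n] S.
  apply: measurable_realfun.measurable_funM; first exact: measurable_cst.
  by apply: measurable_sum => j.
exists [set w | L `^ delta * rho <= S w]; split.
- have -> : [set w | L `^ delta * rho <= S w] = [set: T n] `&` S @^-1` `[L `^ delta * rho, +oo[.
    by rewrite setTI; apply/seteqP; split => w /=; rewrite in_itv/= andbT.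
  exact: (mS measurableT _ (measurable_itv _)).
- move=> w /= h; apply: (@le_trans _ _ (L `^ delta * large_squares L w)).
    by rewrite ler_wpM2l// ltW.
  rewrite /large_squares mulrCA /S ler_wpM2l// mulr_sumr; apply: ler_sum => j _.
  case: (lerP L (Zblock X q F j w)) => LZ /=; last by rewrite mul0r mulr0.
  rewrite mul1r /Y powRD; last by rewrite gt_eqF ?implybT// addr_gt0.
  rewrite powR_mulrn// mulrC ler_wpM2l ?exprn_ge0//.
  by apply: ge0_ler_powR; rewrite ?nnegrE ?(ltW L0) ?(ltW delta0).
have IS : (\int[P n]_w (S w)%:E <= M%:E)%E.
  rewrite (_ : (fun w => (S w)%:E) = (fun w => ((nblocks q n)%:R^-1)%:E *
     (\sum_(1 <= j < (nblocks q n).+1) (Y j w)%:E))%E); last first.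
    by apply/funext => w; rewrite /S EFinM sumEFin.
  rewrite ge0_integralZl//; last 2 first.
  - under eq_fun do rewrite sumEFin.
    by apply/measurable_realfun.measurable_EFinP; apply: measurable_sum => j.
  - by move=> w _; rewrite sumEFin lee_fin sumr_ge0.
  rewrite ge0_integral_sum//; last 2 first.
  - by move=> j; apply/measurable_realfun.measurable_EFinP.
  - by move=> j w _; rewrite lee_fin.
  apply: (@le_trans _ _ (((nblocks q n)%:R^-1)%:E * \sum_(1 <= j < (nblocks q n).+1) M%:E)%E).
    apply: lee_wpmul2l; first by rewrite lee_fin.
    rewrite !big_seq; apply: lee_sum => j; rewrite mem_index_iota ltnS => jk.
    exact: hMn.
  rewrite sumEFin -EFinM lee_fin sumr_const_nat subn1 -[M *+ _]mulr_natl mulrA mulVf ?mul1r//.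
  by rewrite gt_eqF.
have := @le_integral_abse _ _ _ (P n) setT measurableT (EFin \o S) (L `^ delta * rho).
have -> : [set: T n] `&` [set x | ((L `^ delta * rho)%:E <= `|(EFin \o S) x|)%E]
   = [set w | L `^ delta * rho <= S w].
  rewrite setTI; apply/seteqP; split => w /=; by rewrite lee_fin ger0_norm.
have -> : (\int[P n]_(x in setT) `|(EFin \o S) x| = \int[P n]_w (S w)%:E)%E.
  by apply: eq_integral => w _ /=; rewrite ger0_norm.
move=> /(_ _ t0) h.
have {}h : ((L `^ delta * rho)%:E * P n [set w | (L `^ delta * rho <= S w)%R] <= M%:E)%E.
  by apply: le_trans IS; apply: h; exact/measurable_realfun.measurable_EFinP.
have mB : measurable [set w | (L `^ delta * rho <= S w)%R].
  have -> : [set w | L `^ delta * rho <= S w] = [set: T n] `&` S @^-1` `[L `^ delta * rho, +oo[.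
    by rewrite setTI; apply/seteqP; split => w /=; rewrite in_itv/= andbT.
  exact: (mS measurableT _ (measurable_itv _)).
rewrite -[X in (X <= _)%E]fineK ?fin_num_measure// lee_fin ler_pdivlMr// mulrC.
by rewrite -lee_fin EFinM fineK ?fin_num_measure.
Unshelve. all: end_near. Qed.

End tails.

(** * The estimated level of a block *)

Section block_comparison.
Context {R : realType} (d : nat -> measure_display) (T : forall n : nat, measurableType (d n))
  (P : forall n : nat, probability (T n) R)
  (X : forall n : nat, nat -> {RV (P n) >-> R}) (q : nat -> nat).
Variables (F : cumulativeBounded (0 : R) (1 : R)) (u : R -> R).
Variables (n j m L : nat) (w : T n) (b : R).
Hypotheses (q0 : (0 < q n)%N) (n0 : (0 < n)%N) (jk : (1 <= j <= nblocks q n)%N)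
  (m0 : (0 < m)%N) (L0 : (0 < L)%N).
Hypothesis uE : forall y, 0 < y -> y <= L%:R -> (q n)%:R * (1 - F (u y)) = y.
Hypothesis count_close : forall a, (1 <= a <= L * m)%N ->
  `|(q n)%:R / n%:R * above X (u (a%:R / m%:R)) w - a%:R / m%:R| <= m%:R^-1.
Hypothesis dyadic : forall i, (i < (q n).+1)%N -> dyadic_count X F q i w <= b * 4 ^+ i.
Hypothesis b0 : 0 <= b.

(** Riemann sum of mesh [1 / m], over [0 < y <= L], of the indicator that the block
is quiet at the level [y / q]. The integral of this indicator is the level of
the block truncated at [L]. *)
Definition quiet_sum : R :=
  m%:R^-1 * \sum_(1 <= a < (L * m).+1) (quiet X q (u (a%:R / m%:R)) j.-1 w)%:R.

Let mR : (0 : R) < m%:R. Proof. by rewrite ltr0n. Qed.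
Let qR : (0 : R) < (q n)%:R. Proof. by rewrite ltr0n. Qed.

Let grid_range a : (1 <= a <= L * m)%N -> 0 < (a%:R / m%:R : R) <= L%:R.
Proof.
move=> /andP[a1 aL]; rewrite divr_gt0 ?ltr0n//= ler_pdivrMr//.
by rewrite -natrM ler_nat.
Qed.

Let quiet_mono a a' : (1 <= a)%N -> (a <= a')%N -> (a' <= L * m)%N ->
  quiet X q (u (a'%:R / m%:R)) j.-1 w -> quiet X q (u (a%:R / m%:R)) j.-1 w.
Proof.
move=> a1 aa' aL /forallP qa; apply/forallP => i; apply/implyP => bi.
have := qa i; rewrite bi/=; apply: contra; rewrite /exceed; apply: le_lt_trans.
case: (ltngtP a a') aa' => // [aa' _|-> //].
have /andP[r1 r2] : 0 < (a%:R / m%:R : R) <= L%:R by apply: grid_range; rewrite a1 (leq_trans (ltnW aa')).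
have /andP[r3 r4] : 0 < (a'%:R / m%:R : R) <= L%:R by apply: grid_range; rewrite aL (leq_trans a1 (ltnW aa')).
have lt_y : (a%:R / m%:R : R) < a'%:R / m%:R by rewrite ltr_pM2r ?invr_gt0// ltr_nat.
apply: ltW; apply: (@cumulative_lt _ F).
have e1 := uE r1 r2; have e2 := uE r3 r4.
have : (q n)%:R * (1 - F (u (a%:R / m%:R))) < (q n)%:R * (1 - F (u (a'%:R / m%:R))) by rewrite e1 e2.
by rewrite ltr_pM2l//; lra.
Qed.

(** Between two consecutive levels of the grid the estimated level of the block
is trapped by the counts at these levels; beyond the largest one the quadratic
bound takes over. *)
Lemma block_comparison : `|Zhat X q j w - quiet_sum| <=
  2 / m%:R + 4 * b * ((L%:R <= Zblock X q F j w)%R%:R * Zblock X q F j w ^+ 2).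
Proof.
have tail0 : 0 <= 4 * b * ((L%:R <= Zblock X q F j w)%R%:R * Zblock X q F j w ^+ 2).
  apply: mulr_ge0; first by rewrite mulr_ge0.
  by apply: mulr_ge0 => //; exact: sqr_ge0.
have mi : 0 < m%:R^-1 :> R by rewrite invr_gt0.
have LR : (1 : R) <= L%:R by rewrite ler1n.
have Lm : (1 <= L * m <= L * m)%N by rewrite leqnn muln_gt0 L0 m0.
have LmE : ((L * m)%:R / m%:R : R) = L%:R by rewrite natrM mulfK// gt_eqF.
case: (boolP (quiet X q (u ((L * m)%:R / m%:R)) j.-1 w)) => qL.
  have HL : quiet_sum = L%:R.
    rewrite /quiet_sum (eq_big_nat _ _ (F2 := fun=> 1)); last first.
      by move=> a /andP[a1 aL]; rewrite (quiet_mono a1 _ _ qL)//; move: aL; rewrite ltnS.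
    by rewrite sumr_const_nat subn1/= mulrC.
  have ZL : L%:R <= Zblock X q F j w.
    have := Zblock_quiet q0 jk F qL; rewrite LmE uE//; lra.
  have := Zhat_quiet q0 n0 jk qL; have := count_close Lm; rewrite LmE ler_norml.
  have := Zhat_le_square q0 n0 jk dyadic (le_trans LR ZL) b0.
  rewrite ZL HL mul1r ler_norml => h1 /andP[h2 h3] h4.
  apply/andP; split; lra.
have exa : exists a, (0 < a)%N && ~~ quiet X q (u (a%:R / m%:R)) j.-1 w.
  by exists (L * m)%N; rewrite qL andbT; case/andP: Lm.
case: (ex_minnP exa) => a0 /andP[a01 qa0] amin.
have a0L : (a0 <= L * m)%N by apply: amin; rewrite qL andbT; case/andP: Lm.
have HE : quiet_sum = (a0%:R - 1) / m%:R.
  rewrite /quiet_sum (big_cat_nat (n := a0))//=; last exact: ltnW.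
  rewrite (eq_big_nat _ _ (F2 := fun=> 1)); last first.
    move=> a /andP[a1 aa0]; case: (boolP (quiet _ _ _ _ _)) => // nq.
    by have := amin a; rewrite a1 nq => /(_ isT); rewrite leqNgt aa0.
  rewrite [X in _ + X]big_nat_cond [X in _ + X]big1; last first.
    move=> a /andP[/andP[a0a aL] _]; rewrite (_ : quiet _ _ _ _ _ = false)//.
    by apply: contraNF qa0; apply: quiet_mono.
  by rewrite addr0 sumr_const_nat mulrC natrB.
have a0r : (1 <= a0 <= L * m)%N by rewrite a01.
have := Zhat_not_quiet n0 jk qa0; have := count_close a0r; rewrite ler_norml => /andP[_ h1] h2.
have up : Zhat X q j w <= quiet_sum + 2 / m%:R by rewrite HE mulrBl; lra.
have low : quiet_sum - m%:R^-1 <= Zhat X q j w.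
  case: (ltngtP a0 1) a01 => // [a1 _|a01' _]; last first.
    rewrite HE a01' subrr mul0r; have := @Zhat_ge0 _ _ _ _ X q n j w n0; lra.
  have a1r : (1 <= a0.-1 <= L * m)%N by move: a1 a0L; lia.
  have qa1 : quiet X q (u (a0.-1%:R / m%:R)) j.-1 w.
    apply/negP => /negP nq; have /andP[p1 _] := a1r.
    have : (a0 <= a0.-1)%N by apply: amin; rewrite nq andbT.
    by rewrite leqNgt prednK ?leqnn ?(ltnW a1).
  have := Zhat_quiet q0 n0 jk qa1; have := count_close a1r; rewrite ler_norml HE.
  have -> : (a0.-1%:R : R) = a0%:R - 1 by rewrite -subn1 natrB//; exact: ltnW.
  by move=> /andP[]; lra.
rewrite ler_norml; apply/andP; split; lra.
Qed.

End block_comparison.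

Section block_sizes.
Context {R : realType} d0 (T0 : measurableType d0) (P0 : probability T0 R) (U : int -> {RV P0 >-> R}).
Variable q : nat -> nat.
Hypotheses (hq : block_size U q) (beta0 : forall n, 0 <= beta_mixing U n).

Lemma block_size_gt0 : \forall n \near \oo, (0 < q n)%N.
Proof. by have /cvgnyPgt/(_ 0%N) := block_infty hq. Qed.

Lemma block_sq_small : (q n)%:R / (n%:R * (q n)%:R^-1) @[n --> \oo] --> (0 : R).
Proof.
have h : (q n)%:R / Num.sqrt n%:R * ((q n)%:R / Num.sqrt n%:R) @[n --> \oo] --> (0 : R).
  by rewrite -[X in _ --> X](mulr0 0); apply: cvgM; exact: block_small hq.
apply: cvg_trans h; apply: near_eq_cvg; near=> n.
have n0 : (0 : R) < n%:R by rewrite ltr0n; near: n; exact: nbhs_infty_gt.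
have q0 : (0 : R) < (q n)%:R by rewrite ltr0n; near: n; exact: block_size_gt0.
rewrite /= mulrACA -invfM -[Num.sqrt _ * _]expr2 sqr_sqrtr ?(ltW n0)//; field.
by rewrite !gt_eqF.
Unshelve. all: end_near. Qed.

Lemma nblocks_cvg : nblocks q n @[n --> \oo] --> \oo.
Proof.
apply/cvgnyPge => A.
have A0 : (0 : R) < A.+1%:R^-1 by rewrite invr_gt0.
near=> n.
have n0 : (0 < n)%N by near: n; exact: nbhs_infty_gt.
have nR : (0 : R) < n%:R by rewrite ltr0n.
have q0 : (0 < q n)%N by near: n; exact: block_size_gt0.
have : (q n)%:R / (n%:R * (q n)%:R^-1) < A.+1%:R^-1 :> R by near: n; exact: (cvgr_lt _ block_sq_small).
have qR : (1 : R) <= (q n)%:R by rewrite ler1n.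
have qR0 : (0 : R) < (q n)%:R by rewrite ltr0n.
rewrite ltr_pdivrMr; last by rewrite mulr_gt0// invr_gt0.
rewrite mulrC ltr_pdivlMr// => h2.
rewrite /nblocks leq_divRL//.
have h3 : n%:R / (q n)%:R <= n%:R :> R by rewrite ler_pdivrMr// ler_peMr// ltW.
rewrite -(ler_nat R) natrM; have : (A%:R : R) <= A.+1%:R by rewrite ler_nat.
by nra.
Unshelve. all: end_near. Qed.

Lemma nblocks_le : \forall n \near \oo, (q n <= n)%N.
Proof.
have /cvgnyPgt/(_ 0%N) := nblocks_cvg; apply: filterS => n; rewrite /nblocks.
by case: (leqP (q n) n) => // h; rewrite divn_small.
Qed.

Lemma nblocks_ratio (n : nat) : (0 < q n)%N -> (nblocks q n)%:R <= n%:R / (q n)%:R :> R.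
Proof.
move=> q0; rewrite ler_pdivlMr ?ltr0n// -natrM ler_nat; exact: leq_trunc_div.
Qed.

Lemma nblocks_mix : (nblocks q n)%:R * beta_mixing U (q n) @[n --> \oo] --> (0 : R).
Proof.
apply: (squeeze_cvgr _ (cvg_cst 0) (block_mixing hq)); near=> n.
have q0 : (0 < q n)%N by near: n; exact: block_size_gt0.
rewrite mulr_ge0//=; have := nblocks_ratio q0; have := beta0 (q n).
by rewrite mulrAC; move=> b1 b2; exact: ler_wpM2r.
Unshelve. all: end_near. Qed.

Lemma nblocksS_mix : (n %/ q n).+1%:R * beta_mixing U (q n) @[n --> \oo] --> (0 : R).
Proof.
have h : 2 * (n%:R * beta_mixing U (q n) / (q n)%:R) @[n --> \oo] --> (0 : R).
  by rewrite -[X in _ --> X](mulr0 2); apply: cvgMr; exact: block_mixing hq.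
apply: (squeeze_cvgr _ (cvg_cst 0) h); near=> n.
have q0 : (0 < q n)%N by near: n; exact: block_size_gt0.
have qn : (q n <= n)%N by near: n; exact: nblocks_le.
rewrite mulr_ge0//=; have := nblocks_ratio q0; have := beta0 (q n).
have : (1 : R) <= n%:R / (q n)%:R by rewrite ler_pdivlMr ?ltr0n// mul1r ler_nat.
rewrite /nblocks => h1 b1 h2.
have -> : 2 * (n%:R * beta_mixing U (q n) / (q n)%:R) = 2 * (n%:R / (q n)%:R) * beta_mixing U (q n).
  by ring.
by apply: ler_wpM2r => //; rewrite -natr1; lra.
Unshelve. all: end_near. Qed.

End block_sizes.

(** * Consistency of the mean of the estimated levels *)

Lemma ler_mean_dist {R : realType} (N : nat) (f g b : nat -> R) :
  (forall j, (1 <= j <= N)%N -> `|f j - g j| <= b j) ->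
  `|N%:R^-1 * (\sum_(1 <= j < N.+1) f j) - N%:R^-1 * (\sum_(1 <= j < N.+1) g j)|
    <= N%:R^-1 * (\sum_(1 <= j < N.+1) b j).
Proof.
move=> h; rewrite -mulrBr -sumrB normrM ger0_norm ?invr_ge0// ler_wpM2l ?invr_ge0//.
apply: (le_trans (ler_norm_sum _ _ _)); rewrite !big_nat; apply: ler_sum => j.
by rewrite ltnS; exact: h.
Qed.

Lemma mean_cst {R : realType} (N : nat) (a : R) : (0 < N)%N ->
  N%:R^-1 * (\sum_(1 <= j < N.+1) a) = a.
Proof.
move=> N0; rewrite sumr_const_nat subn1 -[a *+ _]mulr_natl mulrA mulVf ?mul1r//.
by rewrite pnatr_eq0 -lt0n.
Qed.

Lemma eventually_le_weaken {R : realType} (d : nat -> measure_display)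
  (T : forall n : nat, measurableType (d n)) (P : forall n : nat, probability (T n) R)
  e e' (B : forall n, set (T n)) : e <= e' -> eventually_le P e B -> eventually_le P e' B.
Proof.
move=> ee'; apply: filterS => n [C [mC BC PC]]; exists C; split => //.
by apply: le_trans PC _; rewrite lee_fin.
Qed.

Section That_measurable.
Context {R : realType} (d : nat -> measure_display) (T : forall n : nat, measurableType (d n))
  (P : forall n : nat, probability (T n) R)
  (X : forall n : nat, nat -> {RV (P n) >-> R}) (q : nat -> nat).

Lemma That_comparisons n : exists f : {ffun 'I_n * 'I_n -> bool} -> R,
  forall w : T n, That X q w = f (comparisons X w).
Proof.
case: (posnP (q n)) => [q0|q0].
  exists (fun=> 0) => w; rewrite /That /nblocks q0 divn0 invr0 mul0r//.
pose rk (x : {ffun 'I_n * 'I_n -> bool}) (i : nat) : R :=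
  if insub i.-1 is Some i' then n%:R^-1 * \sum_(j < n) (~~ x (i', j))%:R else 0.
exists (fun x => (nblocks q n)%:R^-1 * \sum_(1 <= j < (nblocks q n).+1) (q n)%:R *
  (1 - \big[Num.max/0]_((j - 1) * q n + 1 <= i < (j * q n).+1) rk x i)) => w.
congr (_ * _); rewrite big_nat [RHS]big_nat; apply: eq_bigr => j; rewrite ltnS => jk.
congr (_ * (1 - _)); rewrite /block_max big_nat [RHS]big_nat; apply: eq_bigr => i hi.
have [i' _ ->] := in_blockP q0 jk hi.
rewrite /rk /= valK /ecdf big_add1/= big_mkord.
by congr (_ * _); apply: eq_bigr => j' _; rewrite ffunE/= -leNgt.
Qed.

End That_measurable.

Section consistency.
Context {R : realType} (d : nat -> measure_display) (T : forall n : nat, measurableType (d n))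
  (P : forall n : nat, probability (T n) R)
  (X : forall n : nat, nat -> {RV (P n) >-> R})
  (d0 : measure_display) (T0 : measurableType d0) (P0 : probability T0 R)
  (U : int -> {RV P0 >-> R})
  (F : cumulativeBounded (0 : R) (1 : R)) (c A : R -> R) (cmin cmax : R).
Hypotheses (hmodel : model X F c U) (hF2 : second_order X F c A).
Hypotheses (hc : forall s : R, 0 <= s <= 1 -> cmin < c s <= cmax) (cmin0 : 0 < cmin).
Hypothesis hold : hoelder_half c.
Variables (theta : R) (q : nat -> nat).
Hypotheses (th : 0 < theta <= 1) (ext : extremal_index U theta).
Hypotheses (hq : block_size U q) (UI : block_integrability X q F).

Lemma beta_mixing_ge0 l : 0 <= beta_mixing U l.
Proof.
have := weakly_dependent_ge0 (exceed_weakly_dependent (l := l) hmodel 0 (ltn0Sn 0)).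
by lra.
Qed.

Lemma inv_c_hoelder : exists2 C : R, 0 <= C & forall x y, 0 <= x <= 1 -> 0 <= y <= 1 ->
  `|(c x)^-1 - (c y)^-1| <= C * Num.sqrt `|x - y|.
Proof.
have [Kc Kc0 hKc] := hold.
exists (Kc / cmin ^+ 2) => [|x y x01 y01]; first by rewrite divr_ge0 ?exprn_ge0// ltW.
have /andP[cx _] := hc x01; have /andP[cy _] := hc y01.
have cx0 := lt_trans cmin0 cx; have cy0 := lt_trans cmin0 cy.
have -> : (c x)^-1 - (c y)^-1 = (c y - c x) / (c x * c y) by field; rewrite !gt_eqF.
rewrite normrM [X in _ * X]ger0_norm ?invr_ge0 ?mulr_ge0 ?(ltW cx0) ?(ltW cy0)//.
rewrite distrC mulrAC; apply: ler_pM => //; first by rewrite invr_ge0 mulr_ge0 ?ltW.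
  exact: hKc.
by rewrite lef_pV2 ?posrE ?mulr_gt0 ?exprn_gt0// expr2; apply: ler_pM; exact: ltW.
Qed.

Lemma inv_c_integrable : lebesgue_measure.-integrable `[0, 1] (EFin \o (fun s => (c s)^-1)).
Proof.
apply: (@bounded_integrable _ _ _ cmin^-1) => //.
- by rewrite lebesgue_measure_itv/= lte_fin ltr01 oppr0 adde0 ltry.
- apply: (measurableT_comp measurable_inv).
  apply: measurable_realfun.subspace_continuous_measurable_fun; first exact: measurable_itv.
  exact: model_c_continuous hmodel.
move=> x /=; rewrite in_itv/= => /hc/andP[cx _]; have cx0 := lt_trans cmin0 cx.
by rewrite ger0_norm ?invr_ge0 ?(ltW cx0)// lef_pV2 ?posrE// ltW.
Qed.

Lemma inv_c_mean_cvg :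
  (nblocks q n)%:R^-1 * (\sum_(0 <= j < nblocks q n) (c (j.+1%:R / (nblocks q n)%:R))^-1)
    @[n --> \oo] --> tau c.
Proof.
have [C C0 hC] := inv_c_hoelder.
have kb := nblocks_cvg hq.
have h0 : C * Num.sqrt (nblocks q n)%:R^-1 @[n --> \oo] --> (0 : R).
  rewrite -[X in _ --> X](mulr0 C); apply: cvgMr; apply: sqrt_inv_cvg0.
  exact: (cvg_comp _ _ kb (@cvgr_idn R)).
apply/cvgrPdist_le => e e0; near=> n.
have k0 : (0 < nblocks q n)%N by near: n; move/cvgnyPgt: kb; exact.
have small : C * Num.sqrt (nblocks q n)%:R^-1 < e by near: n; exact: (cvgr_lt _ h0).
rewrite distrC big_mkord; apply: le_trans (ltW small).
exact: (hoelder_riemann_sum k0 C0 inv_c_integrable hC).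
Unshelve. all: end_near. Qed.

Section one_sample.
Variables (u : R -> R) (n m L : nat) (w : T n) (b eta : R).
Hypotheses (q0 : (0 < q n)%N) (n0 : (0 < n)%N) (k0 : (0 < nblocks q n)%N)
  (m0 : (0 < m)%N) (L0 : (0 < L)%N).
Hypothesis uE : forall y, 0 < y -> y <= L%:R -> (q n)%:R * (1 - F (u y)) = y.
Hypothesis count_close : forall a, (1 <= a <= L * m)%N ->
  `|(q n)%:R / n%:R * above X (u (a%:R / m%:R)) w - a%:R / m%:R| <= m%:R^-1.
Hypothesis dyadic : forall i, (i < (q n).+1)%N -> dyadic_count X F q i w <= b * 4 ^+ i.
Hypothesis b0 : 0 <= b.
Hypothesis quiet_close : forall a, (1 <= a <= L * m)%N ->
  `|(nblocks q n)%:R^-1 * (\sum_(0 <= j < nblocks q n) (quiet X q (u (a%:R / m%:R)) j w)%:R)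
   - (nblocks q n)%:R^-1 * (\sum_(0 <= j < nblocks q n)
        expR (- (theta * (c (j.+1%:R / (nblocks q n)%:R) * (a%:R / m%:R)))))| <= eta.

Let kk := nblocks q n.
Let mean (f : nat -> R) : R := kk%:R^-1 * \sum_(1 <= j < kk.+1) f j.
Let cj (j : nat) := c (j%:R / kk%:R).
Let kR : (0 : R) < kk%:R. Proof. by rewrite ltr0n. Qed.
Let mR : (0 : R) < m%:R. Proof. by rewrite ltr0n. Qed.

Let cj_range j : (1 <= j <= kk)%N -> cmin < cj j.
Proof.
move=> /andP[j1 jk]; have /hc/andP[] // : 0 <= (j%:R / kk%:R : R) <= 1.
by rewrite divr_ge0 ?(ltW kR)//= ler_pdivrMr// mul1r ler_nat.
Qed.

Let mean_Zhat : `|That X q w - mean (fun j => quiet_sum X q u j m L w)|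
  <= 2 / m%:R + 4 * b * large_squares X F q L%:R w.
Proof.
apply: le_trans (ler_mean_dist (b := fun j => 2 / m%:R + 4 * b *
   ((L%:R <= Zblock X q F j w)%R%:R * Zblock X q F j w ^+ 2)) _) _.
  by move=> j jk; exact: (block_comparison q0 n0 jk m0 L0 uE count_close dyadic b0).
rewrite big_split/= mulrDr mean_cst// lerD2l -mulr_sumr mulrCA; exact: lexx.
Qed.

Let exp_sum (j : nat) : R := m%:R^-1 * \sum_(1 <= a < (L * m).+1) expR (- (theta * cj j * (a%:R / m%:R))).

Let mean_quiet : `|mean (fun j => quiet_sum X q u j m L w) - mean exp_sum| <= L%:R * eta.
Proof.
have swap (f : nat -> nat -> R) : mean (fun j => m%:R^-1 * \sum_(1 <= a < (L * m).+1) f a j.-1)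
   = m%:R^-1 * \sum_(1 <= a < (L * m).+1) (kk%:R^-1 * \sum_(0 <= j < kk) f a j).
  rewrite /mean -!mulr_sumr mulrCA; congr (_ * (_ * _)).
  by rewrite big_add1/= exchange_big.
have -> : mean (fun j => quiet_sum X q u j m L w) =
   m%:R^-1 * \sum_(1 <= a < (L * m).+1) (kk%:R^-1 * \sum_(0 <= j < kk) (quiet X q (u (a%:R / m%:R)) j w)%:R).
  exact: (swap (fun a j => (quiet X q (u (a%:R / m%:R)) j w)%:R)).
have -> : mean exp_sum = m%:R^-1 * \sum_(1 <= a < (L * m).+1) (kk%:R^-1 * \sum_(0 <= j < kk)
    expR (- (theta * (c (j.+1%:R / kk%:R) * (a%:R / m%:R))))).
  rewrite -(swap (fun a j => expR (- (theta * (c (j.+1%:R / kk%:R) * (a%:R / m%:R)))))).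
  congr (_ * _); rewrite big_nat [RHS]big_nat; apply: eq_bigr => j /andP[j1 _].
  by congr (_ * _); apply: eq_bigr => a _; rewrite prednK// mulrA.
rewrite -mulrBr -sumrB normrM ger0_norm ?invr_ge0//.
rewrite mulrC ler_pdivrMr//; apply: (le_trans (ler_norm_sum _ _ _)).
apply: (@le_trans _ _ (\sum_(1 <= a < (L * m).+1) eta)).
  by rewrite big_nat [leRHS]big_nat; apply: ler_sum => a; rewrite ltnS; exact: quiet_close.
by rewrite sumr_const_nat subn1/= -[eta *+ _]mulr_natl natrM mulrAC.
Qed.

Let mean_exp : `|mean exp_sum - mean (fun j => (theta * cj j)^-1)|
  <= m%:R^-1 + ((theta * cmin) ^+ 2 * L%:R)^-1.
Proof.
have /andP[th0 _] := th; have LR : (0 : R) < L%:R by rewrite ltr0n.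
rewrite -[leRHS](mean_cst _ k0); apply: ler_mean_dist => j jk.
have cjm := cj_range jk; have cj0 := lt_trans cmin0 cjm.
have s0 : 0 < theta * cj j by rewrite mulr_gt0.
have := exp_riemann_upper (L * m) s0 m0; have := exp_riemann_lower s0 m0 L0.
rewrite -/(exp_sum j).
have : ((theta * cj j) ^+ 2 * L%:R)^-1 <= ((theta * cmin) ^+ 2 * L%:R)^-1.
  rewrite lef_pV2 ?posrE ?mulr_gt0 ?exprn_gt0 ?mulr_gt0// ler_pM2r//.
  rewrite lerXn2r ?nnegrE ?(ltW s0)//; first by rewrite mulr_ge0 ?ltW.
  by rewrite ler_pM2l// ltW.
have : 0 <= ((theta * cmin) ^+ 2 * L%:R)^-1 by rewrite invr_ge0 mulr_ge0// sqr_ge0.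
have : 0 < m%:R^-1 :> R by rewrite invr_gt0.
rewrite ler_norml => *; apply/andP; split; lra.
Qed.

(** Exchanging the average over the blocks with the sum over the grid leads from
the estimated levels to the proportions of quiet blocks at the levels of the
grid. Once these are replaced by their limits, the sum over the grid is a
Riemann sum of an exponential for each block. *)
Lemma That_close : `|That X q w - theta^-1 *
    (kk%:R^-1 * \sum_(0 <= j < kk) (c (j.+1%:R / kk%:R))^-1)|
  <= 3 / m%:R + 4 * b * large_squares X F q L%:R w + L%:R * eta
     + ((theta * cmin) ^+ 2 * L%:R)^-1.
Proof.
have -> : theta^-1 * (kk%:R^-1 * \sum_(0 <= j < kk) (c (j.+1%:R / kk%:R))^-1)
  = mean (fun j => (theta * cj j)^-1).
  rewrite /mean big_add1/= mulrCA mulr_sumr; congr (_ * _).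
  by apply: eq_bigr => j _; rewrite /cj invfM.
have := ler_distD (mean (fun j => quiet_sum X q u j m L w)) (That X q w) (mean (fun j => (theta * cj j)^-1)).
have := ler_distD (mean exp_sum) (mean (fun j => quiet_sum X q u j m L w)) (mean (fun j => (theta * cj j)^-1)).
move: mean_Zhat mean_quiet mean_exp.
have -> : 3 / m%:R = 2 / m%:R + m%:R^-1 :> R by field; rewrite gt_eqF.
lra.
Qed.

End one_sample.

Lemma block_count_lln y eta : 0 < y -> 0 < eta -> vanishing P (fun n => [set w | eta <
  `|(q n)%:R / n%:R * above X (level F (y / (q n)%:R)) w - y|]).
Proof.
move=> y0 eta0; pose kap (n : nat) : R := (q n)%:R^-1.
have kap0 : \forall n \near \oo, 0 < kap n.
  by near=> n; rewrite invr_gt0 ltr0n; near: n; exact: block_size_gt0 hq.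
have kap_cvg : kap n @[n --> \oo] --> (0 : R).
  apply/gtr0_cvgV0; last exact: (cvg_comp _ _ (block_infty hq) (@cvgr_idn R)).
  by near=> n; rewrite ltr0n; near: n; exact: block_size_gt0 hq.
have hrl : \forall n \near \oo, (0 < q n)%N && (q n <= q n)%N.
  by near=> n; rewrite leqnn andbT; near: n; exact: block_size_gt0 hq.
have := count_lln hmodel hF2 hc cmin0 hold kap0 kap_cvg hrl (nblocksS_mix hq beta_mixing_ge0)
  y0 (block_sq_small hq) eta0.
by apply: vanishing_sub; near=> n => w /=; rewrite /kap invfM invrK [n%:R^-1 * _]mulrC.
Unshelve. all: end_near. Qed.

Theorem That_consistent : cvg_in_prob P (That X q) (theta^-1 * tau c).
Proof.
apply: cvg_in_prob_vanishing.
  by near=> n => e; apply: measurable_through_comparisons; exact: That_comparisons.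
move=> e e0 p p0.
have /andP[th0 th1] := th.
have kb := nblocks_cvg hq.
have [C C0 hC] := dyadic_count_bound hmodel hF2 hc cmin0 q.
have k0 : \forall n \near \oo, (0 < nblocks q n)%N by move/cvgnyPgt: kb; exact.
have [delta delta0 [M M0 hM]] := large_squares_bound hmodel UI k0.
(* [b] bounds the dyadic counts with probability at least [1 - p / 4]; [L]
truncates the levels of the blocks and [m] is the fineness of the grid *)
pose b := 4 * (C + 1) / p.
have b0 : 0 < b by rewrite divr_gt0// mulr_gt0//; lra.
have Cb : C / b <= p / 4.
  rewrite ler_pdivrMr// /b; have -> : p / 4 * (4 * (C + 1) / p) = C + 1 by field; rewrite gt_eqF.
  lra.
pose rho := e / (16 * b).
have rho0 : 0 < rho by rewrite divr_gt0// mulr_gt0.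
have brho : 4 * b * rho = e / 4 by rewrite /rho; field; rewrite gt_eqF.
have [L [L0 LM Lth]] : exists L : nat, [/\ (0 < L)%N, M / (L%:R `^ delta * rho) <= p / 4
    & ((theta * cmin) ^+ 2 * L%:R)^-1 <= e / 8].
  pose t := M / (p / 4 * rho) + 1.
  have pr : 0 < p / 4 * rho by rewrite mulr_gt0// divr_gt0.
  have t0 : 0 < t by rewrite ltr_wpDl// divr_ge0// ltW.
  have tc2 : 0 < (theta * cmin) ^+ 2 by rewrite exprn_gt0// mulr_gt0.
  pose z := t `^ delta^-1 + 8 / (e * (theta * cmin) ^+ 2).
  have z1 : 0 < t `^ delta^-1 by exact: powR_gt0.
  have z2 : 0 < 8 / (e * (theta * cmin) ^+ 2) by rewrite divr_gt0// mulr_gt0.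
  have zL : z < (Num.truncn z).+1%:R by exact: Num.Theory.truncnS_gt.
  have zL1 : t `^ delta^-1 <= (Num.truncn z).+1%:R by rewrite /z in zL *; lra.
  have zL2 : 8 / (e * (theta * cmin) ^+ 2) <= (Num.truncn z).+1%:R by rewrite /z in zL *; lra.
  exists (Num.truncn z).+1; split => //.
    have tL : t <= (Num.truncn z).+1%:R `^ delta.
      apply: (@le_trans _ _ ((t `^ delta^-1) `^ delta)).
        by rewrite -powRrM mulVf ?gt_eqF// powRr1// ltW.
      by apply: ge0_ler_powR; rewrite ?nnegrE ?(ltW delta0) ?(ltW z1).
    have Ld := lt_le_trans t0 tL.
    have ML : M / (p / 4 * rho) <= (Num.truncn z).+1%:R `^ delta by rewrite /t in tL; lra.
    rewrite ler_pdivrMr// in ML; rewrite ler_pdivrMr; last by rewrite mulr_gt0.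
    by move: ML; set a := _ `^ _; rewrite (mulrCA a).
  rewrite -[leRHS]invrK lef_pV2 ?posrE ?mulr_gt0 ?invr_gt0 ?divr_gt0// invf_div.
  move: zL2; rewrite ler_pdivrMr ?mulr_gt0// ler_pdivrMr//.
  set S := _ ^+ 2; move/le_trans; apply; rewrite le_eqVlt; apply/orP; left; apply/eqP; ring.
have [m [m0 me]] : exists m : nat, (0 < m)%N /\ m%:R^-1 <= e / 16.
  exists (Num.truncn (16 / e)).+1; split => //.
  rewrite -[leRHS]invrK lef_pV2 ?posrE ?invr_gt0 ?divr_gt0// invf_div.
  by apply: ltW; exact: Num.Theory.truncnS_gt.
have LR : (0 : R) < L%:R by rewrite ltr0n.
have mR : (0 : R) < m%:R by rewrite ltr0n.
pose eta := e / (8 * L%:R).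
have eta0 : 0 < eta by rewrite divr_gt0// mulr_gt0.
have Leta : L%:R * eta = e / 8 by rewrite /eta; field; rewrite gt_eqF.
have lev a : 0 < (a.+1%:R / m%:R : R) by rewrite divr_gt0.
have mi : 0 < m%:R^-1 :> R by rewrite invr_gt0.
have V1 := vanishing_exists (N := (L * m)%N) (fun a _ => block_count_lln (lev a) mi).
have V2 := vanishing_exists (N := (L * m)%N) (fun a _ =>
  quiet_lln hmodel hF2 hc cmin0 hold th ext (block_infty hq) kb
    (nblocks_mix hq beta_mixing_ge0) (lev a) eta0).
have V3 := hC b b0 (block_size_gt0 hq).
have V4 := hM L%:R rho LR rho0.
have p4 : 0 < p / 4 by lra.
have V := eventually_leU (eventually_leU (V1 _ p4) (V2 _ p4)) (eventually_leU V3 V4).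
apply: eventually_le_weaken (_ : p / 4 + p / 4 + (C / b + M / (L%:R `^ delta * rho)) <= p) _; first by lra.
apply: eventually_le_sub V.
have qL : L%:R / (q n)%:R @[n --> \oo] --> (0 : R).
  rewrite -[X in _ --> X](mulr0 L%:R); apply: cvgMr; apply/gtr0_cvgV0.
    by near=> n; rewrite ltr0n; near: n; exact: block_size_gt0 hq.
  exact: (cvg_comp _ _ (block_infty hq) (@cvgr_idn R)).
have mc : theta^-1 * ((nblocks q n)%:R^-1 * (\sum_(0 <= j < nblocks q n) (c (j.+1%:R / (nblocks q n)%:R))^-1))
    @[n --> \oo] --> theta^-1 * tau c by apply: cvgMr; exact: inv_c_mean_cvg.
near=> n => w /= far.
have n0 : (0 < n)%N by near: n; exact: nbhs_infty_gt.
have q0 : (0 < q n)%N by near: n; exact: block_size_gt0 hq.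
have kn0 : (0 < nblocks q n)%N by near: n.
have qR : (0 : R) < (q n)%:R by rewrite ltr0n.
have Lq : L%:R / (q n)%:R < 1 :> R by near: n; apply: (cvgr_lt _ qL); exact: ltr01.
have mcn : `|theta^-1 * tau c - theta^-1 * ((nblocks q n)%:R^-1 *
    (\sum_(0 <= j < nblocks q n) (c (j.+1%:R / (nblocks q n)%:R))^-1))| <= e / 8.
  by near: n; move/cvgrPdist_le: mc; apply; rewrite divr_gt0.
apply: contrapT => /not_orP[/not_orP[n1 n2] /not_orP[n3 /negP n4]].
rewrite -ltNge in n4.
pose u y := level F (y / (q n)%:R).
have uE y : 0 < y -> y <= L%:R -> (q n)%:R * (1 - F (u y)) = y.
  move=> y0 yL; rewrite (levelE hmodel) ?divr_gt0//; first by field; rewrite gt_eqF.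
  by apply: le_lt_trans Lq; rewrite ler_pM2r// invr_gt0.
have cc a : (1 <= a <= L * m)%N -> `|(q n)%:R / n%:R * above X (u (a%:R / m%:R)) w - a%:R / m%:R| <= m%:R^-1.
  case: a => // a aL; rewrite leNgt; apply/negP => h; apply: n1; exists a => //.
have qc a : (1 <= a <= L * m)%N ->
  `|(nblocks q n)%:R^-1 * (\sum_(0 <= j < nblocks q n) (quiet X q (u (a%:R / m%:R)) j w)%:R)
   - (nblocks q n)%:R^-1 * (\sum_(0 <= j < nblocks q n)
        expR (- (theta * (c (j.+1%:R / (nblocks q n)%:R) * (a%:R / m%:R)))))| <= eta.
  case: a => // a aL; rewrite leNgt; apply/negP => h; apply: n2; exists a => //.
have dy i : (i < (q n).+1)%N -> dyadic_count X F q i w <= b * 4 ^+ i.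
  by move=> iq; rewrite leNgt; apply/negP => /ltW h; apply: n3; exists i.
have := That_close q0 n0 kn0 m0 L0 uE cc dy (ltW b0) qc.
set a1 := That X q w in far *; set a2 := theta^-1 * (_ * _) in mcn *.
move: far mcn; have := ler_distD a2 a1 (theta^-1 * tau c); rewrite [`|a2 - _|]distrC.
have : 4 * b * large_squares X F q L%:R w <= e / 4.
  by rewrite -brho; apply: ler_wpM2l (ltW n4); rewrite mulr_ge0 ?(ltW b0).
lra.
Unshelve. all: end_near. Qed.

End consistency.

(** * Ratios and rates *)

Section ratio.
Context {R : realType} (d : nat -> measure_display) (T : forall n : nat, measurableType (d n))
  (P : forall n : nat, probability (T n) R).

Lemma vanishing_cvg_in_prob (Y : forall n, T n -> R) (a : R) :
  (\forall n \near \oo, forall e, measurable [set w | e < `|Y n w - a|]) ->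
  cvg_in_prob P Y a -> forall e, 0 < e -> vanishing P (fun n => [set w | e < `|Y n w - a|]).
Proof.
move=> mY Ya e e0 p p0; have /fine_cvgP[_ lim] := Ya e e0.
near=> n; exists [set w | e < `|Y n w - a|]; split => //.
  by have : forall e, measurable [set w | e < `|Y n w - a|] by near: n.
have me : measurable [set w | e < `|Y n w - a|].
  by have : forall e, measurable [set w | e < `|Y n w - a|] by near: n.
rewrite -[leLHS]fineK ?fin_num_measure// lee_fin; apply: ltW.
by near: n; exact: (cvgr_lt _ lim).
Unshelve. all: end_near. Qed.

Lemma ratio_stable (a b e y z : R) : 0 < a -> 0 <= b -> 0 < e ->
  `|y - a| <= Num.min (a / 2) (e * a ^+ 2 / (2 * (a + b))) ->
  `|z - b| <= Num.min (a / 2) (e * a ^+ 2 / (2 * (a + b))) -> `|y^-1 * z - a^-1 * b| <= e.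
Proof.
move=> a0 b0 e0; rewrite !le_min => /andP[ya1 ya2] /andP[_ zb].
have y2 : a / 2 <= y by move: ya1; rewrite ler_norml; lra.
have y0 : 0 < y by lra.
have ab : 0 < a + b by lra.
set dl := e * a ^+ 2 / (2 * (a + b)) in ya2 zb.
have dE : (a + b) * dl = e * (a * (a / 2)) by rewrite /dl; field; rewrite gt_eqF.
have -> : y^-1 * z - a^-1 * b = (a * (z - b) - b * (y - a)) / (a * y) by field; rewrite !gt_eqF.
rewrite normrM [X in _ * X]ger0_norm ?invr_ge0 ?mulr_ge0 ?(ltW a0) ?(ltW y0)//.
rewrite ler_pdivrMr ?mulr_gt0//; apply: (@le_trans _ _ (a * dl + b * dl)).
  apply: (le_trans (ler_normB _ _)); rewrite !normrM (gtr0_norm a0) (ger0_norm b0).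
  by apply: lerD; [rewrite ler_pM2l|rewrite ler_wpM2l].
by rewrite -mulrDl dE !ler_pM2l.
Qed.

Lemma cvg_in_prob_ratio (Y Z : forall n, T n -> R) (a b : R) : 0 < a -> 0 <= b ->
  (\forall n \near \oo, forall e, measurable [set w | e < `|Y n w - a|]) ->
  (\forall n \near \oo, forall e, measurable [set w | e < `|Z n w - b|]) ->
  (\forall n \near \oo, forall e, measurable [set w | e < `|(Y n w)^-1 * Z n w - a^-1 * b|]) ->
  cvg_in_prob P Y a -> cvg_in_prob P Z b ->
  cvg_in_prob P (fun n w => (Y n w)^-1 * Z n w) (a^-1 * b).
Proof.
move=> a0 b0 mY mZ mYZ Ya Zb; apply: cvg_in_prob_vanishing => // e e0.
pose dl := Num.min (a / 2) (e * a ^+ 2 / (2 * (a + b))).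
have dl0 : 0 < dl.
  by rewrite lt_min !divr_gt0 ?mulr_gt0 ?exprn_gt0//; lra.
apply: vanishing_sub (vanishingU (vanishing_cvg_in_prob mY Ya dl0) (vanishing_cvg_in_prob mZ Zb dl0)).
near=> n => w /= far; apply: contrapT => /not_orP[/negP + /negP]; rewrite -!leNgt => y1 z1.
by have := ratio_stable a0 b0 e0 y1 z1; rewrite leNgt far.
Unshelve. all: end_near. Qed.

End ratio.

Section rates.
Context {R : realType} (d0 : measure_display) (T0 : measurableType d0) (P0 : probability T0 R)
  (U : int -> {RV P0 >-> R}).
Variables (k l r : nat -> nat) (h : nat -> R).
Hypotheses (hk : intermediate_sequence R k) (hm : mixing_cond U k l r) (hb : bandwidth k r h).
Hypothesis beta0 : forall n, 0 <= beta_mixing U n.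

Lemma intermediate_range : \forall n \near \oo, (0 < k n)%N && (k n < n)%N.
Proof.
have [_ ki kn] := hk; near=> n.
have n0 : (0 < n)%N by near: n; exact: nbhs_infty_gt.
apply/andP; split; first by near: n; move/cvgnyPgt: ki; exact.
have : (k n)%:R / n%:R < 1 :> R by near: n; apply: (cvgr_lt _ kn); exact: ltr01.
by rewrite ltr_pdivrMr ?ltr0n// mul1r ltr_nat.
Unshelve. all: end_near. Qed.

Lemma mixing_order : \forall n \near \oo, (0 < r n)%N && (l n <= r n)%N.
Proof.
apply: filterS (mix_order hm) => n [l1 lr _].
by rewrite (ltnW lr) andbT (leq_ltn_trans (leq0n _) lr).
Qed.

Lemma mixing_blocks : (n %/ r n).+1%:R * beta_mixing U (l n) @[n --> \oo] --> (0 : R).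
Proof.
have h2 : 2 * (n%:R / (r n)%:R * beta_mixing U (l n)) @[n --> \oo] --> (0 : R).
  by rewrite -[X in _ --> X](mulr0 2); apply: cvgMr; exact: mix_beta_rate hm.
apply: (squeeze_cvgr _ (cvg_cst 0) h2); near=> n.
have [l1 lr rn] : [/\ 1 < l n, l n < r n & r n < n]%N by near: n; exact: mix_order hm.
have r0 : (0 < r n)%N by exact: leq_ltn_trans lr.
have rR : (0 : R) < (r n)%:R by rewrite ltr0n.
rewrite mulr_ge0//= mulrA ler_wpM2r//.
have a1 : (n %/ r n)%:R <= n%:R / (r n)%:R :> R.
  by rewrite ler_pdivlMr// -natrM ler_nat; exact: leq_trunc_div.
have a2 : 1 <= n%:R / (r n)%:R :> R by rewrite ler_pdivlMr// mul1r ler_nat ltnW.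
by rewrite -natr1; lra.
Unshelve. all: end_near. Qed.

Lemma mixing_small : (r n)%:R / (k n)%:R @[n --> \oo] --> (0 : R).
Proof.
apply: (squeeze_cvgr _ (cvg_cst 0) (mix_r_small hm)); near=> n.
have /andP[k0 kn] : (0 < k n)%N && (k n < n)%N by near: n; exact: intermediate_range.
have kR : (1 : R) <= (k n)%:R by rewrite ler1n.
have kR0 : (0 : R) < (k n)%:R by rewrite ltr0n.
have nR : (0 : R) < n%:R by rewrite ltr0n; exact: leq_trans kn.
rewrite divr_ge0//= ler_wpM2l// lef_pV2 ?posrE//; last by rewrite lt_min sqrtr_gt0 kR0 divr_gt0.
rewrite ge_min; apply/orP; left.
rewrite -[leRHS](ger0_norm (ltW kR0)) -sqrtr_sqr ler_wsqrtr// expr2 ler_peMr//; exact: ltW.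
Unshelve. all: end_near. Qed.

Lemma bandwidth_inv : (n%:R * h n)^-1 @[n --> \oo] --> (0 : R).
Proof.
have kh : ((k n)%:R * h n)^-1 @[n --> \oo] --> (0 : R).
  apply/gtr0_cvgV0; last exact: band_kh hb.
  near=> n; have /andP[k0 _] : (0 < k n)%N && (k n < n)%N by near: n; exact: intermediate_range.
  by rewrite mulr_gt0 ?ltr0n//; exact: band_positive hb n.
apply: (squeeze_cvgr _ (cvg_cst 0) kh); near=> n.
have /andP[k0 kn] : (0 < k n)%N && (k n < n)%N by near: n; exact: intermediate_range.
have h0 := band_positive hb n; have kR0 : (0 : R) < (k n)%:R by rewrite ltr0n.
have nR : (0 : R) < n%:R by rewrite ltr0n; exact: leq_trans kn.
rewrite invr_ge0 mulr_ge0 ?(ltW h0)//= lef_pV2 ?posrE ?mulr_gt0//.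
by rewrite ler_wpM2r ?(ltW h0)// ler_nat ltnW.
Unshelve. all: end_near. Qed.

Lemma bandwidth_blocks : (r n)%:R / ((k n)%:R * h n) @[n --> \oo] --> (0 : R).
Proof.
have h2 : (r n)%:R / Num.sqrt ((k n)%:R * h n) * Num.sqrt ((k n)%:R * h n)^-1 @[n --> \oo] --> (0 : R).
  rewrite -[X in _ --> X](mulr0 0); apply: cvgM; first exact: band_r hb.
  by apply: sqrt_inv_cvg0; exact: band_kh hb.
apply: cvg_trans h2; apply: near_eq_cvg; near=> n.
have kh : 0 <= (k n)%:R * h n by rewrite mulr_ge0// ltW//; exact: band_positive hb n.
by rewrite sqrtrV// -mulrA -invfM -[Num.sqrt _ * _]expr2 sqr_sqrtr.
Unshelve. all: end_near. Qed.

End rates.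

Lemma tau_gt0 {R : realType} (c : R -> R) (cmin cmax : R) :
  lebesgue_measure.-integrable `[0, 1] (EFin \o (fun s => (c s)^-1)) -> 0 < cmin ->
  (forall s : R, 0 <= s <= 1 -> cmin < c s <= cmax) -> 0 < tau c.
Proof.
move=> ic cmin0 hc.
have cmax0 : 0 < cmax.
  have := hc (0 : R); rewrite lexx ler01 => /(_ isT)/andP[c1 c2].
  exact: lt_trans cmin0 (lt_le_trans c1 c2).
have m01 : fine ((@lebesgue_measure R) `[0, 1]%classic) = 1.
  by rewrite lebesgue_measure_itv/= lte_fin ltr01 oppr0 adde0.
apply: (@lt_le_trans _ _ cmax^-1); first by rewrite invr_gt0.
have <- : \int[lebesgue_measure]_(s in `[0, 1]) (cst cmax^-1 : R -> R) s = cmax^-1.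
  by rewrite Rintegral_cst// m01 mulr1.
apply: le_Rintegral => //.
  apply: (@bounded_integrable _ _ _ cmax^-1) => //.
    by rewrite lebesgue_measure_itv/= lte_fin ltr01 oppr0 adde0 ltry.
  by move=> x _ /=; rewrite ger0_norm// invr_ge0 ltW.
move=> x /=; rewrite in_itv/= => /hc/andP[cx1 cx2].
by rewrite lef_pV2 ?posrE// (lt_trans cmin0 cx1).
Qed.

Unset Implicit Arguments.
Theorem theorem5p3 (R : realType)
  (d : nat -> measure_display) (T : forall n : nat, measurableType (d n))
  (P : forall n : nat, probability (T n) R)
  (X : forall n : nat, nat -> {RV (P n) >-> R})
  (d0 : measure_display) (T0 : measurableType d0) (P0 : probability T0 R)
  (U : int -> {RV P0 >-> R})
  (F : cumulativeBounded (0 : R) (1 : R)) (c : R -> R) (A : R -> R)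
  (K : R -> R) (cmin kappa theta : R)
  (k l r l' r' q : nat -> nat) (h : nat -> R) :
  model X F c U ->
  pareto_regularly_varying U ->
  hoelder_half c ->
  C2_01 c ->
  kernel_function K ->
  [lipschitz K x | x in `[-1, 1]] ->
  0 < cmin -> (forall s : R, 0 <= s <= 1 -> cmin < c s) ->
  0 < kappa < cmin ->
  [/\ (intermediate_sequence R k ->
       mixing_cond U k l r -> moment_cond U c k r 2 ->
       increment_cond U c k r 2 ->
       second_order X F c A -> bandwidth k r h -> bias_cond A k 2 ->
       cvg_in_prob P (tauhat X K k h kappa) (tau c)),
      (mixing_cond U (nblocks q) l' r' ->
       (forall L, (0 < L)%N -> moment_cond U c (nblocks q) r' L) ->
       (forall L, (0 < L)%N -> increment_cond U c (nblocks q) r' L) ->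
       second_order X F c A ->
       (forall L, (0 < L)%N -> bias_cond A (nblocks q) L) ->
       0 < theta <= 1 -> extremal_index U theta -> block_size U q ->
       block_integrability X q F ->
       cvg_in_prob P (That X q) (theta^-1 * tau c))
    & (second_order X F c A ->
       intermediate_sequence R k ->
       mixing_cond U k l r -> moment_cond U c k r 2 ->
       increment_cond U c k r 2 ->
       bandwidth k r h -> bias_cond A k 2 ->
       0 < theta <= 1 -> extremal_index U theta -> block_size U q ->
       block_integrability X q F ->
       mixing_cond U (nblocks q) l' r' ->
       (forall L, (0 < L)%N -> moment_cond U c (nblocks q) r' L) ->
       (forall L, (0 < L)%N -> increment_cond U c (nblocks q) r' L) ->
       (forall L, (0 < L)%N -> bias_cond A (nblocks q) L) ->
       cvg_in_prob P (thetahat X K k h kappa q) theta)].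
Proof.
move=> hmodel _ hold _ hK LK cmin0 hcmin /andP[kappa0 kappac].
have beta0 : forall n, 0 <= beta_mixing U n by exact: beta_mixing_ge0 hmodel.
have [cmax hc] : exists cmax, forall s : R, 0 <= s <= 1 -> cmin < c s <= cmax.
  have [M [_ hM]] := model_c_bounded hmodel.
  exists (M + 1) => s s01; rewrite hcmin//=; apply: (le_trans (ler_norm _)).
  apply: hM; first by rewrite ltrDl.
  by rewrite /= in_itv.
have a : intermediate_sequence R k -> mixing_cond U k l r -> second_order X F c A ->
    bandwidth k r h -> cvg_in_prob P (tauhat X K k h kappa) (tau c).
  move=> hk hm h2 hb.
  apply: (tauhat_consistent hmodel h2 hc cmin0 hold hK LK (l := l) (r := r)) => //.
  - exact: intermediate_range hk.
  - by case: hk.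
  - exact: mixing_order hm.
  - exact: mixing_blocks hm beta0.
  - exact: mixing_small hk hm.
  - exact: band_positive hb.
  - exact: band_zero hb.
  - exact: bandwidth_inv hk hb.
  - exact: bandwidth_blocks hb.
have b : second_order X F c A -> 0 < theta <= 1 -> extremal_index U theta -> block_size U q ->
    block_integrability X q F -> cvg_in_prob P (That X q) (theta^-1 * tau c).
  by move=> h2 th ext hq UI; exact: (That_consistent hmodel h2 hc cmin0 hold th ext hq).
split.
- by move=> hk hm _ _ h2 hb _; exact: a.
- by move=> _ _ _ h2 _ th ext hq UI; exact: b.
move=> h2 hk hm _ _ hb _ th ext hq UI _ _ _ _.
have tau0 := tau_gt0 (inv_c_integrable hmodel hc cmin0) cmin0 hc.
have /andP[th0 _] := th.
have E : (theta^-1 * tau c)^-1 * tau c = theta by field; rewrite !gt_eqF.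
have kr := intermediate_range hk.
rewrite -[X in cvg_in_prob _ _ X]E.
apply: cvg_in_prob_ratio (b h2 th ext hq UI) (a hk hm h2 hb).
- by rewrite mulr_gt0 ?invr_gt0.
- exact: ltW.
- near=> n => e; apply: measurable_through_comparisons; exact: That_comparisons.
- near=> n => e; apply: measurable_through_comparisons; apply: tauhat_comparisons.
  by have /andP[] : (0 < k n)%N && (k n < n)%N by near: n.
near=> n => e; apply: measurable_through_comparisons.
have [f hf] := That_comparisons X q n.
have kn : (k n < n)%N by have /andP[] : (0 < k n)%N && (k n < n)%N by near: n.
have [g hg] := tauhat_comparisons X K h kappa kn.
by exists (fun x => (f x)^-1 * g x) => w; rewrite hf hg.
Unshelve. all: end_near. Qed.
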